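(* With $\widehat H$, $\xi_n$, $I$, $\rho_n$, $\rho_\infty$ as below, \[ \mathbb P\Big(\rho_n\to\rho_\infty\text{ uniformly on compact subsets of } I\ \text{ and }\ \lim_{n\to\infty}\inf_{u\in(0,1)\setminus I}\rho_n(u)=\infty\Big)=1, \] where the infimum over the empty set is $+\infty$.
   Context: For $H\in(0,1)$ let $f_H(\lambda)=C_H|e^{i\lambda}-1|^2\sum_{k\in\mathbb Z}|\lambda-2\pi k|^{-(2H+1)}$, $\lambda\in[-\pi,\pi)$, with $C_H>0$ the normalizing constant making $f_H$ the spectral density of fractional Gaussian noise. For integrable $g$, $\hat g(m)=\frac1{2\pi}\int_{-\pi}^{\pi}e^{-imt}g(t)dt$, $T_n(g)=(\hat g(j-k))_{j,k=1}^n$. Fix $\widehat H\in(0,1)$, let $\xi_n\sim N(0,T_n(f_{\widehat H}))$ on a common probability space, $I=(\widehat H-\frac12,1)\cap(0,1)$, $\rho_n(u)=n^{-1}\langle\xi_n,T_n(f_u)^{-1}\xi_n\rangle$ for $u\in(0,1)$, and $\rho_\infty(u)=\frac1{2\pi}\int_{-\pi}^{\pi}f_{\widehat H}(t)/f_u(t)\,dt$ for $u\in I$. *)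

(* Defs.v *)
From HB Require Import structures.
From mathcomp Require Import all_boot all_order all_algebra.
From mathcomp Require Import all_classical all_reals all_analysis.
Set Implicit Arguments. Unset Strict Implicit. Unset Printing Implicit Defensive.
Import Order.TTheory GRing.Theory Num.Theory.
Import numFieldNormedType.Exports.
Local Open Scope classical_set_scope.
Local Open Scope ring_scope.

Section Defs.
Variable R : realType.

(* Fourier coefficient  g^(m) = (1/2pi) int_{-pi}^{pi} e^{-imt} g(t) dt,
   written for real-valued g through its real part
   (1/2pi) int cos(mt) g(t) dt; for the even functions f_H used below
   the imaginary part vanishes, so this is exactly g^(m). *)
Definition fcoef (g : R -> R) (m : int) : R :=
  (pi *+ 2)^-1 * Rintegral lebesgue_measure `[- pi, pi[
                   (fun t => cos (m%:~R * t) * g t).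

Definition toeplitz (n : nat) (g : R -> R) : 'M[R]_n :=
  \matrix_(j < n, k < n) fcoef g (j%:Z - k%:Z).

(* unnormalised fGn spectral density:
   |e^{i l} - 1|^2 * sum_{k in Z} |l - 2 pi k|^{-(2H+1)},
   with |e^{i l} - 1|^2 = 2 - 2 cos l *)
Definition fgn_unnorm (H : R) (l : R) : R :=
  (2 - 2 * cos l) *
  fine (\esum_(k in [set: int]) ((`|l - pi *+ 2 * k%:~R|) `^ (- (2 * H + 1)))%:E)%E.

(* normalising constant C_H: makes the variance g^(0) equal to 1 *)
Definition C_fgn (H : R) : R := (fcoef (fgn_unnorm H) 0)^-1.

Definition f_fgn (H : R) (l : R) : R := C_fgn H * fgn_unnorm H l.

Definition centered_gaussian_vector d (Omega : measurableType d)
    (P : probability Omega R) (n : nat) (X : Omega -> 'cV[R]_n)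
    (S : 'M[R]_n) : Prop :=
  (forall i : 'I_n, measurable_fun setT (fun w => X w i ord0)) /\
  (forall a : 'cV[R]_n, a != 0 -> forall B : set R, measurable B ->
     P ((fun w => (a^T *m X w) ord0 ord0) @^-1` B)
     = normal_prob 0 (Num.sqrt ((a^T *m S *m a) ord0 ord0)) B).

Definition rho_n (n : nat) (x : 'cV[R]_n) (u : R) : R :=
  (n%:R)^-1 * (x^T *m invmx (toeplitz n (f_fgn u)) *m x) ord0 ord0.

Definition rho_infty (Hh u : R) : R :=
  (pi *+ 2)^-1 * Rintegral lebesgue_measure `[- pi, pi[
                   (fun t => f_fgn Hh t / f_fgn u t).

Definition I_set (Hh : R) : set R :=
  [set u | Hh - 2^-1 < u /\ u < 1 /\ 0 < u].

End Defs.

(* Main.v *)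
(* Write g_u for the unnormalized density, so that f_u = C_u g_u and rho_n(u) = C_u^-1 n^-1 <xi_n, T_n(g_u)^-1 xi_n>.

   For fixed u in I the quadratic form concentrates around its mean tr(T_n(g_u)^-1 T_n(f)), f being the density of xi_n: a decoupling of the exponential moments, one rank-one term of T_n(g_u)^-1 at a time, bounds the deviation probability at scale n by 2 exp(- c n^(1 - a - b)), where a and b are the exponents in f(t) <= C |t|^-a and g_u(t) >= c |t|^b; a + b < 1 is exactly the condition u > Hh - 1/2.

   The mean divided by n is the integral of f k_n with k_n(l) = n^-1 e_l^* T_n(g_u)^-1 e_l, e_l = (exp(ijl))_j. Since 1 / (F_n * g) <= k_n <= F_n * (1 / g) for the Fejer kernel F_n, k_n tends to 1 / g pointwise off the origin, and k_n(l) <= K |l|^-b allows dominated convergence.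

   Uniformity in u comes from monotonicity: g_u <= (1 + K (v - u)) g_v for u < v transfers to the inverse Toeplitz forms, so convergence at rational points controls everything in between. For u <= Hh - 1/2 one has f_u <= C g_v with C independent of u, hence rho_n(u) >= C^-1 n^-1 <xi_n, T_n(g_v)^-1 xi_n> for v slightly above Hh - 1/2, and the limit of the right-hand side blows up as v decreases to Hh - 1/2. *)

Require Import Defs.
From HB Require Import structures.
From mathcomp Require Import all_boot all_order all_algebra.
From mathcomp Require Import all_classical all_reals all_analysis.
From mathcomp Require Import measurable_realfun ring lra zify.
Import Order.TTheory GRing.Theory Num.Theory.
Import numFieldNormedType.Exports.
Local Open Scope classical_set_scope.
Local Open Scope ring_scope.
Set Implicit Arguments. Unset Strict Implicit. Unset Printing Implicit Defensive.

(** * Gaussian integrals *)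

(** Of each vector only the laws of its linear forms [dot a (X w)] are given. The argument therefore
    uses neither a joint density nor a diagonalization, only the averages of [expR] and [cos] of
    linear forms. For the upper tail, exp(t (b.X)^2) is a Gaussian average of exponentials. For the
    lower tail, exp(- t (b.X)^2) is a Gaussian average of characteristic functions, and [cos] keeps
    these real. Both tails share one argument, with a function [e] and a sign [s] as parameters.

    Nothing is assumed on the joint law for different n, so almost sure convergence rests on
    summable deviation probabilities. If T_n(f) <= L T_n(g_u), the bound is exp(- t r + 10 t^2 L m).
    Since L has order n^(a + b) and the trace m has order n, at r = eps n the right t has order
    n^-(a + b).

    The constant C_u is split off because the comparison in u is clean for g_u as long as u stays
    away from 0. Near 0 the tail of the series defining g_u blows up, and only the normalized f_u
    has a bound uniform in u; the divergence outside I depends on that bound. *)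

Section Density.
Import HBNNSimple.
Context d (T : measurableType d) (R : realType).
Variables (mu nu : {measure set T -> \bar R}) (p : T -> R).
Hypothesis mp : measurable_fun setT p.
Hypothesis p0 : forall x, 0 <= p x.
Hypothesis nuE : forall A, measurable A -> nu A = (\int[mu]_(x in A) (p x)%:E)%E.

Let density_nnsfun (f : {nnsfun T >-> R}) :
  (\int[nu]_x (f x)%:E = \int[mu]_x (f x * p x)%:E)%E.
Proof.
under [LHS]eq_integral do rewrite fimfunE -fsumEFin//.
rewrite [LHS]ge0_integral_fsum//; last 2 first.
  - by move=> r; exact/measurable_EFinP/measurableT_comp.
  - by move=> n x _; rewrite EFinM nnfun_muleindic_ge0.
under [RHS]eq_integral.
  move=> x _; rewrite EFinM fimfunE -fsumEFin// muleC ge0_mule_fsumr; last first.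
    by move=> r; rewrite EFinM nnfun_muleindic_ge0.
  over.
rewrite [RHS]ge0_integral_fsum//; last 2 first.
  - move=> r; apply: emeasurable_funM; first exact/measurable_EFinP.
    by apply/measurable_EFinP; apply/measurableT_comp => //.
  - move=> n x _; rewrite mule_ge0//; first by rewrite lee_fin.
    by rewrite EFinM nnfun_muleindic_ge0.
apply: eq_fsbigr => r; rewrite inE => -[t _ <-].
rewrite integralZl_indic_nnsfun// integral_indic// setIT nuE//.
rewrite integral_mkcond -ge0_integralZl//; last 3 first.
  - apply/(measurable_restrictT _ _).1 => //.
    exact/measurable_EFinP/measurable_funTS.
  - by move=> x _; apply: erestrict_ge0 => y _; rewrite lee_fin.
  - by rewrite lee_fin.
apply: eq_integral => x _; rewrite patchE indicE.
case: ifPn => xA; last by rewrite mulr0 !mule0.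
by rewrite mulr1 muleC.
Qed.

(** Known for indicators by [nuE]; simple functions and monotone convergence along [nnsfun_approx]
    do the rest. It turns the expectation of a function of one linear form into a Lebesgue
    integral. *)
Lemma ge0_integral_density (f : T -> R) :
  measurable_fun setT f -> (forall x, 0 <= f x) ->
  (\int[nu]_x (f x)%:E = \int[mu]_x (f x * p x)%:E)%E.
Proof.
move=> mf f0.
have mf' : measurable_fun setT (EFin \o f) by exact/measurable_EFinP.
pose g := nnsfun_approx measurableT mf'.
have gf x : (g n x)%:E @[n --> \oo] --> (f x)%:E.
  by apply: (@cvg_nnsfun_approx _ _ _ _ measurableT _ mf') => // y _; rewrite lee_fin.
have ndg x : {homo (fun n => (g n x)) : a b / (a <= b)%N >-> a <= b}.
  by move=> a b ab; exact/lefP/nd_nnsfun_approx.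
transitivity (limn (fun n => \int[nu]_x (g n x)%:E)%E).
  rewrite -monotone_convergence//=.
  - by apply: eq_integral => x _; apply/esym/cvg_lim.
  - by move=> n; exact/measurable_EFinP/measurable_funTS.
  - by move=> n x _; rewrite lee_fin.
  - by move=> x _ a b ab; rewrite lee_fin ndg.
transitivity (limn (fun n => \int[mu]_x (g n x * p x)%:E)%E).
  by apply: congr_lim; apply/funext => n /=; exact: density_nnsfun.
rewrite -monotone_convergence//=.
- apply: eq_integral => x _; apply/cvg_lim => //.
  under eq_fun do rewrite EFinM muleC.
  rewrite EFinM muleC.
  by apply: cvgeZl => //; exact: gf.
- by move=> n; apply/measurable_EFinP/measurable_funM.
- by move=> n x _; rewrite lee_fin mulr_ge0.
- by move=> x _ a b ab; rewrite lee_fin ler_wpM2r// ndg.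
Qed.

End Density.

(** * Exponential moments of the normal density *)

Section Gauss1D.
Variable R : realType.
Notation mu := (@lebesgue_measure R).
Implicit Types s a b x k : R.

(** Completing the square: the tilted exponent belongs to the normal density of variance [s' ^+ 2]
    and mean [b * s' ^+ 2], and [s' / s] is the ratio of the two peaks. *)
Lemma normal_pdf_tilt s s' a b x : 0 < s -> 0 < s' -> s' ^- 2 = s ^- 2 - a ->
  normal_pdf 0 s x * expR (b * x + a * x ^+ 2 / 2) =
  s' / s * expR (b ^+ 2 * s' ^+ 2 / 2) * normal_pdf (b * s' ^+ 2) s' x.
Proof.
move=> s0 s'0 ss'.
rewrite !normal_pdfE ?gt_eqF// /normal_peak /normal_fun.
rewrite -!mulrnAr (sqrtrM _ (sqr_ge0 s)) (sqrtrM _ (sqr_ge0 s')) !sqrtr_sqr !gtr0_norm//.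
have p0 : Num.sqrt (pi *+ 2) != 0 :> R.
  by rewrite sqrtr_eq0 -ltNge mulrn_wgt0// pi_gt0.
set e1 := expR _; set e2 := expR _; set e3 := expR _; set e4 := expR _.
have e1234 : e1 * e2 = e3 * e4.
  rewrite -!expRD; congr expR.
  have -> : a = s ^- 2 - s' ^- 2 by rewrite ss'; ring.
  by field; rewrite !gt_eqF.
by rewrite -(mulrA _ e1 e2) e1234; field; rewrite p0 !gt_eqF.
Qed.

Lemma integral_normal_pdf_tilt s s' a b :
  0 < s -> 0 < s' -> s' ^- 2 = s ^- 2 - a ->
  (\int[mu]_x (normal_pdf 0 s x * expR (b * x + a * x ^+ 2 / 2))%:E =
   (s' / s * expR (b ^+ 2 * s' ^+ 2 / 2))%:E)%E.
Proof.
move=> s0 s'0 ss'; under eq_integral do rewrite (normal_pdf_tilt _ _ s0 s'0 ss') EFinM.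
rewrite ge0_integralZl//.
- by rewrite integral_normal_pdf mule1.
- by apply/measurable_EFinP; exact: measurable_normal_pdf.
- by move=> x _; rewrite lee_fin normal_pdf_ge0.
- by rewrite lee_fin mulr_ge0 ?expR_ge0// divr_ge0// ltW.
Qed.

Lemma integral_normal_pdf_expR s b : 0 < s ->
  (\int[mu]_x (normal_pdf 0 s x * expR (b * x))%:E =
   (expR (b ^+ 2 * s ^+ 2 / 2))%:E)%E.
Proof.
move=> s0; have := @integral_normal_pdf_tilt s s 0 b s0 s0 (esym (subr0 _)).
rewrite (divff (lt0r_neq0 s0)) mul1r => <-.
by apply: eq_integral => x _; rewrite !mul0r addr0.
Qed.

Lemma integrable_normal_pdf_expR s b : 0 < s ->
  mu.-integrable setT (fun x => (normal_pdf 0 s x * expR (b * x))%:E).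
Proof.
move=> s0; apply/integrableP; split.
  apply/measurable_EFinP/measurable_funM; first exact: measurable_normal_pdf.
  by apply: measurableT_comp => //; apply: measurable_funM.
under eq_integral do rewrite gee0_abs ?lee_fin ?mulr_ge0 ?normal_pdf_ge0 ?expR_ge0//.
by rewrite integral_normal_pdf_expR// ltry.
Qed.

Lemma integrable_normal_pdf_id s : 0 < s ->
  mu.-integrable setT (fun x => (normal_pdf 0 s x * `|x|)%:E).
Proof.
move=> s0.
(* [|x| <= expR x + expR (- x)], from [1 + y <= expR y] at [x] and at [- x]. *)
apply: (@le_integrable _ _ _ mu _ _ _ (fun x => (normal_pdf 0 s x * expR (1 * x))%:E + (normal_pdf 0 s x * expR (-1 * x))%:E)%E) => //.
- apply/measurable_EFinP/measurable_funM; first exact: measurable_normal_pdf.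
  exact: normr_measurable.
- move=> x _; rewrite -EFinD !abse_EFin lee_fin -mulrDr !normrM.
  apply: ler_wpM2l => //; rewrite normr_id mul1r mulN1r.
  rewrite (@ger0_norm _ (_ + _)); last by rewrite addr_ge0 ?expR_ge0.
  have := expR_ge1Dx x; have := expR_ge1Dx (- x).
  have := expR_ge0 x; have := expR_ge0 (-x).
  case: (ger0P x); lra.
- by apply: integrableD => //; exact: integrable_normal_pdf_expR.
Qed.

Lemma ge0_integral_opp (h : R -> \bar R) : measurable_fun setT h -> (forall x, (0 <= h x)%E) ->
  (\int[mu]_x h (- x)%R = \int[mu]_x h x)%E.
Proof.
move=> mh h0.
transitivity (\int[pushforward mu (-%R : _ -> measurableTypeR R)]_x h x)%E.
  rewrite ge0_integral_pushforward//.
apply: eq_measure_integral => //= A mA _; exact: lebesgue_measureN.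
Qed.

End Gauss1D.

(** * Characteristic function of the normal density *)

Section Char.
Variable R : realType.
Notation mu := (@lebesgue_measure R).
Implicit Types s a b x k : R.

Lemma measurable_cosM k : measurable_fun setT (fun x => cos (k * x)).
Proof.
apply: (measurableT_comp (continuous_measurable_fun (@continuous_cos R))).
exact: measurable_funM.
Qed.

Lemma measurable_sinM k : measurable_fun setT (fun x => sin (k * x)).
Proof.
apply: (measurableT_comp (continuous_measurable_fun (@continuous_sin R))).
exact: measurable_funM.
Qed.

Lemma is_derive_normal_pdf s x : 0 < s ->
  is_derive x 1 (normal_pdf 0 s) (- (x / s ^+ 2) * normal_pdf 0 s x).
Proof.
move=> s0; rewrite normal_pdfE ?gt_eqF// /normal_fun.
apply: is_derive_eq.
rewrite /GRing.scale /= ?mulr0 ?add0r ?addr0 ?mulr1 ?subr0.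
by field; rewrite ?gt_eqF.
Qed.

(** The boundary term of one integration by parts: the derivative [G'] has integral 0 over the line,
    which ties a sine integral to a cosine integral. *)
Let G s k x := normal_pdf 0 s x * sin (k * x).
Let G' s k x := k * (normal_pdf 0 s x * cos (k * x)) -
   s ^- 2 * (x * normal_pdf 0 s x * sin (k * x)).

Let derG s k x : 0 < s -> is_derive x 1 (G s k) (G' s k x).
Proof.
move=> s0; have := @is_derive_normal_pdf s x s0 => H.
have H2 : is_derive x 1 (fun x => sin (k * x)) (k * cos (k * x)).
  apply: is_derive_eq.
  by rewrite /GRing.scale /= ?mulr0 ?add0r ?addr0 ?mulr1 mulrC.
apply: is_derive_eq; rewrite /GRing.scale /= /G'.
by field; rewrite gt_eqF.
Qed.


Let cont_pdf s : 0 < s -> continuous (normal_pdf 0 s : R -> R).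
Proof. by move=> s0; apply: continuous_normal_pdf; rewrite gt_eqF. Qed.

Let cont_mul (f : R -> R) k : continuous f -> continuous (fun x => f (k * x)).
Proof.
move=> cf x; apply: (@continuous_comp _ _ _ ( *%R k) f); last exact: cf.
exact: mulrl_continuous.
Qed.

Let contG' s k : 0 < s -> continuous (G' s k).
Proof.
move=> s0 x; apply: cvgB.
  apply: cvgM; first exact: cvg_cst.
  apply: cvgM; first exact: cont_pdf.
  by apply: cont_mul => //; exact: continuous_cos.
apply: cvgM; first exact: cvg_cst.
apply: cvgM; last by apply: cont_mul => //; exact: continuous_sin.
by apply: cvgM; [exact: cvg_id|exact: cont_pdf].
Qed.

Let measG' s k : measurable_fun setT (G' s k).
Proof.
apply: measurable_funB; apply: measurable_funM => //.
  apply: measurable_funM => //; first exact: measurable_normal_pdf.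
  exact: measurable_cosM.
apply: measurable_funM => //.
  by apply: measurable_funM => //; exact: measurable_normal_pdf.
exact: measurable_sinM.
Qed.

Let intG' s k : 0 < s -> mu.-integrable setT (EFin \o G' s k).
Proof.
move=> s0.
apply: (@le_integrable _ _ _ mu _ _ _ (fun x => `|k|%:E * (normal_pdf 0 s x)%:E +
   (s ^- 2)%:E * (normal_pdf 0 s x * `|x|)%:E)%E) => //.
- apply/measurable_EFinP; exact: measG'.
- move=> x _; rewrite -!EFinM -EFinD !abse_EFin lee_fin.
  have p0 := normal_pdf_ge0 0 s x.
  rewrite (@ger0_norm _ (_ + _)); last first.
    by rewrite addr_ge0 ?mulr_ge0 ?invr_ge0 ?sqr_ge0.
  rewrite /G' (le_trans (ler_normB _ _))// lerD//.
    rewrite normrM ler_wpM2l// normrM (ger0_norm p0) ler_piMr// ?cos_max//.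
  rewrite normrM ger0_norm ?invr_ge0 ?sqr_ge0//.
  rewrite ler_wpM2l ?invr_ge0 ?sqr_ge0//.
  by rewrite normrM normrM (ger0_norm p0) (mulrC `|x|) ler_piMr ?sin_max ?mulr_ge0.
- apply: integrableD => //; apply: integrableZl => //.
    exact: integrable_normal_pdf.
  exact: integrable_normal_pdf_id.
Qed.

Let FTC_G s k (n : nat) : 0 < s -> (0 < n)%N ->
  (\int[mu]_(x in `[(- n%:R)%R, n%:R%R]) (G' s k x)%:E =
    (G s k n%:R - G s k (- n%:R))%:E)%E.
Proof.
move=> s0 n0; rewrite EFinB; apply: continuous_FTC2.
- by rewrite gtrN// ltr0n.
- by apply: continuous_subspaceT; exact: contG'.
- have cG : continuous (G s k).
    move=> x; apply: differentiable_continuous; apply/derivable1_diffP.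
    by have := derG k x s0 => -[].
  split.
  + by move=> x _; have := derG k x s0 => -[].
  + by apply: cvg_at_right_filter; exact: cG.
  + by apply: cvg_at_left_filter; exact: cG.
- by move=> x _; rewrite derive1E; have := derG k x s0 => -[].
Qed.

Let pdf_cvg0 s : 0 < s -> normal_pdf 0 s (n%:R : R) @[n --> \oo] --> (0 : R).
Proof.
move=> s0; apply: (@squeeze_cvgr _ _ _ _ (fun=> 0) (fun n => normal_peak s * (s ^+ 2 *+ 2) * n%:R^-1)).
- near=> n; rewrite normal_pdf_ge0/= normal_pdfE ?gt_eqF// -mulrA.
  have n0 : (0 < n)%N by near: n; exact: nbhs_infty_gt.
  rewrite ler_wpM2l ?normal_peak_ge0// /normal_fun subr0 mulNr expRN.
  have n1 : 1 <= n%:R :> R by rewrite ler1n.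
  have s20 : 0 < s ^+ 2 *+ 2 by rewrite pmulrn_rgt0// exprn_gt0.
  rewrite -[leRHS]invrK lef_pV2 ?posrE ?invr_gt0 ?mulr_gt0 ?invr_gt0 ?ltr0n//; last exact: expR_gt0.
  rewrite invfM invrK mulrC.
  apply: le_trans (ltW (expR_gt1Dx _)).
    rewrite (@le_trans _ _ (n%:R ^+ 2 / (s ^+ 2 *+ 2)))// ?lerDr//.
    by rewrite ler_pM2r ?invr_gt0// expr2 ler_peMl.
  by rewrite gt_eqF// mulr_gt0// ?invr_gt0// exprn_gt0// ltr0n.
- exact: cvg_cst.
- rewrite -[X in _ --> X](mulr0 (normal_peak s * (s ^+ 2 *+ 2))).
  apply: cvgM; first exact: cvg_cst.
  apply/gtr0_cvgV0; last exact: cvgr_idn.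
  by near=> n; rewrite ltr0n; near: n; exact: nbhs_infty_gt.
Unshelve. all: by end_near. Qed.

Let int0_G' s k : 0 < s -> (\int[mu]_x (G' s k x)%:E = 0)%E.
Proof.
move=> s0.
have h1 : (\int[mu]_(x in `[(- n%:R)%R, n%:R%R]) (G' s k x)%:E @[n --> \oo] --> \int[mu]_x (G' s k x)%:E)%E.
  have := @dominated_cvg _ _ _ mu setT measurableT (fun n => (EFin \o G' s k) \_ `[(- n%:R)%R, n%:R%R]) (EFin \o G' s k) (fun x => `|(G' s k x)%:E|)%E.
  move=> H; rewrite (_ : (fun n => _) = (fun n => (\int[mu]_x ((EFin \o G' s k) \_ `[(- n%:R)%R, n%:R%R]) x)%E)); last first.
    by apply/funext => n; rewrite integral_mkcond.
  apply: H => //.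
  - move=> n; apply/(measurable_restrictT _ _).1 => //.
    by apply/measurable_funTS/measurable_EFinP; exact: measG'.
  - move=> x _; apply: cvg_near_cst.
    near=> n; rewrite patchE mem_set//= in_itv/= -ler_norml.
    by near: n; exact: nbhs_infty_ger.
  - by apply: integrable_abse; exact: intG'.
  - move=> n x _; rewrite patchE; case: ifP => // _.
    by rewrite abse0.
have h2 : (\int[mu]_(x in `[(- n%:R)%R, n%:R%R]) (G' s k x)%:E @[n --> \oo] --> 0%:E)%E.
  apply: cvg_trans (_ : (EFin \o (fun n : nat => G s k n%:R - G s k (- n%:R))) @ \oo `=>` _); last first.
    apply: cvg_EFin; first exact: nearW.
    rewrite (_ : (fine \o _) = (fun n : nat => G s k n%:R - G s k (- n%:R)))//.
    apply: (@squeeze_cvgr _ _ _ _ (fun n => - (normal_pdf 0 s n%:R *+ 2)) (fun n => normal_pdf 0 s (n%:R : R) *+ 2)).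
    + near=> n; rewrite -ler_norml mulr2n.
      have pn : normal_pdf 0 s (- n%:R) = normal_pdf 0 s (n%:R : R).
        by rewrite normal_pdfE ?gt_eqF// /normal_fun !subr0 sqrrN.
      rewrite (le_trans (ler_normB _ _))// lerD// /G ?pn normrM (ger0_norm (normal_pdf_ge0 _ _ _)) ler_piMr ?sin_max ?normal_pdf_ge0//.
    + rewrite -[X in _ --> X]oppr0; apply: cvgN; rewrite -[X in _ --> X](mul0rn _ 2).
      by apply: cvgMn; exact: pdf_cvg0.
    + rewrite -[X in _ --> X](mul0rn _ 2).
      by apply: cvgMn; exact: pdf_cvg0.
  apply: near_eq_cvg; near=> n; rewrite FTC_G//.
  by near: n; exact: nbhs_infty_gt.
exact: (cvg_unique _ h1 h2).
Unshelve. all: by end_near. Qed.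


Let F s k := \int[mu]_x (normal_pdf 0 s x * cos (k * x)).

Let intF s k : 0 < s -> mu.-integrable setT (fun x => (normal_pdf 0 s x * cos (k * x))%:E).
Proof.
move=> s0; apply: (@le_integrable _ _ _ mu _ _ _ (fun x => (normal_pdf 0 s x)%:E)) => //.
- apply/measurable_EFinP; apply: measurable_funM => //; first exact: measurable_normal_pdf.
  exact: measurable_cosM.
- move=> x _; rewrite !abse_EFin lee_fin normrM ler_piMr// cos_max//.
- exact: integrable_normal_pdf.
Qed.

Let intF' s k : 0 < s -> mu.-integrable setT (fun x => (x * normal_pdf 0 s x * sin (k * x))%:E).
Proof.
move=> s0; apply: (@le_integrable _ _ _ mu _ _ _ (fun x => (normal_pdf 0 s x * `|x|)%:E)) => //.
- apply/measurable_EFinP; apply: measurable_funM => //.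
    by apply: measurable_funM => //; exact: measurable_normal_pdf.
  exact: measurable_sinM.
- move=> x _; rewrite !abse_EFin lee_fin !normrM normr_id (mulrC `|x|).
  by rewrite ler_piMr ?sin_max ?mulr_ge0.
- exact: integrable_normal_pdf_id.
Qed.

(** Stein's identity for the test function sin(k x), read off from the vanishing integral of
    [G']. *)
Let int_sin s k : 0 < s ->
  \int[mu]_x (x * normal_pdf 0 s x * sin (k * x)) = s ^+ 2 * (k * F s k).
Proof.
move=> s0; have := int0_G' k s0; rewrite /G' => /(congr1 fine) /=.
rewrite -/(Rintegral mu setT _) RintegralB//=; last 2 first.
- by have := @integrableZl _ _ _ mu _ measurableT k _ (intF k s0).
- by have := @integrableZl _ _ _ mu _ measurableT (s ^- 2) _ (intF' k s0).
rewrite RintegralZl//; last exact: intF.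
rewrite RintegralZl//; last exact: intF'.
move/eqP; rewrite subr_eq0 => /eqP; rewrite -/(F s k) => ->.
by rewrite mulrA divff ?mul1r// expf_neq0// gt_eqF.
Qed.

Let derF s k : 0 < s -> is_derive k 1 (F s) (- (s ^+ 2 * (k * F s k))).
Proof.
move=> s0.
have d1 k' x : is_derive k' 1 (fun k => normal_pdf 0 s x * cos (k * x)) (- (x * normal_pdf 0 s x * sin (k' * x))).
  apply: is_derive_eq; rewrite /GRing.scale /= ?mulr0 ?add0r ?addr0 ?mulr1; ring.
have kk : `]k - 1, k + 1[%classic k by rewrite /= in_itv/= ltrBlDr !ltrDl ltr01.
pose f k x := normal_pdf 0 s x * cos (k * x).
have p1 k' x : partial1of2 f k' x = - (x * normal_pdf 0 s x * sin (k' * x)).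
  by rewrite partial1of2E; have := d1 k' x => -[].
have H1 := @derivable_under_integral R _ _ mu f setT measurableT k (k - 1) (k + 1) kk (fun k' _ => intF k' s0) (fun k' x _ _ => @ex_derive _ _ _ _ _ _ _ (d1 k' x)) (fun x => normal_pdf 0 s x * `|x|).
have H2 := @differentiation_under_integral R _ _ mu f setT measurableT k (k - 1) (k + 1) kk (fun k' _ => intF k' s0) (fun k' x _ _ => @ex_derive _ _ _ _ _ _ _ (d1 k' x)) (fun x => normal_pdf 0 s x * `|x|).
have G0 x : 0 <= normal_pdf 0 s x * `|x| by rewrite mulr_ge0// normal_pdf_ge0.
have Gub x y : (`]k - 1, k + 1[%classic) x -> [set: R] y -> `|partial1of2 f x y| <= normal_pdf 0 s y * `|y|.
  move=> _ _; rewrite p1 normrN !normrM (ger0_norm (normal_pdf_ge0 _ _ _)).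
  by rewrite (mulrC `|y|) ler_piMr ?sin_max ?mulr_ge0 ?normal_pdf_ge0.
have iG := integrable_normal_pdf_id s0.
apply: DeriveDef; first exact: (H1 G0 iG Gub).
rewrite -derive1E (H2 G0 iG Gub) -(int_sin k s0).
under eq_Rintegral do rewrite p1 -mulN1r.
by rewrite RintegralZl ?mulN1r//; exact: intF'.
Qed.

Lemma Rintegral_normal_pdf_cos s k : 0 < s ->
  \int[mu]_x (normal_pdf 0 s x * cos (k * x)) = expR (- (k ^+ 2 * s ^+ 2 / 2)).
Proof.
move=> s0; rewrite -/(F s k).
(* The linear differential equation [derF] makes the derivative of this product vanish; at [k = 0]
   its value is the total mass 1. *)
have key : F s k * expR (k ^+ 2 * s ^+ 2 / 2) = F s 0 * expR (0 ^+ 2 * s ^+ 2 / 2).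
  apply: (@is_derive_0_is_cst _ (fun k => F s k * expR (k ^+ 2 * s ^+ 2 / 2))) => x.
  have := derF x s0 => dF; apply: is_derive_eq.
  by rewrite /GRing.scale /= ?mulr0 ?add0r ?addr0 ?mulr1; field.
have F0 : F s 0 = 1.
  rewrite /F; under eq_Rintegral do rewrite mul0r cos0 mulr1.
  by rewrite /Rintegral integral_normal_pdf.
rewrite expRN; apply: (@mulIf _ (expR (k ^+ 2 * s ^+ 2 / 2))).
  by rewrite gt_eqF// expR_gt0.
by rewrite key F0 expr0n/= !mul0r expR0 mulr1 mulVf// gt_eqF// expR_gt0.
Qed.

Lemma integrable_normal_pdf_cos s k : 0 < s -> mu.-integrable setT (fun x => (normal_pdf 0 s x * cos (k * x))%:E).
Proof. exact: intF. Qed.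

End Char.

(** * Concentration of Gaussian quadratic forms *)

Section BilinearForm.
Context {R : realType} {n : nat}.
Implicit Types (M N : 'M[R]_n) (a b c x y : 'cV[R]_n) (k : R).

Definition bform M a b : R := (a^T *m M *m b) ord0 ord0.
Definition dot a b : R := (a^T *m b) ord0 ord0.

Lemma bformDl M a b c : bform M (a + b) c = bform M a c + bform M b c.
Proof. by rewrite /bform linearD/= !mulmxDl mxE. Qed.

Lemma bformDr M a b c : bform M c (a + b) = bform M c a + bform M c b.
Proof. by rewrite /bform mulmxDr mxE. Qed.

Lemma bformZl M k a b : bform M (k *: a) b = k * bform M a b.
Proof. by rewrite /bform linearZ/= -!scalemxAl mxE. Qed.

Lemma bformZr M k a b : bform M a (k *: b) = k * bform M a b.
Proof. by rewrite /bform -scalemxAr mxE. Qed.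

Lemma bformMD M N a b : bform (M + N) a b = bform M a b + bform N a b.
Proof. by rewrite /bform mulmxDr mulmxDl mxE. Qed.

Lemma bformMZ M k a b : bform (k *: M) a b = k * bform M a b.
Proof. by rewrite /bform -scalemxAr -scalemxAl mxE. Qed.

Lemma bformC M a b : M^T = M -> bform M a b = bform M b a.
Proof.
move=> sM; have -> : bform M a b = (a^T *m M *m b)^T ord0 ord0 by rewrite mxE.
by rewrite !trmx_mul sM trmxK mulmxA.
Qed.

Lemma dotC a b : dot a b = dot b a.
Proof. by rewrite /dot !mxE; apply: eq_bigr => i _; rewrite !mxE mulrC. Qed.

Lemma dotDl a b c : dot (a + b) c = dot a c + dot b c.
Proof. by rewrite /dot linearD/= !mulmxDl mxE. Qed.

Lemma dotZl k a b : dot (k *: a) b = k * dot a b.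
Proof. by rewrite /dot linearZ/= -!scalemxAl mxE. Qed.

Lemma dot_bform M a b : bform M a b = dot a (M *m b).
Proof. by rewrite /bform /dot mulmxA. Qed.

Lemma bform_outer a b x y : bform (a *m b^T) x y = dot x a * dot b y.
Proof.
rewrite /bform /dot mulmxA -mulmxA [in LHS]mxE big_ord1.
by congr (_ * _).
Qed.

(** The form at [a + k *: b] is a polynomial in [k] that is never negative. The form is only
    semidefinite, so the leading coefficient may vanish and is treated apart. *)
Lemma bform_CS M a b : M^T = M -> (forall x, 0 <= bform M x x) ->
  bform M a b ^+ 2 <= bform M a a * bform M b b.
Proof.
move=> sM pM.
have H k : 0 <= bform M a a + k * (bform M a b *+ 2) + k ^+ 2 * bform M b b.
  have := pM (a + k *: b).
  rewrite !bformDl !bformDr !bformZl !bformZr (bformC b a sM).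
  by rewrite (_ : _ + _ = bform M a a + k * (bform M a b *+ 2) + k ^+ 2 * bform M b b)//; ring.
have Hb := pM b; move: H Hb.
set A := bform M a a; set B := bform M a b; set C := bform M b b => H.
rewrite le_eqVlt => /predU1P[C0|C0].
  rewrite -C0 mulr0; have [->|B0] := eqVneq B 0; first by rewrite expr0n.
  (* At this [k] the remaining linear function takes the value -1. *)
  have := H (- (A + 1) / (B *+ 2)); rewrite -C0 mulr0 addr0 divfK ?mulrn_eq0//.
  by have := pM a; rewrite -/A; lra.
have := H (- B / C).
rewrite (_ : _ + _ = (A * C - B ^+ 2) / C); last by field; rewrite gt_eqF.
by rewrite pmulr_lge0 ?invr_gt0// subr_ge0.
Qed.

End BilinearForm.

(** * Numerical bounds for one decoupling factor *)

Section ScalarBounds.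
Variable R : realType.
Implicit Types t q L x y z : R.

Lemma sqrtV_le_expR y z : expR z <= y -> (Num.sqrt y)^-1 <= expR (- (z / 2)).
Proof.
move=> zy; rewrite expRN lef_pV2 ?posrE ?expR_gt0 ?sqrtr_gt0//; last first.
  exact: lt_le_trans (expR_gt0 _) zy.
rewrite -[leLHS](ger0_norm (expR_ge0 _)) -sqrtr_sqr ler_wsqrtr// -expRM_natl.
by rewrite mulrC divfK.
Qed.

Lemma expRN_le y z : 0 <= y -> 1 <= y * (1 + z) -> expR (- z) <= y.
Proof.
move=> y0 yz; rewrite expRN -[leLHS]mul1r ler_pdivrMr ?expR_gt0//.
by apply: (le_trans yz); rewrite ler_wpM2l// expR_ge1Dx.
Qed.

(** Here [q] will be the variance of b.X after the earlier tilts and [q0] the original one. The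
    bound is in terms of [q0] because the [q0] add up to the trace. With y = 2 t q <= 1/3 one has 1
    - y >= exp(- y - 2 y^2), and replacing [q] by [q0] leaves an error of at most (8/3 + 64/9) t^2 L
    q0, which explains the 10. *)
Lemma chernoff_factor_pos t q q0 L : 0 <= t -> 0 <= q -> 0 <= q0 -> q0 <= L ->
  8 * (t * L) <= 1 -> q * (1 - 2 * (t * L)) <= q0 ->
  0 < 1 - 2 * t * q /\
  (Num.sqrt (1 - 2 * t * q))^-1 <= expR (t * q0 + 10 * (t ^+ 2 * (L * q0))).
Proof.
move=> t0 q0' q00 q0L tL qq.
have tL0 : 0 <= t * L by rewrite mulr_ge0// (le_trans q00).
(* 1 / (1 - x) <= 1 + 4/3 x for 0 <= x <= 1/4, at x = 2 t L. *)
have a1 : q <= q0 * (1 + 8 / 3 * (t * L)).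
  rewrite -(@ler_pM2r _ (1 - 2 * (t * L))); last lra.
  apply: (le_trans qq); rewrite -[leRHS]mulrA ler_peMr//; nra.
have a2 : t * q <= t * q0 * (1 + 8 / 3 * (t * L)).
  by rewrite -mulrA ler_wpM2l.
have tq0 : 0 <= t * q0 by rewrite mulr_ge0.
have tq : 0 <= t * q by rewrite mulr_ge0.
have tq0L : t * q0 <= t * L by rewrite ler_wpM2l.
have a3 : t * q <= 4 / 3 * (t * q0) by nra.
split; first by rewrite -mulrA; lra.
apply: (@le_trans _ _ (expR (- (- (2 * (t * q) + 2 * (2 * (t * q)) ^+ 2) / 2)))).
  apply: sqrtV_le_expR; apply: expRN_le; first by rewrite -mulrA; lra.
  by rewrite -mulrA; nra.
rewrite ler_expR mulNr opprK.
have e : t ^+ 2 * (L * q0) = (t * q0) * (t * L) by ring.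
rewrite e.
have a4 : (t * q) ^+ 2 <= 16 / 9 * ((t * q0) * (t * L)) by nra.
by nra.
Qed.

(** The counterpart for the lower tail: 1 + x >= exp(x - x^2), because (1 + x)(1 - x + x^2) = 1 +
    x^3. The errors add up to 4 t^2 L q0; the 10 is taken over from the upper tail so that both have
    one form. *)
Lemma chernoff_factor_neg t q q0 L : 0 <= t -> 0 <= q0 -> q0 <= L ->
  8 * (t * L) <= 1 -> q0 <= q * (1 + 2 * (t * L)) ->
  0 < 1 + 2 * t * q /\
  (Num.sqrt (1 + 2 * t * q))^-1 <= expR (- (t * q0) + 10 * (t ^+ 2 * (L * q0))).
Proof.
move=> t0 q00 q0L tL qq.
have tL0 : 0 <= t * L by rewrite mulr_ge0// (le_trans q00).
have a1 : q0 * (1 - 2 * (t * L)) <= q.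
  rewrite -(@ler_pM2r _ (1 + 2 * (t * L))); last lra.
  by apply: le_trans qq; rewrite -mulrA ler_piMr//; nra.
have a2 : t * q0 * (1 - 2 * (t * L)) <= t * q by rewrite -mulrA ler_wpM2l.
have tq0 : 0 <= t * q0 by rewrite mulr_ge0.
have tq0L : t * q0 <= t * L by rewrite ler_wpM2l.
have tq : 0 <= t * q by nra.
split; first by rewrite -mulrA; lra.
pose x := 2 * (t * q0 * (1 - 2 * (t * L))).
have x0 : 0 <= x by rewrite /x; nra.
apply: (@le_trans _ _ (expR (- ((x - x ^+ 2) / 2)))).
  apply: sqrtV_le_expR; rewrite -[X in expR X]opprK.
  have xq : x <= 2 * t * q by rewrite /x -[leRHS]mulrA; lra.
  apply: (@le_trans _ _ (1 + x)); last by rewrite lerD2l.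
  apply: expRN_le; first lra.
  by rewrite (_ : _ * _ = 1 + x ^+ 3); [rewrite lerDl exprn_ge0|ring].
rewrite ler_expR.
have e : t ^+ 2 * (L * q0) = (t * q0) * (t * L) by ring.
rewrite e /x; set u := t * q0 in tq0 tq0L *; set v := t * L in tL tL0 tq0L *.
have : (u * (1 - 2 * v)) ^+ 2 <= u * v.
  apply: (@le_trans _ _ (u ^+ 2)); last by rewrite expr2 ler_wpM2l.
  by rewrite exprMn ler_piMr ?sqr_ge0// exprn_ile1//; lra.
nra.
Qed.

End ScalarBounds.

(** * Exponential moments of sums of squares of linear forms *)

Section Decoupling.
Context {d : measure_display} {Omega : measurableType d} {R : realType}.
Variables (P : probability Omega R) (n : nat) (X : Omega -> 'cV[R]_n).
Notation mu := (@lebesgue_measure R).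
(** Two instances share this section: [e = expR], [s = 1] for the upper tail and [e = cos],
    [s = - 1] for the lower one. In [swap] the bound on [W] matters for the second, where the
    integrand changes sign and Tonelli does not apply. *)
Variables (e : R -> R) (s : R).
Hypothesis mX : forall i, measurable_fun setT (fun w => X w i ord0).
Hypothesis me : measurable_fun setT e.
Hypothesis s1 : s ^+ 2 = 1.
Hypothesis integral_e : forall z k r C, 0 <= C ->
  (\int[mu]_g (C * (normal_pdf 0 1 g * e (z + k * g * r)))%:E =
   (C * (e z * expR (s * (k ^+ 2 * r ^+ 2) / 2)))%:E)%E.
Hypothesis swap : forall (W A B : Omega -> R) (k : R),
  measurable_fun setT W -> measurable_fun setT A -> measurable_fun setT B ->
  (forall w, 0 <= W w) -> (exists C, s = 1 \/ forall w, W w <= C) ->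
  (\int[P]_w \int[mu]_g (W w * (normal_pdf 0 1 g * e (A w + k * g * B w)))%:E =
   \int[mu]_g \int[P]_w (W w * (normal_pdf 0 1 g * e (A w + k * g * B w)))%:E)%E.

Definition sqsum (bs : seq 'cV[R]_n) w := \sum_(b <- bs) dot b (X w) ^+ 2.

Lemma measurable_dot b : measurable_fun setT (fun w => dot b (X w)).
Proof.
rewrite (_ : (fun _ => _) = fun w => \sum_(i < n) (b i ord0 * X w i ord0)).
  by apply: measurable_sum => i; apply: measurable_funM => //.
by apply/funext => w; rewrite /dot mxE; apply: eq_bigr => i _; rewrite mxE.
Qed.

Lemma measurable_sqsum bs : measurable_fun setT (sqsum bs).
Proof.
by apply: measurable_sum => b; apply: measurable_funX; exact: measurable_dot.
Qed.

Lemma sqsum_ge0 bs w : 0 <= sqsum bs w.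
Proof. by apply: sumr_ge0 => b _; rewrite sqr_ge0. Qed.

(** Tilting by the exponential of the squares leaves a Gaussian law with covariance [S], up to the
    mass [c]. The factor [C] is carried along to absorb the density of the auxiliary Gaussian
    variable when a further square is added. *)
Definition mgf_form (t : R) bs (S : 'M[R]_n) (c : R) := forall a C, 0 <= C ->
  (\int[P]_w (C * (expR (s * t * sqsum bs w) * e (dot a (X w))))%:E =
   (C * (c * expR (s / 2 * bform S a a)))%:E)%E.

(* Hubbard-Stratonovich: the new factor exp(s t (b.X)^2) is the average of
   e(. + sqrt(2t) g b.X) over a standard Gaussian g, so that the claim for
   b :: bs is a Gaussian average of the claims for bs. *)
Lemma mgf_form_cons t b bs S c : 0 <= t -> S^T = S -> 0 <= c ->
  mgf_form t bs S c -> 0 < 1 - 2 * s * t * bform S b b ->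
  mgf_form t (b :: bs)
    (S + (2 * s * t / (1 - 2 * s * t * bform S b b)) *: (S *m b *m (S *m b)^T))
    (c * (Num.sqrt (1 - 2 * s * t * bform S b b))^-1).
Proof.
move=> t0 sS c0 IH q0 a C C0.
pose k := Num.sqrt (2 * t).
have k2 : k ^+ 2 = 2 * t by rewrite sqr_sqrtr// mulr_ge0.
have s1' : s = 1 \/ s = - 1.
  have : (s - 1) * (s + 1) == 0 by rewrite -subr_sqr s1 expr1n subrr.
  by rewrite mulf_eq0 subr_eq0 addr_eq0 => /orP[] /eqP ->; [left|right].
transitivity (\int[P]_w \int[mu]_g (C * expR (s * t * sqsum bs w) * (normal_pdf 0 1 g * e (dot a (X w) + k * g * dot b (X w))))%:E)%E.
  apply: eq_integral => w _; rewrite integral_e ?mulr_ge0 ?expR_ge0//.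
  congr EFin; rewrite /sqsum big_cons mulrDr expRD k2 -!mulrA; congr (_ * _).
  rewrite mulrCA; congr (_ * _); rewrite mulrC; congr (_ * expR _).
  by field.
rewrite swap; [|apply: measurable_funM => //; apply: measurableT_comp => //; apply: measurable_funM => //; exact: measurable_sqsum|exact: measurable_dot|exact: measurable_dot|by move=> w; rewrite mulr_ge0 ?expR_ge0|]; last first.
  exists C; case: s1' => ->; [by left|right] => w.
  rewrite ler_piMr// -[leRHS]expR0 ler_expR mulN1r mulNr oppr_le0.
  by rewrite mulr_ge0// sqsum_ge0.
set q := bform S b b in q0 *.
pose be := bform S a b.
transitivity (\int[mu]_g (C * c * expR (s / 2 * bform S a a) *
   (normal_pdf 0 1 g * expR (s * k * be * g + 2 * s * t * q * g ^+ 2 / 2)))%:E)%E.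
  apply: eq_integral => g _.
  have := IH (a + (k * g) *: b) (C * normal_pdf 0 1 g); rewrite mulr_ge0 ?normal_pdf_ge0// => /(_ isT) => H.
  transitivity (\int[P]_w (C * normal_pdf 0 1 g * (expR (s * t * sqsum bs w) * e (dot (a + (k * g) *: b) (X w))))%:E)%E.
    by apply: eq_integral => w _; congr EFin; rewrite dotDl dotZl; ring.
  rewrite H; congr EFin.
  rewrite (_ : expR (s / 2 * bform S (a + (k * g) *: b) _) =
    expR (s / 2 * bform S a a) * expR (s * k * be * g + 2 * s * t * q * g ^+ 2 / 2)).
    ring.
  rewrite -expRD; congr expR.
  rewrite !bformDl !bformDr !bformZl !bformZr (bformC b a sS) -/q -/be.
  by rewrite (_ : 2 * s * t = s * k ^+ 2); [field|rewrite k2; ring].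
(* Standard deviation of a standard Gaussian [g] tilted by exp(s t q g^2). *)
pose v := (Num.sqrt (1 - 2 * s * t * q))^-1.
have v0 : 0 < v by rewrite invr_gt0 sqrtr_gt0.
have v2 : v ^+ 2 = (1 - 2 * s * t * q)^-1 by rewrite exprVn sqr_sqrtr// ltW.
under eq_integral do rewrite EFinM.
rewrite ge0_integralZl//; last 3 first.
- apply/measurable_EFinP; apply: measurable_funM; first exact: measurable_normal_pdf.
  apply: measurableT_comp => //; apply: measurable_funD; first exact: measurable_funM.
  by apply: measurable_funM => //; apply: measurable_funM => //; exact: measurable_funX.
- by move=> g _; rewrite lee_fin mulr_ge0 ?expR_ge0 ?normal_pdf_ge0.
- by rewrite lee_fin !mulr_ge0 ?expR_ge0.
rewrite (@integral_normal_pdf_tilt _ 1 v)//; last by rewrite v2 invrK expr1n invr1.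
rewrite -EFinM; congr EFin; rewrite -/v divr1.
set S' := S + _.
rewrite (_ : expR (s / 2 * bform S' a a) =
  expR (s / 2 * bform S a a) * expR ((s * k * be) ^+ 2 * v ^+ 2 / 2)); first ring.
rewrite -expRD; congr expR.
rewrite bformMD bformMZ bform_outer v2 -dot_bform dotC -dot_bform -/q -/be.
rewrite (_ : (s * k * be) ^+ 2 = 2 * t * be ^+ 2); last first.
  by rewrite !exprMn s1 mul1r k2.
rewrite (_ : s / 2 * _ = s / 2 * bform S a a + s ^+ 2 * t * be ^+ 2 / (1 - 2 * s * t * q)).
  by rewrite s1; field; rewrite gt_eqF.
by field; rewrite gt_eqF.
Qed.


Variables (S N : 'M[R]_n).
Hypothesis sS : S^T = S.
Hypothesis pS : forall x, 0 <= bform S x x.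
Hypothesis SN : S *m N = 1%:M.
Hypothesis mean_e : forall a C, 0 <= C ->
  (\int[P]_w (C * e (dot a (X w)))%:E = (C * expR (s / 2 * bform S a a))%:E)%E.

Let NS : N *m S = 1%:M. Proof. exact: mulmx1C. Qed.

Let sN : N^T = N.
Proof.
by rewrite -[LHS]mulmx1 -SN mulmxA -{1}sS -trmx_mul SN trmx1 mul1mx.
Qed.

Let pN x : 0 <= bform N x x.
Proof.
by have := pS (N *m x); rewrite /bform trmx_mul sN -!mulmxA (mulmxA S) SN mul1mx.
Qed.

(** Induction on the rank-one terms. Keeping [Sk] as the inverse of an explicit matrix, [N]
    corrected by the terms already absorbed, is what allows the current variance [q] of the next
    term to be compared with its original variance [q0]; the factors then multiply to an exponential
    in the sum of the [q0]. *)
Lemma mgf_form_seq t L bs : 0 <= t -> 0 <= L -> 8 * (t * L) <= 1 ->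
  (forall x, \sum_(b <- bs) dot b x ^+ 2 <= L * bform N x x) ->
  exists Sk c, [/\ Sk^T = Sk,
    Sk *m (N - (2 * s * t) *: \sum_(b <- bs) (b *m b^T)) = 1%:M,
    mgf_form t bs Sk c,
    0 <= c &
    c <= expR (s * t * (\sum_(b <- bs) bform S b b) +
           10 * (t ^+ 2 * (L * \sum_(b <- bs) bform S b b)))].
Proof.
move=> t0 L0 tL; elim: bs => [|b bs IH] Hbs.
  exists S, 1; rewrite !big_nil scaler0 subr0 !mulr0 addr0 expR0; split => //.
  move=> a C C0; rewrite mul1r -mean_e//; apply: eq_integral => w _.
  by rewrite /sqsum big_nil mulr0 expR0 mul1r.
have [|Sk [c [sSk SkN Hm c0 cle]]] := IH.
  by move=> x; apply: le_trans (Hbs x); rewrite big_cons lerDr sqr_ge0.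
set B := \sum_(b <- bs) (b *m b^T) in SkN.
have Bx x : bform B x x = \sum_(b <- bs) dot b x ^+ 2.
  rewrite /B; elim: (bs) => [|b' bs' IHb]; last first.
    by rewrite !big_cons bformMD IHb bform_outer dotC expr2.
  by rewrite !big_nil /bform mulmx0 mul0mx mxE.
have B0 x : 0 <= bform B x x by rewrite Bx sumr_ge0// => i _; rewrite sqr_ge0.
have BL x : bform B x x <= L * bform N x x.
  by rewrite Bx; apply: le_trans (Hbs x); rewrite big_cons lerDr sqr_ge0.
set Nk := N - _ in SkN.
have NkSk : Nk *m Sk = 1%:M by exact: mulmx1C.
pose y := Sk *m b.
have yb : Nk *m y = b by rewrite mulmxA NkSk mul1mx.
pose q := bform Sk b b; pose q0 := bform S b b.
have NkE x z : bform Nk x z = bform N x z - 2 * s * t * bform B x z.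
  by rewrite /Nk bformMD -scaleNr bformMZ mulNr.
have qy : q = bform Nk y y.
  by rewrite dot_bform yb dotC /q dot_bform.
have q00 : 0 <= q0 by exact: pS.
have Sb : bform N (S *m b) (S *m b) = q0.
  by rewrite dot_bform mulmxA NS mul1mx dotC -dot_bform.
(* The hypothesis at [x = S b] contains the summand (b.S b)^2 = q0^2 and has right-hand side L
   q0. *)
have q0L : q0 <= L.
  have := Hbs (S *m b); rewrite big_cons Sb -dot_bform -/q0.
  have : 0 <= \sum_(j <- bs) dot j (S *m b) ^+ 2 by apply: sumr_ge0 => i _; rewrite sqr_ge0.
  move=> h1 h2; have h3 : q0 ^+ 2 <= L * q0 by lra.
  move: q00; rewrite le_eqVlt => /predU1P[<-//|q0p].
  by rewrite -(ler_pM2r q0p) -expr2.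
have n0 := pN y; have b0 := B0 y; have bL := BL y.
(* Since q = b.y = N(S b, y), this is Cauchy-Schwarz for [N]. *)
have CS : q ^+ 2 <= q0 * bform N y y.
  have := bform_CS (S *m b) y sN pN; rewrite Sb.
  by rewrite [bform N _ y]bformC// dot_bform mulmxA NS mul1mx dotC -dot_bform.
have tb : t * bform B y y <= t * L * bform N y y by rewrite -mulrA ler_wpM2l.
have tb0 : 0 <= t * bform B y y by rewrite mulr_ge0.
rewrite NkE in qy.
have : s = 1 \/ s = - 1.
  have : (s - 1) * (s + 1) == 0 by rewrite -subr_sqr s1 expr1n subrr.
  by rewrite mulf_eq0 subr_eq0 addr_eq0 => /orP[] /eqP ->; [left|right].
move=> s_cases.
have [qpos fac] : 0 < 1 - 2 * s * t * q /\
    (Num.sqrt (1 - 2 * s * t * q))^-1 <= expR (s * t * q0 + 10 * (t ^+ 2 * (L * q0))).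
  case: s_cases => sE.
    rewrite sE mulr1 mul1r; apply: chernoff_factor_pos => //.
    - by rewrite qy sE; nra.
    (* Together with [CS] this gives q^2 (1 - 2 t L) <= q0 q, and [q] cancels. *)
    - have q1 : (1 - 2 * (t * L)) * bform N y y <= q by rewrite qy sE; nra.
      have qge0 : 0 <= q by nra.
      move: qge0; rewrite le_eqVlt => /predU1P[<-|qgt0]; first by rewrite mul0r.
      by rewrite -(ler_pM2r qgt0); nra.
  rewrite sE mulrN1 !mulNr opprK mul1r -mulNr mulNr; apply: chernoff_factor_neg => //.
  (* Now Nk <= u N, which should give Sk >= u^-1 S. The inequality at [b] comes from expanding Nk(z
     - y, z - y) >= 0 with z = u^-1 S b and y = Sk b. *)
  pose u := 1 + 2 * (t * L).
  have u0 : 0 < u by rewrite /u; have := mulr_ge0 t0 L0; lra.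
  pose z := u^-1 *: (S *m b).
  have Nk0 x : 0 <= bform Nk x x.
    by rewrite NkE sE mulrN1 !mulNr opprK addr_ge0// !mulr_ge0.
  have sNk : Nk^T = Nk.
    rewrite /Nk linearB/= linearZ/= sN; congr (_ - _ *: _).
    rewrite /B; elim: (bs) => [|b' bs' IHb]; first by rewrite big_nil trmx0.
    by rewrite big_cons linearD/= IHb trmx_mul trmxK.
  have Nkzy x : bform Nk (x - y) (x - y) = bform Nk x x - 2 * bform Nk x y + bform Nk y y.
    rewrite -scaleN1r !bformDl !bformDr !bformZl !bformZr (bformC y x sNk).
    by ring.
  have := Nk0 (z - y); rewrite Nkzy.
  have -> : bform Nk z y = u^-1 * q0.
    by rewrite dot_bform yb /z dotZl dotC -dot_bform.
  have -> : bform Nk y y = q by rewrite NkE qy.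
  have : bform Nk z z <= u^-1 * q0.
    rewrite NkE sE mulrN1 !mulNr opprK /z !bformZl !bformZr Sb.
    have := BL (S *m b); rewrite Sb => BLb.
    have : t * bform B (S *m b) (S *m b) <= t * L * q0 by rewrite -mulrA ler_wpM2l.
    set bb := bform B _ _ => tbb.
    rewrite (_ : _ + _ = u^-1 * (u^-1 * (q0 + 2 * (t * bb)))); last ring.
    rewrite ler_pM2l ?invr_gt0// mulrC ler_pdivrMr// /u; lra.
  move=> h1 h2.
  by rewrite -/u -ler_pdivrMr// mulrC; lra.
exists (Sk + (2 * s * t / (1 - 2 * s * t * q)) *: (Sk *m b *m (Sk *m b)^T)).
exists (c * (Num.sqrt (1 - 2 * s * t * q))^-1).
split.
- rewrite linearD/= linearZ/= sSk; congr (_ + _ *: _).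
  by rewrite trmx_mul trmxK.
(* Sherman-Morrison formula: the product [b^T *m Sk *m b] in the middle collapses to the scalar [q],
   and the rank-one contributions cancel. *)
- rewrite big_cons scalerDr opprD addrA (addrAC N) -/B -/Nk mulmxBr mulmxDl SkN.
  rewrite trmx_mul sSk -!scalemxAl -!mulmxA SkN mulmx1 mulmxDl -!scalemxAl -!scalemxAr.
  rewrite (_ : Sk *m (b *m (b^T *m Sk)) *m (b *m b^T) = q *: (Sk *m (b *m b^T))); last first.
    rewrite -!mulmxA (mulmxA b^T) (mulmxA (b^T *m Sk)).
    rewrite [b^T *m Sk *m b]mx11_scalar mul_scalar_mx.
    by rewrite -!scalemxAr.
  set Z := Sk *m (b *m b^T).
  rewrite !scalerA -addrA -[RHS]addr0; congr (_ + _).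
  rewrite -scalerDl -scalerBl (_ : _ - _ = 0) ?scale0r//.
  by field; rewrite gt_eqF.
- exact: mgf_form_cons.
- by rewrite mulr_ge0// invr_ge0 sqrtr_ge0.
- rewrite !big_cons !mulrDr addrACA expRD [leRHS]mulrC.
  by apply: ler_pM => //; rewrite invr_ge0 sqrtr_ge0.
Qed.

End Decoupling.

(** * Order between inverses, and sums of rank-one matrices *)

Section Decomposition.
Variable R : realType.

Lemma bform_posdef_unit n (M : 'M[R]_n) :
  (forall x, x != 0 -> 0 < bform M x x) -> M \in unitmx.
Proof.
move=> pM; rewrite -unitmx_tr -row_free_unit -kermx_eq0.
apply/rowV0P => v /sub_kermxP vM; apply/eqP; apply: contraT => v0.
have := pM v^T; rewrite -trmx0 (inj_eq trmx_inj) => /(_ v0).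
have Mv : M *m v^T = 0 by rewrite -[M]trmxK -trmx_mul vM trmx0.
by rewrite dot_bform Mv /dot mulmx0 mxE ltxx.
Qed.

Lemma bform_posdef_ge0 n (M : 'M[R]_n) :
  (forall x, x != 0 -> 0 < bform M x x) -> forall x, 0 <= bform M x x.
Proof.
move=> pM x; have [->|x0] := eqVneq x 0; last exact: ltW (pM _ x0).
by rewrite /bform mulmx0 mxE.
Qed.

Lemma trmx_invmx n (M : 'M[R]_n) : M^T = M -> (invmx M)^T = invmx M.
Proof. by move=> sM; rewrite trmx_inv sM. Qed.

Lemma bform_invmx n (M : 'M[R]_n) x : M^T = M -> M \in unitmx ->
  bform (invmx M) x x = bform M (invmx M *m x) (invmx M *m x).
Proof.
by move=> sM uM; rewrite (dot_bform M) mulKVmx// dot_bform dotC.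
Qed.

Lemma bform_invmx_posdef n (M : 'M[R]_n) : M^T = M ->
  (forall x, x != 0 -> 0 < bform M x x) ->
  forall x, x != 0 -> 0 < bform (invmx M) x x.
Proof.
move=> sM pM x x0; have uM := bform_posdef_unit pM.
rewrite bform_invmx//; apply: pM; apply: contra x0 => /eqP Mx.
by rewrite -(mulKVmx uM x) Mx mulmx0.
Qed.

(* Cauchy-Schwarz for M^-1, applied to x and M N^-1 x. *)
Lemma bform_invmx_le n (M N : 'M[R]_n) c :
  M^T = M -> (forall x, x != 0 -> 0 < bform M x x) ->
  N^T = N -> (forall x, x != 0 -> 0 < bform N x x) ->
  (forall x, bform M x x <= c * bform N x x) ->
  forall x, bform (invmx N) x x <= c * bform (invmx M) x x.
Proof.
move=> sM pM sN pN MN x.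
have [->|x0] := eqVneq x 0; first by rewrite /bform !mulmx0 !mxE mulr0.
have uM := bform_posdef_unit pM; have uN := bform_posdef_unit pN.
have p0 := bform_invmx_posdef sN pN x0.
have := bform_CS x (M *m (invmx N *m x)) (trmx_invmx sM)
  (bform_posdef_ge0 (bform_invmx_posdef sM pM)).
have -> : bform (invmx M) x (M *m (invmx N *m x)) = bform (invmx N) x x.
  by rewrite dot_bform mulKmx// -dot_bform.
have -> : bform (invmx M) (M *m (invmx N *m x)) (M *m (invmx N *m x)) =
    bform M (invmx N *m x) (invmx N *m x).
  by rewrite dot_bform mulKmx// dotC -dot_bform.
move=> CS.
have := MN (invmx N *m x); rewrite -bform_invmx// => MNx.
rewrite -(ler_pM2r p0) -expr2; apply: (le_trans CS).
rewrite mulrAC [leRHS]mulrC ler_wpM2l//.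
exact: bform_posdef_ge0 (bform_invmx_posdef sM pM) _.
Qed.

(** Cholesky elimination: after stage [k] the remainder annihilates the first [k] basis vectors. It
    supplies the rank-one terms for the decoupling without any spectral theorem. *)
Lemma psd_sum_outer n (M : 'M[R]_n) : M^T = M -> (forall x, 0 <= bform M x x) ->
  exists bs : seq 'cV[R]_n, M = \sum_(b <- bs) b *m b^T.
Proof.
move=> sM pM.
suff H k : (k <= n)%N -> exists bs : seq 'cV[R]_n, exists Mk : 'M[R]_n,
    [/\ M = Mk + \sum_(b <- bs) b *m b^T, Mk^T = Mk,
       forall x, 0 <= bform Mk x x &
       forall i : 'I_n, (i < k)%N -> Mk *m delta_mx i ord0 = 0 :> 'cV_n].
  have [bs [Mk [-> _ _ Mk0]]] := H n (leqnn n).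
  exists bs; rewrite (_ : Mk = 0) ?add0r//.
  apply/matrixP => i j; have := Mk0 j (ltn_ord j).
  by rewrite -colE => /matrixP/(_ i ord0); rewrite !mxE.
elim: k => [|k IH] kn.
  by exists [::], M; rewrite big_nil addr0; split.
have [bs [Mk [ME sMk pMk Mk0]]] := IH (ltnW kn).
pose e : 'cV[R]_n := delta_mx (Ordinal kn) ord0.
have lastk (N : 'M[R]_n) : (forall i : 'I_n, (i < k)%N -> N *m delta_mx i ord0 = 0 :> 'cV_n) ->
    N *m e = 0 -> forall i : 'I_n, (i < k.+1)%N -> N *m delta_mx i ord0 = 0 :> 'cV_n.
  move=> h1 h2 i; rewrite ltnS leq_eqVlt => /predU1P[ik|]; last exact: h1.
  by rewrite (_ : i = Ordinal kn)//; exact: val_inj.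
have := pMk e; rewrite le_eqVlt => /predU1P[a0|].
  (* A zero diagonal entry of a semidefinite matrix forces a zero column, by Cauchy-Schwarz between
     [e] and [Mk *m e]. *)
  exists bs, Mk; split => //; apply: lastk => //.
  have : dot (Mk *m e) (Mk *m e) = 0.
    have := bform_CS e (Mk *m e) sMk pMk; rewrite -a0 mul0r bformC// dot_bform.
    by move=> h; apply/eqP; rewrite -sqrf_eq0 eq_le h sqr_ge0.
  rewrite /dot mxE => /eqP; rewrite psumr_eq0; last first.
    by move=> i _; rewrite mxE -expr2 sqr_ge0.
  move/allP => h0; apply/matrixP => i j; rewrite (ord1 j) [RHS]mxE.
  have := h0 i (mem_index_enum i); rewrite mxE -expr2 sqrf_eq0.
  by move/eqP.
set a := bform Mk e e => a0.
(* With this scaling [b *m b^T] agrees with [Mk] on [e], and Cauchy-Schwarz keeps the remainder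
   semidefinite. *)
pose b := (Num.sqrt a)^-1 *: (Mk *m e).
have sa : Num.sqrt a != 0 by rewrite sqrtr_eq0 -ltNge.
have be x : dot b x = (Num.sqrt a)^-1 * bform Mk e x.
  by rewrite /b dotZl dotC -dot_bform bformC.
exists (b :: bs), (Mk - b *m b^T); split.
- by rewrite big_cons addrA subrK.
- by rewrite linearB/= sMk trmx_mul trmxK.
- move=> x; rewrite bformMD -scaleN1r bformMZ mulN1r bform_outer (dotC x) !be subr_ge0.
  rewrite mulrACA -invfM -!expr2 (sqr_sqrtr (ltW a0)).
  by rewrite ler_pdivrMl// bform_CS.
- apply: lastk => [i ik|]; rewrite mulmxBl -mulmxA.
    rewrite Mk0// [b^T *m _]mx11_scalar -[_ ord0 ord0]/(dot b _) be dot_bform Mk0//.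
    by rewrite /dot mulmx0 mxE mulr0 -scalemx1 scale0r mulmx0 subrr.
  rewrite [b^T *m _]mx11_scalar -[_ ord0 ord0]/(dot b _) be -/a mul_mx_scalar.
  rewrite /b scalerA (_ : _ * _ = 1) ?scale1r ?subrr//.
  by rewrite -{2}(sqr_sqrtr (ltW a0)) expr2; field.
Qed.

End Decomposition.

(** * Deviation bound for quadratic forms of a Gaussian vector *)

Section GaussianVector.
Context {d : measure_display} {Omega : measurableType d} {R : realType}.
Variables (P : probability Omega R) (n : nat) (X : Omega -> 'cV[R]_n) (S : 'M[R]_n).
Notation mu := (@lebesgue_measure R).
Hypothesis gX : centered_gaussian_vector P X S.
Hypothesis sS : S^T = S.
Hypothesis pS : forall x, x != 0 -> 0 < bform S x x.

Let mX i : measurable_fun setT (fun w => X w i ord0).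
Proof. by case: gX => + _; apply. Qed.

Let mdot a : measurable_fun setT (fun w => dot a (X w)).
Proof. exact: measurable_dot. Qed.

Let gaussian_integral a (h : R -> R) : a != 0 -> measurable_fun setT h ->
  (forall x, 0 <= h x) ->
  (\int[P]_w (h (dot a (X w)))%:E =
   \int[mu]_x (h x * normal_pdf 0 (Num.sqrt (bform S a a)) x)%:E)%E.
Proof.
move=> a0 mh h0.
have nuE (A : set R) : measurable A -> pushforward P (fun w => dot a (X w)) A =
    (\int[mu]_(x in A) (normal_pdf 0 (Num.sqrt (bform S a a)) x)%:E)%E.
  by move=> mA; case: gX => _ /(_ a a0 A mA).
pose nu : {measure set (measurableTypeR R) -> \bar R} :=
  @measure_function_pushforward__canonical__measure_function_Measure
    _ _ _ (measurableTypeR R) _ P (fun w => dot a (X w)) (mdot a).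
have mh' : measurable_fun [set: measurableTypeR R] (EFin \o h) by exact/measurable_EFinP.
have h0' : {in [set: measurableTypeR R], forall y, (0 <= (EFin \o h) y)%E}.
  by move=> y _; rewrite lee_fin.
have <- : (\int[nu]_y (h y)%:E = \int[P]_w (h (dot a (X w)))%:E)%E :=
  @ge0_integral_pushforward _ _ _ (measurableTypeR R) R _ (mdot a) P _ _ measurableT mh' h0'.
apply: (@ge0_integral_density _ (measurableTypeR R) R mu nu _ _ _ nuE) => //.
- exact: measurable_normal_pdf.
- by move=> x; exact: normal_pdf_ge0.
Qed.

Let mean_expR a C : 0 <= C ->
  (\int[P]_w (C * expR (dot a (X w)))%:E = (C * expR (1 / 2 * bform S a a))%:E)%E.
Proof.
move=> C0.
have [->|a0] := eqVneq a 0.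
  under eq_integral do rewrite /dot trmx0 mul0mx mxE expR0 mulr1.
  rewrite integral_cst//= probability_setT mule1.
  by rewrite /bform mulmx0 mxE mulr0 expR0 mulr1.
rewrite (gaussian_integral (h := fun x => C * expR x))//; last 2 first.
- by apply: measurable_funM => //; exact: measurable_expR.
- by move=> x; rewrite mulr_ge0 ?expR_ge0.
have q0 := pS a0.
transitivity (\int[mu]_x (C%:E * (normal_pdf 0 (Num.sqrt (bform S a a)) x * expR (1 * x))%:E))%E.
  by apply: eq_integral => x _; rewrite -EFinM; congr EFin; rewrite mul1r; ring.
rewrite ge0_integralZl//.
- rewrite integral_normal_pdf_expR ?sqrtr_gt0// sqr_sqrtr ?ltW// -EFinM.
  by congr (_ * expR _)%:E; ring.
- apply/measurable_EFinP; apply: measurable_funM; first exact: measurable_normal_pdf.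
  by apply: measurableT_comp => //; exact: measurable_funM.
- by move=> x _; rewrite lee_fin mulr_ge0 ?normal_pdf_ge0 ?expR_ge0.
Qed.

Let mcosdot a : measurable_fun setT (fun w => cos (dot a (X w))).
Proof.
apply: (measurableT_comp (continuous_measurable_fun (@continuous_cos R))).
exact: mdot.
Qed.

Let mean_cos a C : 0 <= C ->
  (\int[P]_w (C * cos (dot a (X w)))%:E = (C * expR (-1 / 2 * bform S a a))%:E)%E.
Proof.
move=> C0.
have [->|a0] := eqVneq a 0.
  under eq_integral do rewrite /dot trmx0 mul0mx mxE cos0 mulr1.
  rewrite integral_cst//= probability_setT mule1.
  by rewrite /bform mulmx0 mxE mulr0 expR0 mulr1.
have q0 := pS a0.
have ic : P.-integrable setT (fun w => (C * cos (dot a (X w)))%:E).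
  apply: (@le_integrable _ _ _ P _ _ _ (fun=> C%:E)) => //.
  - by apply/measurable_EFinP; apply: measurable_funM.
  - move=> w _; rewrite !abse_EFin lee_fin normrM ler_piMr// cos_max//.
  - exact: finite_measure_integrable_cst.
have icst : P.-integrable setT (fun w : Omega => C%:E) by exact: finite_measure_integrable_cst.
(* The transfer to the normal density is available for nonnegative functions, hence [1 + cos]; the
   constant is subtracted afterwards. *)
have : (\int[P]_w (C * (1 + cos (dot a (X w))))%:E = (C * (1 + expR (-1 / 2 * bform S a a)))%:E)%E.
  rewrite (gaussian_integral (h := fun x => C * (1 + cos x)))//; last 2 first.
  - apply: measurable_funM => //; apply: measurable_funD => //.
    exact: continuous_measurable_fun (@continuous_cos R).
  - move=> x; rewrite mulr_ge0// -lerBlDl sub0r; have := cos_geN1 x; lra.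
  set v := Num.sqrt _; have v0 : 0 < v by rewrite sqrtr_gt0.
  transitivity (\int[mu]_x (C%:E * (normal_pdf 0 v x)%:E + C%:E * (normal_pdf 0 v x * cos (1 * x))%:E))%E.
    by apply: eq_integral => x _; rewrite -!EFinM -EFinD; congr EFin; rewrite mul1r; ring.
  rewrite integralD//; last 2 first.
  - by apply: integrableZl => //; exact: integrable_normal_pdf.
  - by apply: integrableZl => //; exact: integrable_normal_pdf_cos.
  rewrite !integralZl//; last 2 first.
  - exact: integrable_normal_pdf_cos.
  - exact: integrable_normal_pdf.
  rewrite integral_normal_pdf -[X in (_ * 1 + _ * X)%E]fineK; last first.
    by apply: integrable_fin_num => //; exact: integrable_normal_pdf_cos.
  rewrite -/(Rintegral mu setT _) Rintegral_normal_pdf_cos// -!EFinM -EFinD.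
  rewrite mulr1 mulrDr mulr1 /v sqr_sqrtr ?ltW// expr1n mul1r.
  by congr (_ + _ * expR _)%:E; ring.
under eq_integral do rewrite mulrDr mulr1 EFinD.
rewrite integralD// integral_cst//= probability_setT mule1.
have [r ->] : exists r, (\int[P]_w (C * cos (dot a (X w)))%:E)%E = r%:E.
  by exists (fine (\int[P]_w (C * cos (dot a (X w)))%:E)%E); rewrite fineK// integrable_fin_num.
by rewrite -EFinD mulrDr mulr1 => -[/addrI ->].
Qed.

Let measurable_prod (W A B : Omega -> R) (e : R -> R) (k : R) :
  measurable_fun setT W -> measurable_fun setT A -> measurable_fun setT B ->
  measurable_fun setT e ->
  measurable_fun [set: Omega * (measurableTypeR R)] (fun z : Omega * measurableTypeR R =>
     (W z.1 * (normal_pdf 0 1 z.2 * e (A z.1 + k * z.2 * B z.1)))%:E).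
Proof.
move=> mW mA mB me; apply/measurable_EFinP.
apply: measurable_funM; first by apply: measurableT_comp.
apply: measurable_funM.
  by apply: (measurableT_comp (@measurable_normal_pdf R 0 1)).
apply: measurableT_comp => //; apply: measurable_funD; first by apply: measurableT_comp.
apply: measurable_funM; last by apply: measurableT_comp.
exact: measurable_funM.
Qed.

Let swap_expR (W A B : Omega -> R) (k : R) :
  measurable_fun setT W -> measurable_fun setT A -> measurable_fun setT B ->
  (forall w, 0 <= W w) ->
  (\int[P]_w \int[mu]_g (W w * (normal_pdf 0 1 g * expR (A w + k * g * B w)))%:E =
   \int[mu]_g \int[P]_w (W w * (normal_pdf 0 1 g * expR (A w + k * g * B w)))%:E)%E.
Proof.
move=> mW mA mB W0.
have := @fubini_tonelli _ _ _ _ R P mu _ (measurable_prod k mW mA mB (@measurable_expR R)).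
apply => z; by rewrite lee_fin !mulr_ge0 ?normal_pdf_ge0 ?expR_ge0.
Qed.

Let swap_cos (W A B : Omega -> R) (k : R) :
  measurable_fun setT W -> measurable_fun setT A -> measurable_fun setT B ->
  (forall w, 0 <= W w) -> (exists C, forall w, W w <= C) ->
  (\int[P]_w \int[mu]_g (W w * (normal_pdf 0 1 g * cos (A w + k * g * B w)))%:E =
   \int[mu]_g \int[P]_w (W w * (normal_pdf 0 1 g * cos (A w + k * g * B w)))%:E)%E.
Proof.
move=> mW mA mB W0 [C WC].
have mc := continuous_measurable_fun (@continuous_cos R).
have mp := measurable_prod k mW mA mB mc.
have := @Fubini _ _ _ _ R P mu (fun z : Omega * measurableTypeR R =>
     (W z.1 * (normal_pdf 0 1 z.2 * cos (A z.1 + k * z.2 * B z.1)))%:E).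
apply; apply/integrable12ltyP => //=.
apply: (@le_lt_trans _ _ (\int[P]_w (C%:E)))%E; last first.
  by rewrite integral_cst//= probability_setT mule1 ltry.
apply: ge0_le_integral => //.
- by move=> w _; apply: integral_ge0 => g _; rewrite lee_fin.
- apply: (measurable_fun_fubini_tonelli_F (m2 := mu) (fun z : Omega * measurableTypeR R =>
     `|(W z.1 * (normal_pdf 0 1 z.2 * cos (A z.1 + k * z.2 * B z.1)))%:E|%E)) => //.
  exact: measurableT_comp.
- move=> w _.
  have C0 : 0 <= C := le_trans (W0 w) (WC w).
  apply: (@le_trans _ _ (\int[mu]_g (C%:E * (normal_pdf 0 1 g)%:E)))%E; last first.
    rewrite ge0_integralZl//; first by rewrite integral_normal_pdf mule1.
    - by apply/measurable_EFinP; exact: measurable_normal_pdf.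
    - by move=> g _; rewrite lee_fin normal_pdf_ge0.
  apply: ge0_le_integral => //.
  + apply/measurable_EFinP; apply: measurableT_comp => //; apply: measurable_funM => //.
    apply: measurable_funM; first exact: measurable_normal_pdf.
    apply: (measurableT_comp mc); apply: measurable_funD => //.
    by apply: measurable_funM => //; exact: measurable_funM.
  + apply/measurable_EFinP; apply: measurable_funM => //; exact: measurable_normal_pdf.
  + move=> g _; rewrite -EFinM lee_fin normrM (ger0_norm (W0 w)).
    apply: ler_pM => //; rewrite normrM (ger0_norm (normal_pdf_ge0 _ _ _)).
    by rewrite ler_piMr ?normal_pdf_ge0// cos_max.
Qed.


Section Concentration.
Variable T : 'M[R]_n.
Hypothesis sT : T^T = T.
Hypothesis pT : forall x, x != 0 -> 0 < bform T x x.
Variables (L t : R).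
Hypothesis L0 : 0 <= L.
Hypothesis STL : forall x, bform S x x <= L * bform T x x.
Hypothesis t0 : 0 < t.
Hypothesis tL : 8 * (t * L) <= 1.

Let Q w := bform (invmx T) (X w) (X w).
Let m := \tr (invmx T *m S).

Let outer_invT : exists bs : seq 'cV[R]_n, invmx T = \sum_(b <- bs) b *m b^T.
Proof.
apply: psd_sum_outer; first exact: trmx_invmx.
exact/bform_posdef_ge0/bform_invmx_posdef.
Qed.

Let mQ : measurable_fun setT Q.
Proof.
rewrite /Q; have [bs ->] := outer_invT.
rewrite (_ : (fun w => _) = sqsum X bs); first exact: measurable_sqsum.
apply/funext => w; rewrite /sqsum.
elim: (bs) => [|b bs' IH]; first by rewrite !big_nil /bform mulmx0 mul0mx mxE.
by rewrite !big_cons bformMD IH bform_outer dotC expr2.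
Qed.

(** The exponential moment is the case [a = 0] of [mgf_form], where [e 0 = 1]. The order S <= L T
    reverses under inversion, which is the hypothesis of [mgf_form_seq], and the variances of the
    rank-one terms of T^-1 sum to the trace [m]. *)
Let mgf_bound (e : R -> R) s : measurable_fun setT e -> s ^+ 2 = 1 -> e 0 = 1 ->
  (forall z k r C, 0 <= C ->
  (\int[mu]_g (C * (normal_pdf 0 1 g * e (z + k * g * r)))%:E =
   (C * (e z * expR (s * (k ^+ 2 * r ^+ 2) / 2)))%:E)%E) ->
  (forall (W A B : Omega -> R) (k : R),
  measurable_fun setT W -> measurable_fun setT A -> measurable_fun setT B ->
  (forall w, 0 <= W w) -> (exists C, s = 1 \/ forall w, W w <= C) ->
  (\int[P]_w \int[mu]_g (W w * (normal_pdf 0 1 g * e (A w + k * g * B w)))%:E =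
   \int[mu]_g \int[P]_w (W w * (normal_pdf 0 1 g * e (A w + k * g * B w)))%:E)%E) ->
  (forall a C, 0 <= C ->
  (\int[P]_w (C * e (dot a (X w)))%:E = (C * expR (s / 2 * bform S a a))%:E)%E) ->
  (\int[P]_w (expR (s * t * Q w))%:E <= (expR (s * t * m + 10 * (t ^+ 2 * (L * m))))%:E)%E.
Proof.
move=> me s1 e0 he hswap hmean.
have [bs bsE] := outer_invT.
have uS := bform_posdef_unit pS.
have [|Sk [c [_ _ Hm c0 cle]]] := mgf_form_seq mX s1 he hswap sS
  (bform_posdef_ge0 pS) (mulmxV uS) hmean (ltW t0) L0 tL (bs := bs).
  move=> x; apply: le_trans (bform_invmx_le sS pS sT pT STL x).
  rewrite bsE; elim: (bs) => [|b bs' IH]; first by rewrite !big_nil /bform mulmx0 mul0mx mxE.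
  by rewrite !big_cons bformMD bform_outer (dotC x) -expr2 lerD2l.
have mE : \sum_(b <- bs) bform S b b = m.
  rewrite /m bsE mulmx_suml raddf_sum/=; apply: eq_bigr => b _.
  by rewrite -mulmxA mxtrace_mulC /bform /mxtrace big_ord1.
rewrite mE in cle.
have := Hm 0 1 ler01.
rewrite (_ : bform Sk 0 0 = 0) ?mulr0 ?expR0 ?mul1r ?mulr1; last by rewrite /bform mulmx0 mxE.
move=> H; apply: (@le_trans _ _ (c%:E)); last by rewrite lee_fin.
rewrite -H le_eqVlt; apply/orP; left; apply/eqP; apply: eq_integral => w _.
rewrite /dot trmx0 mul0mx mxE e0 mul1r mulr1; congr (expR (_ * _))%:E.
rewrite /Q bsE /sqsum; elim: (bs) => [|b bs' IH]; first by rewrite !big_nil /bform mulmx0 mul0mx mxE.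
by rewrite !big_cons bformMD IH bform_outer dotC expr2.
Qed.

Let mgf_pos : (\int[P]_w (expR (1 * t * Q w))%:E <= (expR (1 * t * m + 10 * (t ^+ 2 * (L * m))))%:E)%E.
Proof.
apply: (mgf_bound (@measurable_expR R)) => //.
- by rewrite expr1n.
- exact: expR0.
- move=> z k r C C0.
  transitivity (\int[mu]_g ((C * expR z)%:E * (normal_pdf 0 1 g * expR (k * r * g))%:E))%E.
    apply: eq_integral => g _; rewrite -EFinM expRD (_ : k * g * r = k * r * g); last ring.
    by congr EFin; ring.
  rewrite ge0_integralZl//.
  + rewrite integral_normal_pdf_expR// -EFinM exprMn expr1n.
    by congr EFin; rewrite [RHS]mulrA; congr (_ * expR _); ring.
  + apply/measurable_EFinP; apply: measurable_funM; first exact: measurable_normal_pdf.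
    by apply: measurableT_comp => //; exact: measurable_funM.
  + by move=> x _; rewrite lee_fin mulr_ge0 ?normal_pdf_ge0 ?expR_ge0.
  + by rewrite lee_fin mulr_ge0 ?expR_ge0.
- by move=> W A B k mW mA mB W0 _; exact: swap_expR.
Qed.

Let integral_sin k : (\int[mu]_g (normal_pdf 0 1 g * sin (k * g))%:E = 0)%E.
Proof.
have pN (g : R) : normal_pdf 0 1 (- g) = normal_pdf 0 1 g.
  by rewrite !normal_pdfE ?oner_eq0// /normal_fun !subr0 sqrrN.
have is_ : mu.-integrable setT (fun g => (normal_pdf 0 1 g * sin (k * g))%:E).
  apply: (@le_integrable _ _ _ mu _ _ _ (fun g => (normal_pdf 0 1 g)%:E)) => //.
  - apply/measurable_EFinP; apply: measurable_funM; first exact: measurable_normal_pdf.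
    exact: measurable_sinM.
  - move=> x _; rewrite !abse_EFin lee_fin normrM ler_piMr// sin_max//.
  - exact: integrable_normal_pdf.
have ip := @integrable_normal_pdf R 0 1.
(* The integrand is odd, but [ge0_integral_opp] is for nonnegative functions; adding the density
   yields the nonnegative function [normal_pdf] times [1 + sin]. *)
have : (\int[mu]_g ((normal_pdf 0 1 (- g)%R)%:E + (normal_pdf 0 1 (- g)%R * sin (k * (- g)%R)%R)%:E) =
        \int[mu]_g ((normal_pdf 0 1 g)%:E + (normal_pdf 0 1 g * sin (k * g))%:E))%E.
  apply: (ge0_integral_opp (h := fun g => ((normal_pdf 0 1 g)%:E + (normal_pdf 0 1 g * sin (k * g))%:E)%E)).
  - apply: emeasurable_funD; first by apply/measurable_EFinP; exact: measurable_normal_pdf.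
    by case/integrableP : is_.
  - move=> x; rewrite -EFinD lee_fin -[X in X + _]mulr1 -mulrDr mulr_ge0 ?normal_pdf_ge0//.
under eq_integral do rewrite pN mulrN sinN mulrN EFinN.
rewrite integralB// integralD//.
have : (\int[mu]_g (normal_pdf 0 1 g * sin (k * g))%:E)%E \is a fin_num by exact: integrable_fin_num.
rewrite integral_normal_pdf; case: integral => // r _ [].
by move=> h; congr EFin; lra.
Qed.

(** Averaging cos(z + k g r) over [g] removes the sine part and multiplies cos z by the
    characteristic function, whose exponent has the sign required by [s = - 1]. *)
Let mgf_neg : (\int[P]_w (expR (-1 * t * Q w))%:E <= (expR (-1 * t * m + 10 * (t ^+ 2 * (L * m))))%:E)%E.
Proof.
apply: (mgf_bound (continuous_measurable_fun (@continuous_cos R))) => //.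
- by rewrite sqrrN expr1n.
- exact: cos0.
- move=> z k r C C0.
  transitivity (\int[mu]_g ((C * cos z)%:E * (normal_pdf 0 1 g * cos (k * r * g))%:E +
      (- (C * sin z))%:E * (normal_pdf 0 1 g * sin (k * r * g))%:E))%E.
    apply: eq_integral => g _; rewrite -!EFinM -EFinD (_ : k * g * r = k * r * g); last ring.
    by rewrite cosD; congr EFin; ring.
  have ic := integrable_normal_pdf_cos (k * r) (@ltr01 R).
  have is_ : mu.-integrable setT (fun g => (normal_pdf 0 1 g * sin (k * r * g))%:E).
    apply: (@le_integrable _ _ _ mu _ _ _ (fun g => (normal_pdf 0 1 g)%:E)) => //.
    - apply/measurable_EFinP; apply: measurable_funM; first exact: measurable_normal_pdf.
      exact: measurable_sinM.
    - move=> x _; rewrite !abse_EFin lee_fin normrM ler_piMr// sin_max//.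
    - exact: integrable_normal_pdf.
  rewrite integralD//; [|exact: integrableZl|exact: integrableZl].
  rewrite !integralZl// integral_sin mule0 adde0 -[X in (_ * X)%E]fineK; last exact: integrable_fin_num.
  rewrite -/(Rintegral mu setT _) Rintegral_normal_pdf_cos// -EFinM expr1n exprMn.
  by congr EFin; rewrite [RHS]mulrA; congr (_ * expR _); ring.
- move=> W A B k mW mA mB W0 [C [s1|WC]]; last by apply: swap_cos => //; exists C.
  by exfalso; move: s1; lra.
Qed.

(** Markov's inequality for the exponential, with [s] the sign of the deviation. *)
Let chernoff_bound s r : s ^+ 2 = 1 ->
  (\int[P]_w (expR (s * t * Q w))%:E <= (expR (s * t * m + 10 * (t ^+ 2 * (L * m))))%:E)%E ->
  (P [set w | (r <= s * (Q w - m))%R] <= (expR (- (t * r) + 10 * (t ^+ 2 * (L * m))))%:E)%E.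
Proof.
move=> s1 mgf.
set A := [set w | _].
have mA : measurable A.
  rewrite /A -[X in measurable X]setTI.
  by apply: measurable_fun_le => //; apply: measurable_funM => //; exact: measurable_funB.
have me : measurable_fun setT (fun w => (expR (s * t * Q w))%:E).
  by apply/measurable_EFinP; apply: measurableT_comp => //; exact: measurable_funM.
pose c := expR (t * r + s * t * m).
have : (c%:E * P A <= (expR (s * t * m + 10 * (t ^+ 2 * (L * m))))%:E)%E.
  apply: le_trans mgf; rewrite -integral_cst//.
  apply: (@le_trans _ _ (\int[P]_(w in A) (expR (s * t * Q w))%:E)%E).
    apply: ge0_le_integral => //.
    - by move=> w _; rewrite lee_fin expR_ge0.
    - exact: measurable_funTS.
    - move=> w Aw; rewrite lee_fin ler_expR -lerBrDr.
      have := ler_wpM2l (ltW t0) Aw; rewrite /= => h; apply: (le_trans h).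
      by rewrite le_eqVlt; apply/orP; left; apply/eqP; ring.
  by apply: ge0_subset_integral => // w _; rewrite lee_fin expR_ge0.
rewrite -lee_pdivlMl ?expR_gt0// => /le_trans; apply.
by rewrite lee_fin /c -expRN -expRD ler_expR; lra.
Qed.

Lemma gaussian_quadratic_concentration r :
  (P [set w | (r <= `|bform (invmx T) (X w) (X w) - \tr (invmx T *m S)|)%R] <=
   (2 * expR (- (t * r) + 10 * (t ^+ 2 * (L * \tr (invmx T *m S)))))%:E)%E.
Proof.
have h1 := chernoff_bound r (expr1n R 2) mgf_pos.
have s1 : (-1) ^+ 2 = 1 :> R by rewrite sqrrN expr1n.
have h2 := chernoff_bound r s1 mgf_neg.
rewrite mulr_natl mulr2n EFinD; apply: le_trans (leeD h1 h2).
have mle s : measurable [set w | (r <= s * (Q w - m))%R].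
  rewrite -[X in measurable X]setTI.
  by apply: measurable_fun_le => //; apply: measurable_funM => //; exact: measurable_funB.
apply: le_trans (measureU2 _ (mle 1) (mle (-1))).
apply: le_measure; rewrite ?inE.
- rewrite -[X in measurable X]setTI.
  apply: measurable_fun_le => //; apply: measurableT_comp => //; exact: measurable_funB.
- by apply: measurableU.
- by move=> w /=; rewrite -/(Q w) -/m mul1r mulN1r ler_normr => /orP[]; [left|right].
Qed.

End Concentration.

End GaussianVector.

(** * Toeplitz forms of weights with power singularities *)

Section PowerIntegral.
Variable R : realType.
Notation mu := (@lebesgue_measure R).
Implicit Types a d t : R.

Lemma integral_powR a d : a < 1 -> 0 < d ->
  (\int[mu]_(t in `]0%R, d]) (t `^ (- a))%:E = (d `^ (1 - a) / (1 - a))%:E)%E.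
Proof.
move=> a1 d0.
have a10 : 0 < 1 - a by rewrite subr_gt0.
(* A cut near 0, where the power may be unbounded; [n.+2] keeps the left end strictly below [d] even
   for [n = 0]. *)
pose F n : set R := `[(d / n.+2%:R), d]%classic.
have Fn n : 0 < d / n.+2%:R by rewrite divr_gt0.
have FU : \bigcup_n F n = `]0, d]%classic.
  apply/seteqP; split => [t [n _]|t] /=; rewrite /F /= !in_itv/=.
    by move=> /andP[h ->]; rewrite (lt_le_trans (Fn n) h).
  move=> /andP[t0 td].
  have [n nt] : exists n : nat, d / t <= n%:R.
    exists `|Num.ceil (d / t)|%N; apply: (le_trans (Num.Theory.ceil_ge _)).
    by rewrite natr_absz ler_int ler_norm.
  exists n => //=; rewrite in_itv/= td andbT ler_pdivrMr// mulrC -ler_pdivrMr//.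
  by apply: (le_trans nt); rewrite ler_nat; lia.
have ndF : nondecreasing_seq F.
  move=> m n mn; apply/subsetPset => t; rewrite /F/= !in_itv/= => /andP[h ->].
  rewrite andbT (le_trans _ h)// ler_pM2l// lef_pV2 ?posrE// ler_nat; lia.
have mp : measurable_fun setT (fun t => (t `^ (- a))%:E).
  by apply/measurable_EFinP; exact: measurable_powR.
have h1 := @ge0_nondecreasing_set_cvg_integral _ (measurableTypeR R) R F (fun t => (t `^ (- a))%:E) mu ndF.
have {}h1 : (\int[mu]_(t in F n) (t `^ (- a))%:E @[n --> \oo] --> \int[mu]_(t in `]0%R, d]) (t `^ (- a))%:E)%E.
  rewrite -FU; apply: h1 => [n|n|n t _].
  - exact: measurable_itv.
  - exact: measurable_funTS.
  - by rewrite lee_fin powR_ge0.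
have h2 n : (\int[mu]_(t in F n) (t `^ (- a))%:E = ((1 - a)^-1 * d `^ (1 - a))%:E - ((1 - a)^-1 * (d / n.+2%:R) `^ (1 - a))%:E)%E.
  apply: (@continuous_FTC2 _ _ (fun t => (1 - a)^-1 * t `^ (1 - a))).
  - by rewrite ltr_pdivrMr// ltr_pMr// ltr1n.
  - apply: derivable_within_continuous => t; rewrite in_itv/= => /andP[t0 _].
    by apply: derivable_powR; rewrite in_itv/= andbT (lt_le_trans (Fn n) t0).
  - have cont t : 0 < t -> {for t, continuous (fun t : R => (1 - a)^-1 * t `^ (1 - a))}.
      move=> t0; apply: differentiable_continuous; apply/derivable1_diffP.
      by apply: derivableM => //; apply: derivable_powR; rewrite in_itv/= andbT.
    split.
    + move=> t; rewrite in_itv/= => /andP[t0 _].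
      by apply: derivableM => //; apply: derivable_powR; rewrite in_itv/= andbT (lt_trans (Fn n) t0).
    + exact/cvg_at_right_filter/cont.
    + exact/cvg_at_left_filter/cont.
  - move=> t; rewrite in_itv/= => /andP[t0 _].
    have tp := lt_trans (Fn n) t0.
    have := is_derive1_powR (1 - a) tp => dp.
    rewrite derive1E; have [_ ->] : is_derive t 1 (fun t => (1 - a)^-1 * t `^ (1 - a)) (t `^ (- a)).
      apply: is_derive_eq; rewrite /GRing.scale/= ?mulr0 ?addr0 ?add0r mulrA mulVf ?gt_eqF// mul1r.
      by congr (_ `^ _); ring.
    by [].
apply: (cvg_unique _ h1) => //.
apply: cvg_trans (_ : (fun n : nat => ((1 - a)^-1 * d `^ (1 - a) - (1 - a)^-1 * (d / n.+2%:R) `^ (1 - a))%:E) @ \oo `=>` _).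
  by apply: near_eq_cvg; apply: nearW => n; rewrite h2.
apply: cvg_EFin; first exact: nearW.
rewrite (_ : fine \o _ = (fun n : nat => (1 - a)^-1 * d `^ (1 - a) - (1 - a)^-1 * (d / n.+2%:R) `^ (1 - a)))//.
rewrite (_ : d `^ (1 - a) / (1 - a) = (1 - a)^-1 * d `^ (1 - a) - (1 - a)^-1 * 0); last by ring.
apply: cvgB; first exact: cvg_cst.
apply: cvgM; first exact: cvg_cst.
have /cvg_at_rightP := powR_cvg0 a10; apply; split => //.
rewrite -[X in _ --> X](mulr0 d); apply: cvgM; first exact: cvg_cst.
apply/gtr0_cvgV0; first exact: nearW.
apply/cvgrnyP; rewrite [X in X @ _](_ : _ = fun n => n + 2)%N; first exact: cvg_addnr.
by apply/funext => n; rewrite addn2.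
Qed.

(* The origin, where the densities may vanish or blow up, is removed. *)
Definition Upi : set R := [set t | - pi < t < pi /\ t != 0].

Lemma Upi_neq0 t : Upi t -> 0 < `|t|.
Proof. by case=> _; rewrite normr_gt0. Qed.

Lemma Upi_norm t : Upi t -> `|t| < pi.
Proof. by case=> + _; rewrite ltr_norml. Qed.

Lemma UpiE : Upi = `]- pi, pi[%classic `\ 0.
Proof.
by apply/seteqP; split => t /=; rewrite /Upi/= in_itv/= => -[? /eqP ?].
Qed.

Lemma measurable_Upi : measurable Upi.
Proof. by rewrite UpiE; apply: measurableD. Qed.

Lemma measurable_trunc_powR a d :
  measurable_fun setT (fun t => if `|t| < d then `|t| `^ (- a) else 0).
Proof.
apply: measurable_fun_ifT => //.
  by apply: measurable_fun_ltr => //; exact: normr_measurable.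
exact: (measurableT_comp (measurable_powR _)).
Qed.

Lemma integral_trunc_powR a d : a < 1 -> 0 < d ->
  (\int[mu]_(t in Upi) (if `|t| < d then `|t| `^ (- a) else 0)%:E <=
   (2 * (d `^ (1 - a) / (1 - a)))%:E)%E.
Proof.
move=> a1 d0.
(* The right half of the truncated power; [f t + f (- t)] dominates it off the origin, hence the
   factor 2. *)
pose f (t : R) := (if (0 < t <= d)%R then t `^ (- a) else 0)%:E.
have f0 t : (0 <= f t)%E by rewrite /f lee_fin; case: ifP => // _; rewrite powR_ge0.
have mf : measurable_fun setT f.
  apply/measurable_EFinP; apply: measurable_fun_ifT => //.
  by apply: measurable_and; [exact: measurable_fun_ltr|exact: measurable_fun_ler].
have If : (\int[mu]_t f t = (d `^ (1 - a) / (1 - a))%:E)%E.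
  rewrite -integral_powR// [RHS]integral_mkcond; apply: eq_integral => t _.
  by rewrite /f patchE mem_setE in_itv/=; case: ifP.
apply: (@le_trans _ _ (\int[mu]_t (f t + f (- t)%R))%E).
  apply: (@le_trans _ _ (\int[mu]_(t in Upi) (f t + f (- t)%R))%E).
    apply: ge0_le_integral => //.
    - exact: measurable_Upi.
    - by move=> t _; rewrite lee_fin; case: ifP => // _; exact: powR_ge0.
    - by apply/measurable_funTS/measurable_EFinP; exact: measurable_trunc_powR.
    - apply/measurable_funTS; apply: emeasurable_funD => //.
      exact: (measurableT_comp mf).
    - move=> t /Upi_neq0; rewrite normr_gt0 => t0; rewrite /f -EFinD lee_fin.
      case: (ltrgt0P t) t0 => // t0 _.
        rewrite (lt_gtF (_ : - t < 0)) ?oppr_lt0//= addr0.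
        by case: ifP => td; [rewrite (ltW td)|case: ifP => // _; exact: powR_ge0].
      rewrite /= add0r oppr_gt0 t0/=.
      by case: ifP => td; [rewrite (ltW td)|case: ifP => // _; exact: powR_ge0].
  apply: ge0_subset_integral => //; first exact: measurable_Upi.
    by apply: emeasurable_funD => //; exact: (measurableT_comp mf).
  by move=> t _; rewrite adde_ge0.
rewrite ge0_integralD//; last exact: (measurableT_comp mf).
by rewrite ge0_integral_opp// If -EFinD lee_fin mulr_natl mulr2n.
Qed.

Lemma integral_powR_lb a d : a < 1 -> 0 < d < pi ->
  ((d `^ (1 - a) / (1 - a))%:E <= \int[mu]_(t in Upi) (`|t| `^ (- a))%:E)%E.
Proof.
move=> a1 /andP[d0 dpi].
rewrite -integral_powR// (@eq_integral _ _ _ mu _ (fun t => (`|t| `^ (- a))%:E)); last first.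
  by move=> t; rewrite inE/= in_itv/= => /andP[t0 _]; rewrite gtr0_norm.
apply: ge0_subset_integral => //.
- exact: measurable_Upi.
- apply/measurable_funTS/measurable_EFinP.
  by apply: (measurableT_comp (measurable_powR _)); exact: normr_measurable.
- move=> t /=; rewrite in_itv/= => /andP[t0 td]; split; last by rewrite gt_eqF.
  by rewrite (lt_trans _ t0) ?oppr_lt0 ?pi_gt0// (le_lt_trans td).
Qed.

Lemma integrable_trunc_powR a d : a < 1 -> 0 < d ->
  mu.-integrable Upi (fun t => (if `|t| < d then `|t| `^ (- a) else 0)%:E).
Proof.
move=> a1 d0; apply/integrableP; split.
  by apply/measurable_funTS/measurable_EFinP; exact: measurable_trunc_powR.
under eq_integral.
  move=> t _; rewrite gee0_abs; last by rewrite lee_fin; case: ifP => // _; rewrite powR_ge0.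
  over.
by apply: (le_lt_trans (integral_trunc_powR a1 d0)); rewrite ltry.
Qed.

Lemma integrable_norm_powR a : a < 1 ->
  mu.-integrable Upi (fun t => (`|t| `^ (- a))%:E).
Proof.
move=> a1; apply: eq_integrable (integrable_trunc_powR a1 (pi_gt0 R)).
  exact: measurable_Upi.
by move=> t; rewrite inE => /Upi_norm ->.
Qed.

End PowerIntegral.

(** * The normalized integral over the punctured interval *)

Section MeanFunctional.
Variable R : realType.
Notation mu := (@lebesgue_measure R).
Notation Upi := (@Upi R).
Implicit Types (f g h : R -> R) (c : R).

Definition iJ h := mu.-integrable Upi (EFin \o h).
Definition J h : R := (pi *+ 2)^-1 * \int[mu]_(t in Upi) h t.

Let mU : measurable (Upi : set (measurableTypeR R)) := @measurable_Upi R.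
Let p2 : 0 < (pi *+ 2 : R). Proof. by rewrite pmulrn_rgt0// pi_gt0. Qed.

Lemma iJ_dom h k : measurable_fun setT h -> iJ k ->
  (forall t, Upi t -> `|h t| <= `|k t|) -> iJ h.
Proof.
move=> mh ik hk; apply: (le_integrable mU _ _ ik).
  by apply/measurable_EFinP; exact: measurable_funTS.
by move=> t Ut; rewrite !abse_EFin lee_fin hk.
Qed.

Lemma iJD g h : iJ g -> iJ h -> iJ (fun t => g t + h t).
Proof. by move=> ig ih; apply: (integrableD mU ig ih). Qed.

Lemma iJZ c h : iJ h -> iJ (fun t => c * h t).
Proof. by move=> ih; apply: (integrableZl mU c ih). Qed.

Lemma iJB g h : iJ g -> iJ h -> iJ (fun t => g t - h t).
Proof. by move=> ig ih; apply: (integrableB mU ig ih). Qed.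

Lemma iJ_cst c : iJ (fun=> c).
Proof.
apply: (@iJ_dom _ (fun t => `|c| * (`|t| `^ (- 0)))) => //; last first.
- move=> t _; by rewrite oppr0 powRr0 mulr1 normr_id.
- by apply: (iJZ _ (integrable_norm_powR (@ltr01 R))).
Qed.

Lemma iJM (b : R -> R) (M : R) h : measurable_fun setT b -> measurable_fun setT h ->
  (forall t, Upi t -> `|b t| <= M) -> iJ h -> iJ (fun t => b t * h t).
Proof.
move=> mb mh bM ih; apply: (@iJ_dom _ (fun t => M * h t)) => //.
- exact: measurable_funM.
- exact: iJZ.
- move=> t Ut; rewrite !normrM ler_wpM2r//.
  by apply: (le_trans (bM t Ut)); rewrite ler_norm.
Qed.

Lemma JD g h : iJ g -> iJ h -> J (fun t => g t + h t) = J g + J h.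
Proof. by move=> ig ih; rewrite /J RintegralD// mulrDr. Qed.

Lemma JB g h : iJ g -> iJ h -> J (fun t => g t - h t) = J g - J h.
Proof. by move=> ig ih; rewrite /J RintegralB// mulrBr. Qed.

Lemma JZ c h : iJ h -> J (fun t => c * h t) = c * J h.
Proof. by move=> ih; rewrite /J RintegralZl// mulrCA. Qed.

Lemma eq_J g h : (forall t, Upi t -> g t = h t) -> J g = J h.
Proof.
by move=> gh; rewrite /J; congr (_ * _); apply: eq_Rintegral => t; rewrite inE; exact: gh.
Qed.

Lemma le_J g h : iJ g -> iJ h -> (forall t, Upi t -> g t <= h t) -> J g <= J h.
Proof.
by move=> ig ih gh; rewrite /J ler_pM2l ?invr_gt0//; apply: le_Rintegral.
Qed.

Lemma J_ge0 h : (forall t, Upi t -> 0 <= h t) -> 0 <= J h.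
Proof.
by move=> h0; rewrite /J mulr_ge0 ?invr_ge0//; [exact: ltW|exact: Rintegral_ge0].
Qed.

Lemma ler_norm_J h : iJ h -> `|J h| <= J (fun t => `|h t|).
Proof.
move=> ih; rewrite /J normrM gtr0_norm ?invr_gt0// ler_pM2l ?invr_gt0//.
exact: le_normr_Rintegral.
Qed.

Lemma iJ_norm h : iJ h -> iJ (fun t => `|h t|).
Proof. exact: integrable_norm. Qed.

Lemma iJ_sum I (s : seq I) (F : I -> R -> R) : (forall i, iJ (F i)) ->
  iJ (fun t => \sum_(i <- s) F i t).
Proof.
move=> iF; elim: s => [|i s IH].
  by under [X in iJ X]eq_fun do rewrite big_nil; exact: iJ_cst.
by under [X in iJ X]eq_fun do rewrite big_cons; exact: iJD.
Qed.

Lemma J_cst c : J (fun=> c) = c.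
Proof.
rewrite /J Rintegral_cst// UpiE.
have E : (\int[mu]_(t in `](- pi)%R, pi[%classic `\ 0%R) (cst 1%E t) = (pi *+ 2)%:E)%E.
  rewrite (@integral_setD1 _ (cst 1%E)) //; last exact: measurableD.
  rewrite integral_cst//= mul1e lebesgue_measure_itv/= lte_fin gtrN ?pi_gt0//.
  by rewrite -EFinD opprK mulr2n.
rewrite (_ : fine _ = pi *+ 2); last first.
  move: E; rewrite integral_cst ?mul1e; last exact: measurableD.
  by move=> E; exact: (congr1 fine E).
by rewrite mulrC -mulrA divff ?mulr1// gt_eqF.
Qed.

Lemma J_sum I (s : seq I) (F : I -> R -> R) : (forall i, iJ (F i)) ->
  J (fun t => \sum_(i <- s) F i t) = \sum_(i <- s) J (F i).
Proof.
move=> iF; elim: s => [|i s IH].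
  rewrite big_nil -[RHS](J_cst 0); apply: eq_J => t _; by rewrite big_nil.
rewrite big_cons -IH -JD//; last exact: iJ_sum.
by apply: eq_J => t _; rewrite big_cons.
Qed.

(** The half-open interval of the definitions differs from [Upi] by the two points [- pi] and
    [0]. *)
Lemma RintegralE h : measurable_fun setT h ->
  (pi *+ 2)^-1 * \int[mu]_(t in `[- pi, pi[) h t = J h.
Proof.
move=> mh; rewrite /J /Rintegral UpiE; congr (_ * fine _).
have mh' (A : set R) : measurable_fun A (EFin \o h).
  by apply/measurable_EFinP; exact: measurable_funTS.
rewrite integral_setD1//; last exact: measurableD.
by rewrite integral_itv_obnd_cbnd.
Qed.

Lemma fcoefE g (m : int) : measurable_fun setT g ->
  fcoef g m = J (fun t => cos (m%:~R * t) * g t).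
Proof.
by move=> mg; rewrite /fcoef RintegralE//; apply: measurable_funM => //; exact: measurable_cosM.
Qed.

Lemma sin_npi (k : nat) : sin (k%:R * pi) = 0 :> R.
Proof.
elim: k => [|k IH]; first by rewrite mul0r sin0.
by rewrite -natr1 mulrDl mul1r sinDpi IH oppr0.
Qed.

Lemma J_cos (m : int) : J (fun t => cos (m%:~R * t)) = (m == 0)%:R.
Proof.
have [->|m0] := eqVneq m 0.
  by rewrite -[RHS]J_cst; apply: eq_J => t _; rewrite mul0r cos0.
have mc : measurable_fun setT (fun t : R => cos (m%:~R * t)) by exact: measurable_cosM.
rewrite -RintegralE// /Rintegral.
have mc' (A : set R) : measurable_fun A (EFin \o (fun t : R => cos (m%:~R * t))).
  by apply/measurable_EFinP; exact: measurable_funTS.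
rewrite integral_itv_bndo_bndc//.
have mr0 : (m%:~R : R) != 0 by rewrite intr_eq0.
have dS (t : R) : is_derive t 1 (fun t => m%:~R^-1 * sin (m%:~R * t)) (cos (m%:~R * t)).
  have d1 : is_derive t 1 (fun t : R => sin (m%:~R * t)) (m%:~R * cos (m%:~R * t)).
    by apply: is_derive_eq; rewrite /GRing.scale /= ?mulr0 ?add0r ?addr0 ?mulr1 mulrC.
  apply: is_derive_eq; rewrite /GRing.scale /= ?mulr0 ?add0r ?addr0 mulrA mulVf// mul1r//.
have cS : continuous (fun t : R => m%:~R^-1 * sin (m%:~R * t)).
  move=> t; apply: differentiable_continuous; apply/derivable1_diffP.
  by have := dS t => -[].
rewrite (@continuous_FTC2 _ _ (fun t => m%:~R^-1 * sin (m%:~R * t))).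
- have s0 : sin (m%:~R * pi) = 0 :> R.
    case: m {m0 mc mc' mr0 dS cS} => [k|k].
      exact: sin_npi.
    by rewrite NegzE mulrNz mulNr sinN sin_npi oppr0.
  by rewrite mulrN sinN s0 oppr0 mulr0 subee//= mulr0.
- by rewrite gtrN ?pi_gt0.
- have cc : continuous (fun t : R => cos (m%:~R * t)).
    move=> t; apply: (@continuous_comp _ _ _ ( *%R (m%:~R : R)) (@cos R)).
      exact: mulrl_continuous.
    exact: continuous_cos.
  exact: continuous_subspaceT.
- split.
  + by move=> t _; have := dS t => -[].
  + by apply: cvg_at_right_filter; exact: cS.
  + by apply: cvg_at_left_filter; exact: cS.
- by move=> t _; rewrite derive1E; have := dS t => -[].
Qed.

End MeanFunctional.

(** * Toeplitz forms as weighted integrals of trigonometric polynomials *)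

Section Toeplitz.
Variable R : realType.
Notation Upi := (@Upi R).
Variable n : nat.
Implicit Types (f g h : R -> R) (x y : 'cV[R]_n) (t : R).

Definition cvec t : 'cV[R]_n := \col_j cos (j%:R * t).
Definition svec t : 'cV[R]_n := \col_j sin (j%:R * t).

(* Real part of p_x(t) times the conjugate of p_y(t),
   for p_x(t) = sum_j x_j exp(i j t). *)
Definition trig x y t : R :=
  dot x (cvec t) * dot y (cvec t) + dot x (svec t) * dot y (svec t).

Lemma bformE (M : 'M[R]_n) x y :
  bform M x y = \sum_i \sum_j (x i ord0 * y j ord0) * M i j.
Proof.
rewrite /bform -mulmxA mxE; apply: eq_bigr => i _; rewrite !mxE mulr_sumr.
by apply: eq_bigr => j _; ring.
Qed.

Lemma trigE x y t : trig x y t =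
  \sum_(i < n) \sum_(j < n) (x i ord0 * y j ord0) * cos ((i%:Z - j%:Z)%:~R * t).
Proof.
rewrite /trig /dot !mxE !mulr_suml -big_split/=; apply: eq_bigr => i _.
rewrite !mulr_sumr -big_split/=; apply: eq_bigr => j _.
by rewrite !mxE intrB mulrBl cosB; ring.
Qed.

Lemma measurable_trig x y : measurable_fun setT (trig x y).
Proof.
rewrite (_ : trig x y = fun t => \sum_(i < n) \sum_(j < n) (x i ord0 * y j ord0) * cos ((i%:Z - j%:Z)%:~R * t)).
  apply: measurable_sum => i; apply: measurable_sum => j; apply: measurable_funM => //.
  exact: measurable_cosM.
by apply/funext => t; exact: trigE.
Qed.

Lemma iJ_cosM g (m : int) : measurable_fun setT g -> iJ g ->
  iJ (fun t => cos (m%:~R * t) * g t).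
Proof.
move=> mg ig; apply: (@iJM _ _ 1) => //; first exact: measurable_cosM.
by move=> t _; exact: cos_max.
Qed.

Lemma iJ_trig g x y : measurable_fun setT g -> iJ g -> iJ (fun t => g t * trig x y t).
Proof.
move=> mg ig.
rewrite (_ : (fun _ => _) = fun t => \sum_(i < n) \sum_(j < n) (x i ord0 * y j ord0) * (cos ((i%:Z - j%:Z)%:~R * t) * g t)).
  by apply: iJ_sum => i; apply: iJ_sum => j; apply: iJZ; exact: iJ_cosM.
apply/funext => t; rewrite trigE mulr_sumr; apply: eq_bigr => i _.
by rewrite mulr_sumr; apply: eq_bigr => j _; ring.
Qed.

Lemma bform_toeplitz g x y : measurable_fun setT g -> iJ g ->
  bform (toeplitz n g) x y = J (fun t => g t * trig x y t).
Proof.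
move=> mg ig; rewrite bformE.
have iF i j : iJ (fun t => (x i ord0 * y j ord0) * (cos ((i%:Z - j%:Z)%:~R * t) * g t)).
  by apply: iJZ; exact: iJ_cosM.
transitivity (J (fun t => \sum_(i < n) \sum_(j < n) (x i ord0 * y j ord0) * (cos ((i%:Z - j%:Z)%:~R * t) * g t))).
  rewrite J_sum => [|i]; last exact: iJ_sum.
  apply: eq_bigr => i _; rewrite J_sum//; apply: eq_bigr => j _.
  by rewrite JZ ?mxE ?fcoefE//; exact: iJ_cosM.
apply: eq_J => t _; rewrite trigE mulr_sumr; apply: eq_bigr => i _.
by rewrite mulr_sumr; apply: eq_bigr => j _; ring.
Qed.

Lemma toeplitz_sym g : (toeplitz n g)^T = toeplitz n g.
Proof.
apply/matrixP => i j; rewrite !mxE /fcoef; congr (_ * _); apply: eq_Rintegral => t _.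
by rewrite -cosN -mulNr -mulrNz opprB.
Qed.

Lemma toeplitz1 : toeplitz n (fun=> 1 : R) = 1%:M.
Proof.
apply/matrixP => i j; rewrite !mxE fcoefE//.
rewrite (@eq_J _ _ (fun t => cos ((i%:Z - j%:Z)%:~R * t))); last by move=> t _; rewrite mulr1.
by rewrite J_cos subr_eq0 eqz_nat.
Qed.

Lemma J_trig x y : J (trig x y) = dot x y.
Proof.
have := @bform_toeplitz (fun=> 1) x y (measurable_cst _) (iJ_cst 1).
rewrite toeplitz1 /bform mulmx1 -/(dot x y) => ->.
by apply: eq_J => t _; rewrite mul1r.
Qed.

(** For [M] the inverse of a Toeplitz matrix this writes the mean of the quadratic form as an
    integral of [f], which opens the way to dominated convergence. *)
Lemma mxtrace_toeplitz f (M : 'M[R]_n) : measurable_fun setT f -> iJ f ->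
  \tr (M *m toeplitz n f) =
  J (fun t => f t * (bform M (cvec t) (cvec t) + bform M (svec t) (svec t))).
Proof.
move=> mf jf.
have iF (i j : 'I_n) : iJ (fun t => M i j * (cos ((j%:Z - i%:Z)%:~R * t) * f t)).
  by apply: iJZ; exact: iJ_cosM.
transitivity (J (fun t => \sum_(i < n) \sum_(j < n) M i j * (cos ((j%:Z - i%:Z)%:~R * t) * f t))).
  rewrite J_sum => [|i]; last exact: iJ_sum.
  rewrite /mxtrace; apply: eq_bigr => i _; rewrite mxE J_sum//; apply: eq_bigr => j _.
  by rewrite JZ ?mxE ?fcoefE//; exact: iJ_cosM.
apply: eq_J => t _; rewrite !bformE -big_split mulr_sumr/=; apply: eq_bigr => i _.
rewrite -big_split mulr_sumr/=; apply: eq_bigr => j _.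
by rewrite !mxE intrB mulrBl cosB; ring.
Qed.

Lemma trig_ge0 x t : 0 <= trig x x t.
Proof. by rewrite /trig -!expr2 addr_ge0 ?sqr_ge0. Qed.

Lemma dot_cs t : dot (cvec t) (cvec t) + dot (svec t) (svec t) = n%:R.
Proof.
rewrite /dot !mxE -big_split/= (eq_bigr (fun=> 1)) => [|i _].
  by rewrite sumr_const card_ord.
by rewrite !mxE -!expr2 cos2Dsin2.
Qed.

Lemma dot_ge0 x : 0 <= dot x x.
Proof. by rewrite /dot mxE sumr_ge0// => i _; rewrite mxE -expr2 sqr_ge0. Qed.

Lemma dot_gt0 x : x != 0 -> 0 < dot x x.
Proof.
move=> x0; rewrite lt_neqAle dot_ge0 andbT eq_sym; apply: contra x0.
rewrite /dot mxE psumr_eq0 => [/allP h|i _]; last by rewrite mxE -expr2 sqr_ge0.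
apply/eqP/matrixP => i j; rewrite (ord1 j) [RHS]mxE; apply/eqP.
by have := h i (mem_index_enum i); rewrite mxE -expr2 sqrf_eq0.
Qed.

Lemma dot_CS x y : dot x y ^+ 2 <= dot x x * dot y y.
Proof.
have E a b : dot a b = bform (1%:M : 'M[R]_n) a b by rewrite /bform mulmx1.
by rewrite !E; apply: bform_CS; [exact: trmx1|move=> z; rewrite -E dot_ge0].
Qed.

Lemma trig_le x t : trig x x t <= n%:R * dot x x.
Proof.
rewrite /trig -!expr2 -(dot_cs t) mulrC mulrDr lerD ?dot_CS//.
Qed.

End Toeplitz.

(** * Elementary bounds for the sine *)

Section SineBounds.
Variable R : realType.
Implicit Types x y t : R.

Lemma sin_MVT y : 0 <= y -> exists2 c, 0 <= c <= y & sin y = cos c * y.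
Proof.
move=> y0.
have [c cy h] := MVT_segment y0 (fun x (_ : x \in `]0, y[) => is_derive_sin x)
  (continuous_subspaceT (@continuous_sin R)).
exists c; first by move: cy; rewrite in_itv.
by move: h; rewrite sin0 !subr0.
Qed.

(** A lower bound for sin y / y on (0, 3 pi / 4]: in sin y = 2 sin(y/2) cos(y/2) the mean value
    theorem replaces sin(y/2) by cos(c) y/2, and both cosines are at least cos(3 pi / 8). The range
    contains |l + t| / 2 whenever |t| < |l| / 2 and |l| < pi. *)
Definition sinc0 : R := cos (3 * pi / 8) ^+ 2.

Lemma sinc0_gt0 : 0 < sinc0.
Proof.
rewrite exprn_gt0//; apply: cos_gt0_pihalf; have := pi_gt0 R; lra.
Qed.

Lemma sin_ge_sinc0 y : 0 <= y <= 3 * pi / 4 -> sinc0 * y <= sin y.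
Proof.
move=> /andP[y0 yp]; have p0 := pi_gt0 R.
have y2 : 0 <= y / 2 by rewrite divr_ge0.
have [c /andP[c0 cy] sE] := sin_MVT y2.
have cosd (z : R) : 0 <= z <= 3 * pi / 8 -> cos (3 * pi / 8) <= cos z.
  move=> /andP[z0 zp]; move: zp; rewrite le_eqVlt => /predU1P[->//|zp].
  by apply/ltW; rewrite ltr_cos// in_itv/=; apply/andP; split; lra.
have k0 : 0 <= cos (3 * pi / 8) :> R by apply: cos_ge0_pihalf; lra.
have h1 : cos (3 * pi / 8) <= cos c by apply: cosd; rewrite c0/=; lra.
have h2 : cos (3 * pi / 8) <= cos (y / 2) by apply: cosd; rewrite y2/=; lra.
have -> : sin y = cos c * cos (y / 2) * y.
  rewrite [in LHS](_ : y = y / 2 + y / 2); last by field.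
  by rewrite sinD sE; field.
by rewrite ler_wpM2r// /sinc0 expr2 ler_pM.
Qed.

Lemma sqr_sin_ge t : `|t| <= 3 * pi / 4 -> (sinc0 * t) ^+ 2 <= sin t ^+ 2.
Proof.
move=> tp.
have h (s : R) : 0 <= s <= 3 * pi / 4 -> (sinc0 * s) ^+ 2 <= sin s ^+ 2.
  move=> /[dup] sp /andP[s0 _]; rewrite lerXn2r ?nnegrE ?sin_ge_sinc0//.
    by rewrite mulr_ge0// ltW// sinc0_gt0.
  by apply: le_trans (sin_ge_sinc0 sp); rewrite mulr_ge0// ltW// sinc0_gt0.
have [t0|t0] := leP 0 t; first by apply: h; rewrite t0/= -(ger0_norm t0).
have := h (- t); rewrite sinN !mulrN !sqrrN; apply.
by rewrite oppr_ge0 ltW//= -(ltr0_norm t0).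
Qed.

Lemma sqr_sin_le t : sin t ^+ 2 <= t ^+ 2.
Proof.
have h (s : R) : 0 <= s -> sin s ^+ 2 <= s ^+ 2.
  move=> s0; have [c _ ->] := sin_MVT s0.
  by rewrite exprMn ler_piMl ?sqr_ge0// -(cos2Dsin2 c) lerDl sqr_ge0.
have [t0|t0] := leP 0 t; first exact: h.
by have := h (- t); rewrite sinN !sqrrN; apply; rewrite oppr_ge0 ltW.
Qed.

Lemma twoB2cos t : 2 - 2 * cos t = 4 * sin (t / 2) ^+ 2.
Proof.
rewrite [in LHS](_ : t = t / 2 + t / 2); last by field.
by rewrite cosD -!expr2 cos2sin2; ring.
Qed.

End SineBounds.

(** * Dirichlet sums and the Fejer kernel *)

Section DirichletKernel.
Variable R : realType.
Implicit Types s t l : R.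

Lemma sum_cos_sin n s : 2 * sin (s / 2) * (\sum_(j < n) cos (j%:R * s)) =
  sin (n%:R * s - s / 2) + sin (s / 2).
Proof.
elim: n => [|n IH]; first by rewrite big_ord0 mulr0 mul0r sub0r sinN addNr.
rewrite big_ord_recr/= mulrDr IH.
rewrite (_ : n.+1%:R * s - s / 2 = n%:R * s + s / 2); last by rewrite -natr1; field.
rewrite sinB sinD; ring.
Qed.

Lemma sum_sin_sin n s : 2 * sin (s / 2) * (\sum_(j < n) sin (j%:R * s)) =
  cos (s / 2) - cos (n%:R * s - s / 2).
Proof.
elim: n => [|n IH]; first by rewrite big_ord0 mulr0 mul0r sub0r cosN subrr.
rewrite big_ord_recr/= mulrDr IH.
rewrite (_ : n.+1%:R * s - s / 2 = n%:R * s + s / 2); last by rewrite -natr1; field.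
rewrite cosB cosD; ring.
Qed.

(** Squared modulus of the sum of the exp(i j s), that is, [n] times the Fejer kernel. *)
Definition fejer n s : R :=
  (\sum_(j < n) cos (j%:R * s)) ^+ 2 + (\sum_(j < n) sin (j%:R * s)) ^+ 2.

Lemma fejer_sin n s : sin (s / 2) ^+ 2 * fejer n s <= 2.
Proof.
have h (u v w : R) : 2 * sin (s / 2) * u = v + w -> `|v| <= 1 -> `|w| <= 1 ->
    (sin (s / 2) * u) ^+ 2 <= 1.
  move=> e v1 w1; rewrite -real_normK ?num_real// expr_le1//.
  have -> : sin (s / 2) * u = (v + w) / 2 by rewrite -e; field.
  rewrite normrM (ger0_norm (_ : 0 <= 2^-1))// ler_pdivrMr// mul1r.
  by apply: (le_trans (ler_normD _ _)); lra.
rewrite /fejer mulrDr -!exprMn (_ : 2 = 1 + 1 :> R); last by ring.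
apply: lerD.
  by apply: (h _ _ _ (sum_cos_sin n s)); rewrite ?sin_max.
by apply: (h _ _ _ (sum_sin_sin n s)); rewrite ?normrN ?cos_max.
Qed.

(** Real substitute for the Fejer kernel centred at [l]: treating the cosine and sine parts of exp(i
    j l) separately symmetrizes it over [l] and [- l], which costs nothing against even weights. *)
Definition fejer2 n l t : R :=
  trig (cvec n l) (cvec n l) t + trig (svec n l) (svec n l) t.

Lemma fejer2E n l t : fejer2 n l t = (fejer n (l + t) + fejer n (l - t)) / 2.
Proof.
have E (F G : 'I_n -> R) : dot (\col_j F j) (\col_j G j) = \sum_j F j * G j.
  by rewrite /dot mxE; apply: eq_bigr => j _; rewrite !mxE.
rewrite /fejer2 /trig /fejer /cvec /svec !E.
set cc := \sum_j cos _ * cos _; set cs := \sum_j cos _ * sin _.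
set sc := \sum_j sin _ * cos _; set ss := \sum_j sin _ * sin _.
have -> : \sum_(j < n) cos (j%:R * (l + t)) = cc - ss.
  by rewrite -sumrB; apply: eq_bigr => j _; rewrite mulrDr cosD.
have -> : \sum_(j < n) sin (j%:R * (l + t)) = sc + cs.
  by rewrite -big_split; apply: eq_bigr => j _; rewrite mulrDr sinD.
have -> : \sum_(j < n) cos (j%:R * (l - t)) = cc + ss.
  by rewrite -big_split; apply: eq_bigr => j _; rewrite mulrBr cosB.
have -> : \sum_(j < n) sin (j%:R * (l - t)) = sc - cs.
  by rewrite -sumrB; apply: eq_bigr => j _; rewrite mulrBr sinB.
by field.
Qed.

Lemma fejer2_ge0 n l t : 0 <= fejer2 n l t.
Proof. by rewrite addr_ge0// trig_ge0. Qed.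

Lemma measurable_fejer2 n l : measurable_fun setT (fejer2 n l).
Proof. by apply: measurable_funD; exact: measurable_trig. Qed.

Lemma iJ_fejer2 n l g : measurable_fun setT g -> iJ g -> iJ (fun t => g t * fejer2 n l t).
Proof.
move=> mg ig; rewrite (_ : (fun t => _) = fun t => g t * trig (cvec n l) (cvec n l) t + g t * trig (svec n l) (svec n l) t).
  by apply: iJD; exact: iJ_trig.
by apply/funext => t; rewrite mulrDr.
Qed.

Lemma J_fejer2 n l : J (fejer2 n l) = n%:R.
Proof.
have i1 x y : iJ (@trig R n x y).
  have := iJ_trig x y (@measurable_cst _ _ _ _ setT (1 : R)) (iJ_cst 1).
  by rewrite (_ : (fun t => _) = trig x y)//; apply/funext => t; rewrite mul1r.
by rewrite JD// !J_trig dot_cs.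
Qed.

Lemma fejer2_sin n l t m : m <= sin ((l + t) / 2) ^+ 2 -> m <= sin ((l - t) / 2) ^+ 2 ->
  m * fejer2 n l t <= 2.
Proof.
move=> h1 h2; rewrite fejer2E mulrA ler_pdivrMr// mulrDr.
have f0 s : 0 <= fejer n s by rewrite addr_ge0// sqr_ge0.
have := fejer_sin n (l + t); have := fejer_sin n (l - t).
have := ler_wpM2r (f0 (l + t)) h1; have := ler_wpM2r (f0 (l - t)) h2; lra.
Qed.

(** The difference of cosines measures the distance from both peaks [l] and [- l] at once, being
    twice the product of the two half-angle sines. *)
Lemma fejer2_cos n l t : (cos t - cos l) ^+ 2 * fejer2 n l t <= 8.
Proof.
have e : cos t - cos l = 2 * (sin ((l + t) / 2) * sin ((l - t) / 2)).
  have -> : cos t = cos ((l + t) / 2 - (l - t) / 2) by congr cos; field.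
  have -> : cos l = cos ((l + t) / 2 + (l - t) / 2) by congr cos; field.
  by rewrite cosB cosD; ring.
have s1 (x : R) : sin x ^+ 2 <= 1.
  by rewrite -(cos2Dsin2 x) lerDr sqr_ge0.
have := @fejer2_sin n l t ((cos t - cos l) ^+ 2 / 4).
rewrite e !exprMn => /(_ _ _)/wrap[].
- have := s1 ((l - t) / 2); have := sqr_ge0 (sin ((l + t) / 2)); nra.
- have := s1 ((l + t) / 2); have := sqr_ge0 (sin ((l - t) / 2)); nra.
- lra.
Qed.

End DirichletKernel.

(** * Weights and bounds for the eigenvalues of their Toeplitz matrices *)

Section Weights.
Variable R : realType.
Notation Upi := (@Upi R).
Implicit Types (f g h : R -> R) (a b d t l : R).

(** Upper and lower exponent are separate parameters, so that passing to [1 / g] just swaps them. *)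
Record weight a b g : Prop := Weight {
  weight_meas : measurable_fun setT g ;
  weight_ge0 : forall t, 0 <= g t ;
  weight_even : forall t, g (- t) = g t ;
  weight_cont : forall t, Upi t -> {for t, continuous g} ;
  weight_lb : exists2 c, 0 < c & forall t, Upi t -> c * `|t| `^ b <= g t ;
  weight_ub : exists2 C, 0 < C & forall t, Upi t -> g t <= C * `|t| `^ (- a) }.

Lemma measurable_norm_powR a : measurable_fun setT (fun t : R => `|t| `^ a).
Proof. by apply: (measurableT_comp (measurable_powR _)); exact: normr_measurable. Qed.

Lemma weight_gt0 a b g t : weight a b g -> Upi t -> 0 < g t.
Proof.
move=> [_ _ _ _ [c c0 H] _] Ut; apply: lt_le_trans (H t Ut).
by rewrite mulr_gt0// powR_gt0// Upi_neq0.
Qed.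

Lemma iJ_powR a : a < 1 -> iJ (fun t : R => `|t| `^ (- a)).
Proof. exact: integrable_norm_powR. Qed.

Lemma iJ_weight a b g : a < 1 -> weight a b g -> iJ g.
Proof.
move=> a1 [mg g0 _ _ _ [C C0 HC]].
apply: (@iJ_dom _ _ (fun t => C * `|t| `^ (- a))) => //.
  by apply: iJZ; exact: iJ_powR.
by move=> t Ut; rewrite ger0_norm// (le_trans (HC t Ut))// ler_norm.
Qed.

Lemma weight_inv a b g : weight a b g -> weight b a (fun t => (g t)^-1).
Proof.
move=> W; have g0 t := @weight_gt0 a b g t W; case: W => mg gge0 eg cg [c c0 Hc] [C C0 HC].
split.
- rewrite (_ : (fun t => _) = fun t => g t `^ (-1)); last first.
    by apply/funext => t; rewrite powR_inv1.
  exact: (measurableT_comp (measurable_powR _)).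
- by move=> t; rewrite invr_ge0.
- by move=> t; rewrite eg.
- by move=> t Ut; apply: cvgV; [rewrite gt_eqF// g0|exact: cg].
- exists C^-1; rewrite ?invr_gt0// => t Ut.
  have tp : 0 < `|t| `^ (- a) by rewrite powR_gt0// Upi_neq0.
  rewrite -[leLHS]invrK lef_pV2 ?posrE ?invr_gt0 ?mulr_gt0 ?invr_gt0 ?powR_gt0 ?Upi_neq0 ?g0//.
  by rewrite invfM invrK -powRN HC.
- exists c^-1; rewrite ?invr_gt0// => t Ut.
  rewrite powRN -invfM lef_pV2 ?posrE ?g0 ?mulr_gt0 ?powR_gt0 ?Upi_neq0//.
  exact: Hc.
Qed.

Definition trunc_powR a d t : R := if `|t| < d then `|t| `^ (- a) else 0.

Lemma iJ_trunc_powR a d : a < 1 -> 0 < d -> iJ (trunc_powR a d).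
Proof. exact: integrable_trunc_powR. Qed.

Lemma J_trunc_powR a d : a < 1 -> 0 < d ->
  J (trunc_powR a d) <= d `^ (1 - a) / (1 - a) / pi.
Proof.
move=> a1 d0.
have p0 := pi_gt0 R.
have h := integral_trunc_powR a1 d0.
rewrite /J (_ : d `^ (1 - a) / (1 - a) / pi = (pi *+ 2)^-1 * (2 * (d `^ (1 - a) / (1 - a)))); last first.
  have a10 : 1 - a != 0 by rewrite gt_eqF// subr_gt0.
  by move: p0 {h}; move: (pi : R) => p p0; field; rewrite a10 gt_eqF.
rewrite ler_pM2l; last by rewrite invr_gt0 pmulrn_rgt0.
rewrite -lee_fin /Rintegral fineK//.
by apply: integrable_fin_num; [exact: measurable_Upi|exact: integrable_trunc_powR].
Qed.

Lemma natV_powR n a : (0 < n)%N -> n%:R * (n%:R^-1 `^ (1 - a)) = n%:R `^ a :> R.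
Proof.
move=> n0; have nr : 0 < n%:R :> R by rewrite ltr0n.
rewrite -powR_inv1 ?ltW// -powRrM mulN1r opprB.
rewrite -{1}(powRr1 (ltW nr)) -powRD; last by rewrite (gt_eqF nr) implybT.
by congr (_ `^ _); ring.
Qed.

(** Cut at |t| = 1/n. Outside, [f] is at most C n^a. Inside, the polynomial is at most n |x|^2 and
    the integral of |t|^-a has order n^(a - 1). *)
Lemma toeplitz_upper a b f : 0 <= a < 1 -> weight a b f ->
  exists2 K, 0 < K & forall n (x : 'cV[R]_n), (0 < n)%N ->
    bform (toeplitz n f) x x <= K * n%:R `^ a * dot x x.
Proof.
move=> /andP[a0 a1] W; have i_f := iJ_weight a1 W.
case: W => mf f0 _ _ _ [C C0 HC]; have C0' := ltW C0.
have p0 := pi_gt0 R; have p2 := pi_ge2 R.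
exists (C * (1 + (1 - a)^-1)).
  by rewrite mulr_gt0// ltr_pwDl// invr_ge0 subr_ge0 ltW.
move=> n x n0; rewrite bform_toeplitz//.
have nr : 0 < n%:R :> R by rewrite ltr0n.
have nV : 0 < n%:R^-1 :> R by rewrite invr_gt0.
have nr' := ltW nr; have nV' := ltW nV.
have it := iJ_trunc_powR a1 nV.
have ix : iJ (trig x x).
  have := iJ_trig x x (@measurable_cst _ _ _ _ setT (1 : R)) (iJ_cst 1).
  by rewrite (_ : (fun t => _) = trig x x)//; apply/funext => t; rewrite mul1r.
apply: (@le_trans _ _ (J (fun t => C * n%:R `^ a * trig x x t +
    C * (n%:R * dot x x) * trunc_powR a n%:R^-1 t))).
  apply: le_J; [exact: iJ_trig|by apply: iJD; exact: iJZ|] => t Ut.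
  have tx := trig_ge0 x t; have txl := trig_le x t.
  apply: (@le_trans _ _ (C * `|t| `^ (- a) * trig x x t)).
    by rewrite ler_wpM2r// HC.
  rewrite /trunc_powR; case: ifP => [tn|/negbT].
    rewrite -[leLHS]add0r lerD ?mulr_ge0 ?powR_ge0// mulrAC.
    by rewrite ler_wpM2r ?powR_ge0// ler_wpM2l.
  rewrite -leNgt mulr0 addr0 => tn; rewrite ler_wpM2r// ler_wpM2l//.
  rewrite (_ : n%:R `^ a = (n%:R^-1 `^ a)^-1); last first.
    by rewrite -powRN -[in RHS]powR_inv1// -powRrM mulN1r opprK.
  rewrite powRN lef_pV2 ?posrE ?powR_gt0 ?Upi_neq0//.
  by apply: ge0_ler_powR; rewrite ?nnegrE.
rewrite JD; [|exact: iJZ|exact: iJZ]; rewrite !JZ// J_trig.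
have := J_trunc_powR a1 nV => h.
apply: (@le_trans _ _ (C * n%:R `^ a * dot x x + C * (n%:R * dot x x) * (n%:R^-1 `^ (1 - a) / (1 - a)))).
  rewrite lerD2l ler_wpM2l ?mulr_ge0 ?dot_ge0//.
  apply: (le_trans h); rewrite ler_pdivrMr// ler_peMr//; last lra.
  by rewrite divr_ge0 ?powR_ge0// subr_ge0 ltW.
rewrite le_eqVlt; apply/orP; left; apply/eqP.
by rewrite -(natV_powR a n0); ring.
Qed.

(** For |t| >= 1/n the weight is at least c n^-b, and |t| < 1/n carries at most the share 1/pi <=
    1/2 of the mass |x|^2; hence c / 2. *)
Lemma toeplitz_lower a b g : a < 1 -> 0 <= b < 1 -> weight a b g ->
  exists2 k, 0 < k & forall n (x : 'cV[R]_n), (0 < n)%N ->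
    k * n%:R `^ (- b) * dot x x <= bform (toeplitz n g) x x.
Proof.
move=> a1 /andP[b0 b1] W; have ig := iJ_weight a1 W.
case: W => mg g0 _ _ [c c0 Hc] _; have c0' := ltW c0.
have p0 := pi_gt0 R; have p2 := pi_ge2 R.
exists (c / 2); first by rewrite divr_gt0.
move=> n x n0; rewrite bform_toeplitz//.
have nr : 0 < n%:R :> R by rewrite ltr0n.
have nV : 0 < n%:R^-1 :> R by rewrite invr_gt0.
have nr' := ltW nr; have nV' := ltW nV.
have it := iJ_trunc_powR (@ltr01 R) nV.
have ix : iJ (trig x x).
  have := iJ_trig x x (@measurable_cst _ _ _ _ setT (1 : R)) (iJ_cst 1).
  by rewrite (_ : (fun t => _) = trig x x)//; apply/funext => t; rewrite mul1r.
apply: (@le_trans _ _ (J (fun t => c * n%:R `^ (- b) * trig x x t -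
    c * n%:R `^ (- b) * (n%:R * dot x x) * trunc_powR 0 n%:R^-1 t))).
  rewrite JB; [|exact: iJZ|exact: iJZ]; rewrite !JZ// J_trig.
  have := J_trunc_powR (@ltr01 R) nV; rewrite subr0 divr1 powRr1// => h.
  apply: (@le_trans _ _ (c * n%:R `^ (- b) * dot x x - c * n%:R `^ (- b) * (n%:R * dot x x) * (n%:R^-1 / pi))); last first.
    by rewrite lerD2l lerN2 ler_wpM2l// !mulr_ge0 ?dot_ge0 ?powR_ge0.
  rewrite (_ : _ - _ = c * n%:R `^ (- b) * dot x x * (1 - pi^-1)); last first.
    by move: p0 {h p2}; move: (pi : R) => p p0; field; rewrite !gt_eqF.
  rewrite (_ : c / 2 * _ * _ = c * n%:R `^ (- b) * dot x x * 2^-1); last by field.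
  rewrite ler_wpM2l ?mulr_ge0 ?dot_ge0 ?powR_ge0//.
  by have : pi^-1 <= 2^-1 :> R by [rewrite lef_pV2 ?posrE]; lra.
apply: le_J; [by apply: iJB; exact: iJZ|exact: iJ_trig|] => t Ut.
have tx := trig_ge0 x t; have txl := trig_le x t.
rewrite /trunc_powR oppr0 powRr0; case: ifP => [tn|/negbT].
  rewrite mulr1 -mulrBr (@le_trans _ _ 0) ?mulr_ge0//.
  by rewrite mulr_ge0_le0 ?subr_le0// mulr_ge0 ?powR_ge0.
rewrite -leNgt mulr0 subr0 => tn; rewrite ler_wpM2r//.
apply: le_trans (Hc t Ut); rewrite ler_wpM2l//.
rewrite (_ : n%:R `^ (- b) = n%:R^-1 `^ b); last first.
  by rewrite -[in RHS]powR_inv1// -powRrM mulN1r.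
by apply: ge0_ler_powR; rewrite ?nnegrE.
Qed.

Lemma toeplitz_posdef a b g n : a < 1 -> 0 <= b < 1 -> weight a b g ->
  forall x : 'cV[R]_n, x != 0 -> 0 < bform (toeplitz n g) x x.
Proof.
move=> a1 b01 W x x0; have [k k0 H] := toeplitz_lower a1 b01 W.
have n0 : (0 < n)%N.
  by case: n x x0 => // x /eqP[]; apply/matrixP => -[].
apply: lt_le_trans (H n x n0); rewrite !mulr_gt0 ?dot_gt0//.
by rewrite powR_gt0// ltr0n.
Qed.

Lemma toeplitz_le c f g n : measurable_fun setT f -> measurable_fun setT g ->
  iJ f -> iJ g -> (forall t, Upi t -> f t <= c * g t) ->
  forall x : 'cV[R]_n, bform (toeplitz n f) x x <= c * bform (toeplitz n g) x x.
Proof.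
move=> mf mg i_f ig fg x; rewrite !bform_toeplitz// -JZ; last exact: iJ_trig.
apply: le_J; [exact: iJ_trig|by apply: iJZ; exact: iJ_trig|] => t Ut.
by rewrite mulrA ler_wpM2r ?trig_ge0// fg.
Qed.

End Weights.

(** * The limiting normalized trace *)

Section FejerLimit.
Variable R : realType.
Notation Upi := (@Upi R).
Implicit Types (f g h : R -> R) (a b d t l e : R).

Lemma cos_norm t : cos `|t| = cos t.
Proof. by case: (ger0P t) => // _; rewrite cosN. Qed.

Lemma cos_sep l d : Upi l -> 0 < d -> exists2 m, 0 < m &
  forall t, Upi t -> d <= `| `|t| - `|l| | -> m <= (cos t - cos l) ^+ 2.
Proof.
move=> Ul d0; have l0 := Upi_neq0 Ul; have lp := Upi_norm Ul.
(* A smaller [d] puts |l| - d and |l| + d inside (0, pi), where the cosine is strictly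
   decreasing. *)
wlog [dl dp] : d d0 / d < `|l| /\ d < pi - `|l|.
  move=> H; pose d' := Num.min d (Num.min (`|l| / 2) ((pi - `|l|) / 2)).
  have d'0 : 0 < d' by rewrite !lt_min d0 !divr_gt0// subr_gt0.
  have [|m m0 Hm] := H d' d'0.
    split; rewrite !gt_min; apply/orP; right; apply/orP; [left|right]; lra.
  by exists m => // t Ut dt; apply: Hm => //; apply: le_trans dt; rewrite ge_min lexx.
have m1 : 0 < cos (`|l| - d) - cos `|l|.
  by rewrite subr_gt0 ltr_cos ?in_itv/=; lra.
have m2 : 0 < cos `|l| - cos (`|l| + d).
  by rewrite subr_gt0 ltr_cos ?in_itv/=; lra.
have lec x y : 0 <= x -> x <= y -> y <= pi -> cos y <= cos x :> R.
  move=> x0; rewrite le_eqVlt => /predU1P[->//|xy] yp.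
  by apply/ltW; rewrite ltr_cos// in_itv/=; lra.
exists (Num.min (cos (`|l| - d) - cos `|l|) (cos `|l| - cos (`|l| + d)) ^+ 2).
  by rewrite exprn_gt0// lt_min m1 m2.
move=> t Ut; rewrite -(cos_norm t) -(cos_norm l).
have t0 := Upi_neq0 Ut; have tp := Upi_norm Ut.
have mm : 0 <= Num.min (cos (`|l| - d) - cos `|l|) (cos `|l| - cos (`|l| + d)).
  by rewrite le_min !ltW.
rewrite ler_normr => /orP[dt|dt].
  rewrite -(sqrrN (cos `|t| - _)) opprB lerXn2r ?nnegrE//.
    by rewrite subr_ge0 lec; lra.
  rewrite ge_min; apply/orP; right; rewrite lerD2l lerN2; apply: lec; lra.
rewrite lerXn2r ?nnegrE//; first by rewrite subr_ge0 lec; lra.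
rewrite ge_min; apply/orP; left; rewrite lerD2r; apply: lec; lra.
Qed.

(** Evenness carries continuity at [l] over to the second peak [- l] of [fejer2]. *)
Lemma even_near h l e : (forall t, h (- t) = h t) -> {for l, continuous h} -> 0 < e ->
  exists2 d, 0 < d & forall t, `| `|t| - `|l| | < d -> `|h t - h l| <= e.
Proof.
move=> eh ch e0; have /cvgrPdist_le/(_ e e0)/nbhs_ballP[d /= d0 H] := ch.
exists d => // t td.
have hn x : h `|x| = h x by case: (ger0P x) => // _; rewrite eh.
have key : exists2 t', `|t' - l| = `| `|t| - `|l| | & h t' = h t.
  case: (ger0P l) => l0; first by exists `|t|; rewrite ?hn.
  exists (- `|t|); rewrite ?eh ?hn//.
  by rewrite opprK -opprB opprK normrN addrC.
have [t' t'd <-] := key.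
by rewrite distrC; apply: H; rewrite /ball/= distrC t'd.
Qed.

(** Near the peaks the error is at most e / 2 times the kernel, of total mass n. Elsewhere the
    kernel is at most 8 / m uniformly in n, and the factor 1 / n removes that contribution. *)
Lemma fejer_cvg h l : measurable_fun setT h -> iJ h -> (forall t, h (- t) = h t) ->
  Upi l -> {for l, continuous h} ->
  n%:R^-1 * J (fun t => h t * fejer2 n l t) @[n --> \oo] --> h l.
Proof.
move=> mh ih eh Ul ch; apply/cvgrPdist_le => e e0.
have e2 : 0 < e / 2 by rewrite divr_gt0.
have [d d0 Hd] := even_near eh ch e2.
have [m m0 Hm] := cos_sep Ul d0.
pose M := 8 / m * (J (fun t => `|h t|) + `|h l|).
have M0 : 0 <= M.
  apply: mulr_ge0; first by rewrite divr_ge0// ltW.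
  by rewrite addr_ge0// J_ge0.
near=> n.
have n0 : (0 < n)%N by near: n; exact: nbhs_infty_gt.
have nr : 0 < n%:R :> R by rewrite ltr0n.
have Mn : M / (e / 2) <= n%:R by near: n; exact: nbhs_infty_ger.
have iF c : iJ (fun t => c * fejer2 n l t).
  by apply: (@iJ_fejer2 _ n l (fun=> c)) => //; exact: iJ_cst.
have ihF := iJ_fejer2 n l mh ih.
have mF := @measurable_fejer2 R n l.
have -> : h l - n%:R^-1 * J (fun t => h t * fejer2 n l t) =
    - (n%:R^-1 * J (fun t => (h t - h l) * fejer2 n l t)).
  rewrite (@eq_J _ (fun t => (h t - h l) * fejer2 n l t) (fun t => h t * fejer2 n l t - h l * fejer2 n l t)); last first.
    by move=> t _; rewrite mulrBl.
  have iF1 : iJ (fejer2 n l).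
    by have := iF 1; rewrite (_ : (fun t => _) = fejer2 n l)//; apply/funext => t; rewrite mul1r.
  by rewrite JB// JZ// J_fejer2; field; rewrite gt_eqF.
rewrite normrN normrM gtr0_norm ?invr_gt0// mulrC ler_pdivrMr//.
have ihl : iJ (fun t => (h t - h l) * fejer2 n l t).
  apply: iJ_fejer2; first exact: measurable_funB.
  by apply: iJB => //; exact: iJ_cst.
apply: (le_trans (ler_norm_J ihl)).
have ihn := iJ_norm ih.
have mn : measurable_fun setT (fun t => `|h t|) by apply: measurableT_comp.
apply: (@le_trans _ _ (J (fun t => e / 2 * fejer2 n l t + 8 / m * (`|h t| + `|h l|)))).
  apply: le_J.
  - exact: iJ_norm.
  - by apply: iJD => //; apply: iJZ; apply: iJD => //; exact: iJ_cst.
  - move=> t Ut; have F0 := fejer2_ge0 n l t.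
    rewrite normrM (ger0_norm F0).
    have [td|td] := ltP `| `|t| - `|l| | d.
      rewrite -[leLHS]addr0 lerD//; first by rewrite ler_wpM2r// Hd.
      by rewrite mulr_ge0 ?divr_ge0 ?addr_ge0// ltW.
    rewrite -[leLHS]add0r lerD//; first by rewrite mulr_ge0// ltW.
    rewrite mulrC ler_pM//; last exact: ler_normB.
    rewrite ler_pdivlMr// mulrC; apply: le_trans (fejer2_cos n l t).
    by rewrite ler_wpM2r// Hm.
have iF1 : iJ (fejer2 n l).
  by have := iF 1; rewrite (_ : (fun t => _) = fejer2 n l)//; apply/funext => t; rewrite mul1r.
rewrite JD//; last by apply: iJZ; apply: iJD => //; exact: iJ_cst.
rewrite JZ// J_fejer2 JZ; last by apply: iJD => //; exact: iJ_cst.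
rewrite JD//; last exact: iJ_cst.
rewrite J_cst -/M.
by move: Mn; rewrite ler_pdivrMr//; lra.
Unshelve. all: by end_near. Qed.

End FejerLimit.

(** * The diagonal Christoffel-Darboux kernel *)

Section Christoffel.
Variable R : realType.
Notation Upi := (@Upi R).
Implicit Types (f g h : R -> R) (a b d t l e : R).

(** Positivity of the inverse form at x - k M x, with [k] free to be optimized. *)
Lemma bform_invmx_ge n (M : 'M[R]_n) (x : 'cV[R]_n) (k : R) : M^T = M ->
  (forall x, x != 0 -> 0 < bform M x x) ->
  2 * k * dot x x - k ^+ 2 * bform M x x <= bform (invmx M) x x.
Proof.
move=> sM pM; have uM := bform_posdef_unit pM.
have := bform_posdef_ge0 (bform_invmx_posdef sM pM) (x + (- k) *: (M *m x)).
rewrite !bformDl !bformDr !bformZl !bformZr.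
rewrite [bform _ (M *m x) x]bformC ?trmx_invmx//.
have -> : bform (invmx M) x (M *m x) = dot x x by rewrite dot_bform mulKmx.
have -> : bform (invmx M) (M *m x) (M *m x) = bform M x x.
  by rewrite dot_bform mulKmx// dotC dot_bform.
lra.
Qed.

Variables (a b : R) (g : R -> R).
Hypotheses (a01 : 0 <= a < 1) (b01 : 0 <= b < 1) (W : weight a b g).

Let a1 : a < 1. Proof. by case/andP: a01. Qed.
Let b1 : b < 1. Proof. by case/andP: b01. Qed.
Let ig : iJ g. Proof. exact: iJ_weight W. Qed.
Let mg := weight_meas W.
Let W' := weight_inv W.
Let igV : iJ (fun t => (g t)^-1). Proof. exact: iJ_weight W'. Qed.
Let mgV := weight_meas W'.

(** The k_n of the overview. Since T_n(g) is real symmetric, the form at e_l is the sum of the forms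
    at its cosine and sine parts. *)
Definition christoffel n l : R := n%:R^-1 *
  (bform (invmx (toeplitz n g)) (cvec n l) (cvec n l) +
   bform (invmx (toeplitz n g)) (svec n l) (svec n l)).

Let pT n := toeplitz_posdef a1 b01 W (n := n).
Let sT n := toeplitz_sym n g.

(* T_n(g)^-1 <= T_n(1/g), from x.T_n(g)^-1 x = J(p_x conj p_y) with y = T_n(g)^-1 x
   and the arithmetic-geometric inequality. *)
Lemma bform_invmx_toeplitz_le n (x : 'cV[R]_n) :
  bform (invmx (toeplitz n g)) x x <= J (fun t => (g t)^-1 * trig x x t).
Proof.
have uT := bform_posdef_unit (@pT n).
set y := invmx (toeplitz n g) *m x.
have Pxy : bform (invmx (toeplitz n g)) x x = J (trig x y).
  by rewrite J_trig dot_bform.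
have Pyy : bform (invmx (toeplitz n g)) x x = J (fun t => g t * trig y y t).
  by rewrite -bform_toeplitz// bform_invmx.
have itxy : iJ (trig x y).
  have := iJ_trig x y (@measurable_cst _ _ _ _ setT (1 : R)) (iJ_cst 1).
  by rewrite (_ : (fun t => _) = trig x y)//; apply/funext => t; rewrite mul1r.
have : J (trig x y) <= J (fun t => 2^-1 * ((g t)^-1 * trig x x t) + 2^-1 * (g t * trig y y t)).
  apply: le_J => //.
    by apply: iJD; apply: iJZ; exact: iJ_trig.
  move=> t Ut; have gt0 := weight_gt0 W Ut.
  have amgm u v : u * v <= 2^-1 * ((g t)^-1 * (u * u)) + 2^-1 * (g t * (v * v)).
    have := sqr_ge0 (u - g t * v); rewrite -subr_ge0 => h.
    rewrite (_ : _ - _ = (u - g t * v) ^+ 2 / (2 * g t)); last by field; rewrite gt_eqF.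
    by rewrite divr_ge0 ?sqr_ge0// mulr_ge0// ltW.
  rewrite /trig.
  have := amgm (dot x (cvec n t)) (dot y (cvec n t)).
  have := amgm (dot x (svec n t)) (dot y (svec n t)); lra.
have -> : J (fun t => 2^-1 * ((g t)^-1 * trig x x t) + 2^-1 * (g t * trig y y t)) =
    2^-1 * J (fun t => (g t)^-1 * trig x x t) + 2^-1 * J (fun t => g t * trig y y t).
  by rewrite JD ?JZ//; try apply: iJZ; exact: iJ_trig.
by rewrite -Pyy -Pxy; lra.
Qed.

Lemma christoffel_ge0 n l : 0 <= christoffel n l.
Proof.
have p := bform_posdef_ge0 (bform_invmx_posdef (@sT n) (@pT n)).
by rewrite mulr_ge0 ?invr_ge0// addr_ge0.
Qed.

Lemma christoffel_le n l : christoffel n l <= n%:R^-1 * J (fun t => (g t)^-1 * fejer2 n l t).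
Proof.
rewrite ler_wpM2l ?invr_ge0//.
rewrite (@eq_J _ _ (fun t => (g t)^-1 * trig (cvec n l) (cvec n l) t + (g t)^-1 * trig (svec n l) (svec n l) t)).
  by rewrite JD; [|exact: iJ_trig|exact: iJ_trig]; rewrite lerD ?bform_invmx_toeplitz_le.
by move=> t _; rewrite mulrDr.
Qed.

(** The two vectors together have squared norm n, so the lower bound of [bform_invmx_ge] is 2 k n -
    k^2 S; its maximum is at k = n / S. *)
Lemma christoffel_ge n l : (0 < n)%N ->
  (n%:R^-1 * J (fun t => g t * fejer2 n l t))^-1 <= christoffel n l.
Proof.
move=> n0; have nr : 0 < n%:R :> R by rewrite ltr0n.
set S := J _.
have SE : S = bform (toeplitz n g) (cvec n l) (cvec n l) + bform (toeplitz n g) (svec n l) (svec n l).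
  rewrite !bform_toeplitz// -JD; [|exact: iJ_trig|exact: iJ_trig].
  by apply: eq_J => t _; rewrite mulrDr.
have [k k0 Hk] := toeplitz_lower a1 b01 W.
have S0 : 0 < S.
  apply: (@lt_le_trans _ _ (k * n%:R `^ (- b) * n%:R)).
    by rewrite !mulr_gt0// powR_gt0.
  by rewrite -[X in _ * X](dot_cs n l) mulrDr SE lerD ?Hk.
have := @bform_invmx_ge _ _ (cvec n l) (n%:R / S) (@sT n) (@pT n).
have := @bform_invmx_ge _ _ (svec n l) (n%:R / S) (@sT n) (@pT n).
move=> h1 h2; have := lerD h2 h1.
rewrite (_ : _ + _ = 2 * (n%:R / S) * (dot (cvec n l) (cvec n l) + dot (svec n l) (svec n l)) - (n%:R / S) ^+ 2 * S); last by rewrite SE; ring.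
rewrite dot_cs (_ : 2 * _ * _ - _ = n%:R ^+ 2 / S); last by field; rewrite gt_eqF.
move=> h3; rewrite /christoffel invfM invrK.
have -> : n%:R * S^-1 = n%:R^-1 * (n%:R ^+ 2 / S) by field; rewrite !gt_eqF.
by rewrite ler_wpM2l// invr_ge0.
Qed.

Lemma christoffel_cvg l : Upi l -> christoffel n l @[n --> \oo] --> (g l)^-1.
Proof.
move=> Ul; have g0 := weight_gt0 W Ul.
have h1 := fejer_cvg mg ig (weight_even W) Ul (weight_cont W Ul).
have h2 := fejer_cvg mgV igV (weight_even W') Ul (weight_cont W' Ul).
apply: squeeze_cvgr (cvgV _ h1) h2; last by rewrite gt_eqF.
near=> n; rewrite christoffel_le andbT; apply: christoffel_ge.
by near: n; exact: nbhs_infty_gt.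
Unshelve. all: by end_near. Qed.

(** For |l| <= 1/n the eigenvalue bound gives order n^b <= |l|^-b. For |l| > 1/n the integral in
    [christoffel_le] is cut at |t| = |l| / 2. Outside, 1 / g has order at most |l|^-b and the kernel
    has mass n. Inside, the kernel has order at most l^-2 and 1 / g integrates to order |l|^(1 - b);
    the surplus |l|^-1 is at most n. *)
Lemma christoffel_bound : exists2 K, 0 < K &
  forall n l, (0 < n)%N -> Upi l -> christoffel n l <= K * `|l| `^ (- b).
Proof.
have [k k0 Hk] := toeplitz_lower a1 b01 W.
have [C C0 HC] := weight_ub W'.
have s0 := sinc0_gt0 R; have pi0 := pi_gt0 R.
have b10 : 0 < 1 - b by rewrite subr_gt0.
have b0 : 0 <= b by case/andP: b01.
(* In [K2], the 2 comes from d^-b <= 2 |l|^-b with d = |l| / 2, and the 16 from the product (2 / m)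
   d. *)
pose K1 := k^-1; pose K2 := 2 * C * (1 + 16 / (sinc0 R ^+ 2 * (1 - b))).
have K10 : 0 < K1 by rewrite invr_gt0.
have K20 : 0 < K2.
  by rewrite /K2 !mulr_gt0// addr_gt0// divr_gt0// mulr_gt0// exprn_gt0.
exists (K1 + K2); first by rewrite addr_gt0.
move=> n l n0 Ul; have l0 := Upi_neq0 Ul; have lp := Upi_norm Ul.
have nr : 0 < n%:R :> R by rewrite ltr0n.
have nr' := ltW nr; have l0' := ltW l0.
have pl0 : 0 <= `|l| `^ (- b) by exact: powR_ge0.
have [ln|ln] := leP `|l| n%:R^-1.
  apply: (@le_trans _ _ (K1 * `|l| `^ (- b))); last by rewrite ler_wpM2r// lerDl ltW.
  apply: (@le_trans _ _ (K1 * n%:R `^ b)); last first.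
    rewrite ler_pM2l// (_ : n%:R `^ b = (n%:R^-1 `^ b)^-1); last first.
      by rewrite -powRN -[in RHS]powR_inv1// -powRrM mulN1r opprK.
    rewrite powRN lef_pV2 ?posrE ?powR_gt0 ?invr_gt0//.
    by apply: ge0_ler_powR; rewrite ?nnegrE ?invr_ge0.
  have p1 (x : 'cV[R]_n) : x != 0 -> 0 < bform (1%:M : 'M[R]_n) x x.
    by move=> x0; rewrite /bform mulmx1 dot_gt0.
  have H (x : 'cV[R]_n) : bform (invmx (toeplitz n g)) x x <= K1 * n%:R `^ b * dot x x.
    have d1 (y : 'cV[R]_n) : bform 1%:M y y = dot y y by rewrite /bform mulmx1.
    have := @bform_invmx_le _ _ 1%:M (toeplitz n g) (K1 * n%:R `^ b) (trmx1 _ _) p1 (@sT n) (@pT n).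
    rewrite invmx1 => H; rewrite -(d1 x); apply: H => y; rewrite d1.
    apply: le_trans (ler_wpM2l _ (Hk n y n0)); last by rewrite mulr_ge0 ?powR_ge0 ?ltW.
    rewrite powRN le_eqVlt; apply/orP; left; apply/eqP.
    have nb : 0 < n%:R `^ b :> R by rewrite powR_gt0.
    by rewrite /K1; field; rewrite !gt_eqF.
  rewrite /christoffel ler_pdivrMl// mulrC -[X in _ <= _ * X](dot_cs n l) mulrDr.
  by rewrite lerD.
apply: (@le_trans _ _ (K2 * `|l| `^ (- b))); last by rewrite ler_wpM2r// lerDr ltW.
apply: (le_trans (christoffel_le n l)).
pose d := `|l| / 2; have d0 : 0 < d by rewrite divr_gt0.
pose m := (sinc0 R * (`|l| / 4)) ^+ 2.
have m0 : 0 < m by rewrite exprn_gt0// mulr_gt0// divr_gt0.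
have hF t : `|t| < d -> fejer2 n l t <= 2 / m.
  move=> td; rewrite ler_pdivlMr// mulrC.
  have key u : `|l| / 4 <= `|u| -> `|u| <= 3 * pi / 4 -> m <= sin u ^+ 2.
    move=> u1 u2; apply: le_trans (sqr_sin_ge u2).
    rewrite /m -[leRHS]real_normK ?num_real// normrM (gtr0_norm s0).
    have s0' := ltW s0.
    have l4 : 0 <= `|l| / 4 by rewrite divr_ge0.
    have sl : 0 <= sinc0 R * (`|l| / 4) by exact: mulr_ge0 s0' l4.
    have su : 0 <= sinc0 R * `|u| by apply: mulr_ge0 s0' _.
    by apply: lerXn2r; rewrite ?nnegrE ?sl ?su// ler_pM2l.
  have hn (v : R) : `|v| = `|t| -> `|l| / 4 <= `|(l + v) / 2| /\ `|(l + v) / 2| <= 3 * pi / 4.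
    move=> vt; rewrite normrM (ger0_norm (_ : 0 <= 2^-1))//.
    have h1 := ler_normD l v; have h2 := lerB_normD l v.
    by move: td; rewrite -vt /d; split; lra.
  have [p1 p2] := hn t erefl; have [q1 q2] := hn (- t) (normrN t).
  by apply: fejer2_sin; apply: key.
have iF : iJ (fejer2 n l).
  have := @iJ_fejer2 _ n l (fun=> 1) (measurable_cst _) (iJ_cst 1).
  by rewrite (_ : (fun t => _) = fejer2 n l)//; apply/funext => t; rewrite mul1r.
have it := iJ_trunc_powR b1 d0.
rewrite ler_pdivrMl//.
apply: (@le_trans _ _ (J (fun t => C * d `^ (- b) * fejer2 n l t + C * (2 / m) * trunc_powR b d t))).
  apply: le_J; [exact: iJ_fejer2|by apply: iJD; exact: iJZ|] => t Ut.
  have F0 := fejer2_ge0 n l t.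
  apply: (@le_trans _ _ (C * `|t| `^ (- b) * fejer2 n l t)).
    by rewrite ler_wpM2r// HC.
  rewrite /trunc_powR; case: ifP => [td|/negbT].
    rewrite -[leLHS]add0r lerD//; first by rewrite !mulr_ge0 ?powR_ge0// ltW.
    by rewrite mulrAC ler_wpM2r ?powR_ge0// ler_wpM2l ?hF// ltW.
  rewrite -leNgt mulr0 addr0 => td; rewrite ler_wpM2r// ler_wpM2l//; first exact: ltW.
  rewrite !powRN lef_pV2 ?posrE ?powR_gt0 ?Upi_neq0//.
  by apply: ge0_ler_powR; rewrite ?nnegrE// ltW.
rewrite JD; [|exact: iJZ|exact: iJZ]; rewrite !JZ// J_fejer2.
have db : d `^ (1 - b) = d * d `^ (- b).
  by rewrite powRD ?powRr1 ?ltW// (gt_eqF d0) implybT.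
have hJ : J (trunc_powR b d) <= d * d `^ (- b) / (1 - b).
  have := J_trunc_powR b1 d0; rewrite db => /le_trans; apply.
  rewrite ler_pdivrMr// ler_peMr//; last by have := pi_ge2 R; lra.
  by rewrite !mulr_ge0 ?powR_ge0 ?invr_ge0// ltW.
have dl : d `^ (- b) <= 2 * `|l| `^ (- b).
  rewrite /d powRM// ?invr_ge0// mulrC ler_wpM2r//.
  rewrite -powR_inv1// -powRrM mulN1r opprK -[leRHS]powRr1//.
  by apply: ler_powR; [rewrite ler1n|exact: ltW].
set D := d `^ (- b) in dl hJ *.
have D0 : 0 <= D by exact: powR_ge0.
apply: (@le_trans _ _ (C * D * n%:R + C * (2 / m) * (d * D / (1 - b)))).
  by rewrite lerD2l ler_wpM2l// mulr_ge0 ?divr_ge0 ?ltW.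
have nl : `|l|^-1 <= n%:R by rewrite -[leRHS]invrK lef_pV2 ?posrE ?invr_gt0// ltW.
have -> : C * (2 / m) * (d * D / (1 - b)) = C * D * (16 / (sinc0 R ^+ 2 * (1 - b))) * `|l|^-1.
  by rewrite /m /d; field; rewrite !gt_eqF.
have q0 : 0 <= 16 / (sinc0 R ^+ 2 * (1 - b)).
  by apply: ltW; rewrite divr_gt0// mulr_gt0// exprn_gt0.
have CD0 : 0 <= C * D by rewrite mulr_ge0// ltW.
apply: (@le_trans _ _ (C * D * (1 + 16 / (sinc0 R ^+ 2 * (1 - b))) * n%:R)).
  rewrite [leRHS](_ : _ = C * D * n%:R + C * D * (16 / (sinc0 R ^+ 2 * (1 - b))) * n%:R); last by ring.
  by rewrite lerD2l; apply: ler_wpM2l => //; exact: mulr_ge0.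
rewrite [leRHS]mulrC ler_wpM2r//.
rewrite (_ : K2 * _ = C * (2 * `|l| `^ (- b)) * (1 + 16 / (sinc0 R ^+ 2 * (1 - b)))); last by rewrite /K2; ring.
rewrite ler_wpM2r//; last by rewrite ler_wpM2l// ltW.
by rewrite addr_ge0.
Qed.

Lemma measurable_christoffel n : measurable_fun setT (christoffel n).
Proof.
apply: measurable_funM => //.
have H (M : 'M[R]_n) : measurable_fun setT (fun l => bform M (cvec n l) (cvec n l)) /\
    measurable_fun setT (fun l => bform M (svec n l) (svec n l)).
  split; under eq_fun do rewrite bformE; apply: measurable_sum => i;
    apply: measurable_sum => j; apply: measurable_funM => //; apply: measurable_funM => //;
    under eq_fun do rewrite mxE; (exact: measurable_cosM || exact: measurable_sinM).
by have [h1 h2] := H (invmx (toeplitz n g)); exact: measurable_funD.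
Qed.

Lemma trace_limit f a' b' : 0 <= a' < 1 -> a' + b < 1 -> weight a' b' f ->
  n%:R^-1 * \tr (invmx (toeplitz n g) *m toeplitz n f) @[n --> \oo] -->
    J (fun t => f t / g t).
Proof.
move=> /andP[a'0 a'1] ab Wf.
have mf := weight_meas Wf; have i_f := iJ_weight a'1 Wf.
have [C C0 HC] := weight_ub Wf.
have [K K0 HK] := christoffel_bound.
have dom n t : Upi t -> (0 < n)%N -> `|f t * christoffel n t| <= C * K * `|t| `^ (- (a' + b)).
  move=> Ut n0; have t0 := Upi_neq0 Ut.
  have c0 := christoffel_ge0 n t; have f0 := weight_ge0 Wf t.
  rewrite ger0_norm; last exact: mulr_ge0.
  rewrite opprD powRD; last by rewrite (gt_eqF t0) implybT.
  by rewrite mulrACA; apply: ler_pM => //; [exact: HC|exact: HK].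
have idom : iJ (fun t => C * K * `|t| `^ (- (a' + b))) by apply: iJZ; exact: iJ_powR.
have mfk n : measurable_fun setT (fun t => f t * christoffel n t).
  by apply: measurable_funM => //; exact: measurable_christoffel.
have ifk n : (0 < n)%N -> iJ (fun t => f t * christoffel n t).
  move=> n0; apply: (iJ_dom (mfk n) idom) => t Ut.
  by apply: le_trans (dom n t Ut n0) _; rewrite ler_norm.
have trE n : (0 < n)%N -> n%:R^-1 * \tr (invmx (toeplitz n g) *m toeplitz n f) =
    J (fun t => f t * christoffel n t).
  move=> n0; have nr : (n%:R : R) != 0 by rewrite pnatr_eq0 -lt0n.
  rewrite mxtrace_toeplitz//.
  have -> : J (fun t => f t * (bform (invmx (toeplitz n g)) (cvec n t) (cvec n t) +
      bform (invmx (toeplitz n g)) (svec n t) (svec n t))) = n%:R * J (fun t => f t * christoffel n t).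
    by rewrite -JZ ?ifk//; apply: eq_J => t _; rewrite /christoffel mulrCA mulVKf.
  by rewrite mulKf.
rewrite -(cvg_shiftS _) (_ : [sequence _]_n = (fun n => J (fun t => f t * christoffel n.+1 t))); last first.
  by apply/funext => n; rewrite /= trE.
rewrite /J; apply: cvgM; first exact: cvg_cst.
have mU : measurable (Upi : set (measurableTypeR R)) := @measurable_Upi R.
have mfg : measurable_fun setT (fun t => f t / g t) by apply: measurable_funM.
have cv (t : measurableTypeR R) : Upi t ->
    (f t * christoffel n.+1 t)%:E @[n --> \oo] --> (f t / g t)%:E.
  move=> Ut; apply: cvg_EFin; first exact: nearW.
  apply: cvgM; first exact: cvg_cst.
  by have := christoffel_cvg Ut; rewrite -cvg_shiftS.
have dom' (t : measurableTypeR R) (n : nat) : Upi t ->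
    (`|(f t * christoffel n.+1 t)%:E| <= (C * K * `|t| `^ (- (a' + b)))%:E)%E.
  by move=> Ut; rewrite abse_EFin lee_fin; exact: dom.
have := @dominated_convergence _ _ _ lebesgue_measure Upi mU
  (fun n t => (f t * christoffel n.+1 t)%:E) (fun t => (f t / g t)%:E)
  (fun t => (C * K * `|t| `^ (- (a' + b)))%:E)
  (fun n => (measurable_EFinP _ _).2 (measurable_funTS (mfk n.+1)))
  ((measurable_EFinP _ _).2 (measurable_funTS mfg)) (aeW _ cv)
  idom (aeW _ dom').
move=> [ifg _ H].
by apply: fine_cvg; rewrite fineK//; apply: integrable_fin_num.
Qed.

End Christoffel.

(** * Almost sure convergence of the quadratic forms *)

Section PSeries.
Variable R : realType.
Implicit Types (p x y c : R).

Lemma powRN_ge_linear p x : 0 <= p -> 0 < x -> 1 + p * (1 - x) <= x `^ (- p).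
Proof.
move=> p0 x0; rewrite /powR (gt_eqF x0).
apply: le_trans (expR_ge1Dx _); rewrite lerD2l mulNr -mulrN ler_wpM2l//.
have : ln (1 + (x - 1)) <= x - 1 by apply: le_ln1Dx; lra.
by rewrite addrCA subrr addr0; lra.
Qed.

Lemma sum_powRN_le p N : 0 < p ->
  \sum_(0 <= n < N) n.+1%:R `^ (- (1 + p)) <= 1 + p^-1.
Proof.
move=> p0; case: N => [|N].
  by rewrite big_geq// addr_ge0// invr_ge0 ltW.
apply: (@le_trans _ _ (1 + p^-1 * (1 - N.+1%:R `^ (- p)))); last first.
  by rewrite lerD2l ler_piMr ?invr_ge0 ?ltW// gerBl powR_ge0.
elim: N => [|N IH].
  by rewrite big_nat1 (_ : 1%:R = 1 :> R)// powR1 subrr mulr0 addr0.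
rewrite big_nat_recr//=.
apply: (le_trans (lerD IH (lexx _))).
(* The comparison with the integral of x^-(1 + p), obtained from the tangent inequality for powers
   at the ratio (m - 1) / m. *)
suff : N.+2%:R `^ (- (1 + p)) <= p^-1 * (N.+1%:R `^ (- p) - N.+2%:R `^ (- p)) by rewrite !mulrBr; lra.
set m : R := N.+2%:R; have m0 : 0 < m by rewrite ltr0n.
have mE : N.+1%:R = m * ((m - 1) / m) by rewrite mulrC divfK ?gt_eqF// /m [N.+2%:R]mulrS addrAC subrr add0r.
have n0 : 0 < (m - 1) / m by rewrite divr_gt0// subr_gt0 ltr1n.
rewrite ler_pdivlMl// mE powRM ?(ltW m0) ?(ltW n0)//.
have h := powRN_ge_linear (ltW p0) n0.
have mp : 0 < m `^ (- p) by rewrite powR_gt0.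
rewrite opprD powRD; last by rewrite (gt_eqF m0) implybT.
rewrite powR_inv1 ?(ltW m0)//.
have -> : p * (m^-1 * m `^ (- p)) = m `^ (- p) * (1 + p * (1 - (m - 1) / m)) - m `^ (- p).
  by field; rewrite gt_eqF.
by rewrite lerD2r ler_pM2l.
Qed.

Lemma nneseries_powRN_lty p : 0 < p ->
  (\sum_(0 <= n <oo) (n.+1%:R `^ (- (1 + p)))%:E < +oo)%E.
Proof.
move=> p0; apply: (@le_lt_trans _ _ (1 + p^-1)%:E); last exact: ltry.
apply: lime_le; first by apply: is_cvg_nneseries => n _ _; rewrite lee_fin powR_ge0.
by apply: nearW => N; rewrite sumEFin lee_fin sum_powRN_le.
Qed.

Lemma expRN_le_powR q y : 0 < q -> 0 < y -> expR (- y) <= q `^ q * y `^ (- q).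
Proof.
move=> q0 y0.
have yq : y = q * (y / q) by rewrite mulrC divfK ?gt_eqF.
have h : y `^ q <= q `^ q * expR y.
  have q0' := ltW q0; have yq0 : 0 <= y / q by rewrite divr_ge0// ltW.
  have eE : expR y = expR (y / q) `^ q by rewrite -expRM divfK ?gt_eqF.
  rewrite {1}yq powRM// eE ler_pM2l ?powR_gt0//.
  apply: ge0_ler_powR; rewrite ?nnegrE ?expR_ge0//.
  by apply: le_trans (expR_ge1Dx _); lra.
have yp : 0 < y `^ q by rewrite powR_gt0.
by rewrite powRN expRN ler_pdivlMr// mulrC ler_pdivrMr ?expR_gt0.
Qed.

Lemma nneseries_expRN_lty c e : 0 < c -> 0 < e ->
  (\sum_(0 <= n <oo) (expR (- (c * n.+1%:R `^ e)))%:E < +oo)%E.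
Proof.
(* This exponent turns the exponential into a multiple of n^-2. *)
move=> c0 e0; pose q := 2 / e; have q0 : 0 < q by rewrite divr_gt0.
pose K := q `^ q * c `^ (- q).
have K0 : 0 <= K by rewrite mulr_ge0 ?powR_ge0.
apply: (@le_lt_trans _ _ (\sum_(0 <= n <oo) (K%:E * (n.+1%:R `^ (- (1 + 1)))%:E))%E).
  apply: lee_nneseries => [n _ _|n _]; first by rewrite lee_fin expR_ge0.
  have n0 : 0 < n.+1%:R :> R by rewrite ltr0n.
  rewrite -EFinM lee_fin; apply: (le_trans (expRN_le_powR q0 _)); first by rewrite mulr_gt0 ?powR_gt0.
  rewrite powRM ?powR_ge0 ?(ltW c0)// -powRrM mulrA -/K; apply: ler_wpM2l => //.
  rewrite (_ : e * - q = - (1 + 1))//; rewrite /q mulrN mulrCA divff ?gt_eqF// mulr1; congr (- _); ring.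
rewrite nneseriesZl; last by move=> n _; rewrite lee_fin powR_ge0.
by rewrite lte_mul_pinfty ?lee_fin// nneseries_powRN_lty.
Qed.

End PSeries.

(** * Borel-Cantelli argument *)

Section StrongConvergence.
Context d (Omega : measurableType d) (R : realType) (P : probability Omega R).

Lemma measurable_bform n (M : 'M[R]_n) (X : Omega -> 'cV[R]_n) :
  (forall i, measurable_fun setT (fun w => X w i ord0)) ->
  measurable_fun setT (fun w => bform M (X w) (X w)).
Proof.
move=> mX; under eq_fun do rewrite bformE.
apply: measurable_sum => i; apply: measurable_sum => j.
by apply: measurable_funM => //; apply: measurable_funM.
Qed.

Lemma borel_cantelli_ae (F : nat -> set Omega) : (forall k, measurable (F k)) ->
  (\sum_(0 <= n <oo) P (F n) < +oo)%E ->
  {ae P, forall w, exists N, forall n, (N <= n)%N -> ~ F n w}.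
Proof.
move=> mF sF; have h := lim_sup_set_cvg0 mF sF.
apply: (@negligibleS _ _ _ _ (lim_sup_set F)); last first.
  exists (lim_sup_set F); split => //.
  by apply: bigcap_measurable => // k _; exact: bigcup_measurable.
move=> w /= nH k _; apply: contrapT => nB; apply: nH; exists k => n kn Fn.
by apply: nB; exists n.
Qed.

Variables (f g : R -> R) (a b a' b' : R).
Hypotheses (a01 : 0 <= a < 1) (b01 : 0 <= b < 1) (W : weight a b g).
Hypotheses (a'01 : 0 <= a' < 1) (b'01 : 0 <= b' < 1) (W' : weight a' b' f).
Hypothesis ab : a' + b < 1.
Variable xi : forall n, Omega -> 'cV[R]_n.
Hypothesis gxi : forall n, centered_gaussian_vector P (@xi n) (toeplitz n f).

Let Q n w := bform (invmx (toeplitz n g)) (xi n w) (xi n w).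
Let m n := \tr (invmx (toeplitz n g) *m toeplitz n f).

Let deviation_summable eps : 0 < eps ->
  (\sum_(0 <= n <oo) P [set w | (eps * n.+1%:R <= `|Q n.+1 w - m n.+1|)%R] < +oo)%E.
Proof.
move=> e0; have /andP[a0 a1] := a01; have /andP[b0 b1] := b01.
have /andP[a'0 a'1] := a'01.
have [K K0 HK] := toeplitz_upper a'01 W'.
have [k k0 Hk] := toeplitz_lower a1 b01 W.
have [B B0 HB] : exists2 B, 0 < B & forall n, n%:R^-1 * m n <= B.
  have /cvgP/cvg_seq_bounded/pinfty_ex_gt0[B B0 HB] := trace_limit a01 b01 W a'01 ab W'.
  by exists B => // n; apply: le_trans (HB n I); exact: ler_norm.
pose C := K / k; have C0 : 0 < C by rewrite divr_gt0.
(* With t L = tau C, the first entry ensures 8 t L <= 1. The second makes 10 t L B at most eps / 2,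
   so the quadratic term uses up half of the linear one; the other half gives the rate [c], at scale
   t n = tau n^(1 - (a' + b)). *)
pose tau := Num.min (1 / (8 * C)) (eps / (20 * (C * B))).
have tau0 : 0 < tau by rewrite lt_min !divr_gt0// mulr_gt0// mulr_gt0.
pose c := tau * eps / 2; have c0 : 0 < c by rewrite divr_gt0// mulr_gt0.
pose de := 1 - (a' + b); have de0 : 0 < de by rewrite subr_gt0.
apply: (@le_lt_trans _ _ (\sum_(0 <= n <oo) (2%:E * (expR (- (c * n.+1%:R `^ de)))%:E))%E); last first.
  rewrite nneseriesZl; last by move=> n _; rewrite lee_fin expR_ge0.
  by rewrite lte_mul_pinfty ?lee_fin// nneseries_expRN_lty.
apply: lee_nneseries => // j _; set n := j.+1.
have n0 : 0 < n%:R :> R by rewrite ltr0n.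
have n0' := ltW n0.
pose L := C * n%:R `^ (a' + b).
have nab : 0 < n%:R `^ (a' + b) :> R by rewrite powR_gt0.
have L0 : 0 < L by rewrite mulr_gt0.
pose t := tau / n%:R `^ (a' + b); have t0 : 0 < t by rewrite divr_gt0.
have tLE : t * L = tau * C by rewrite /t /L; field; rewrite gt_eqF.
have tC : tau * C <= 8^-1.
  apply: (@le_trans _ _ (1 / (8 * C) * C)); first by rewrite ler_pM2r// ge_min lexx.
  by rewrite le_eqVlt; apply/orP; left; apply/eqP; field; rewrite gt_eqF.
have STL (x : 'cV[R]_n) : bform (toeplitz n f) x x <= L * bform (toeplitz n g) x x.
  apply: (le_trans (HK n x isT)).
  apply: le_trans (ler_wpM2l (ltW L0) (Hk n x isT)).
  rewrite /L /C powRD; last by rewrite (gt_eqF n0) implybT.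
  rewrite powRN le_eqVlt; apply/orP; left; apply/eqP.
  have nb : 0 < n%:R `^ b :> R by rewrite powR_gt0.
  by field; rewrite !gt_eqF.
have tL : 8 * (t * L) <= 1 by rewrite tLE; lra.
have := @gaussian_quadratic_concentration _ _ _ P n (xi n) (toeplitz n f) (gxi n)
  (toeplitz_sym n f) (toeplitz_posdef a'1 b'01 W')
  (toeplitz n g) (toeplitz_sym n g) (toeplitz_posdef a1 b01 W) L t (ltW L0) STL t0 tL (eps * n%:R).
move=> /le_trans; apply; rewrite -EFinM lee_fin ler_pM2l// ler_expR.
have mB : m n <= n%:R * B by rewrite -ler_pdivrMl.
have tnE : t * n%:R = tau * n%:R `^ de.
  rewrite /de powRD; last by rewrite (gt_eqF n0) implybT.
  by rewrite powRr1// powRN /t mulrA mulrAC.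
have tB : tau * (20 * (C * B)) <= eps.
  have CB : 0 < 20 * (C * B) by rewrite mulr_gt0// mulr_gt0.
  by rewrite -ler_pdivlMr// ge_min lexx orbT.
have pd : 0 < n%:R `^ de :> R by rewrite powR_gt0.
rewrite -/(m n).
apply: (@le_trans _ _ (- (t * (eps * n%:R)) + 10 * (t ^+ 2 * (L * (n%:R * B))))).
  by rewrite lerD2l ler_pM2l// ler_pM2l ?exprn_gt0// ler_pM2l.
have -> : - (t * (eps * n%:R)) + 10 * (t ^+ 2 * (L * (n%:R * B))) =
    (t * n%:R) * (- eps + 10 * (t * L) * B) by ring.
rewrite tLE tnE /c -mulrN.
have -> : tau * eps / 2 * - n%:R `^ de = tau * n%:R `^ de * (- (eps / 2)) by ring.
by rewrite ler_pM2l ?mulr_gt0//; lra.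
Qed.

Lemma quadratic_form_cvg_ae :
  {ae P, forall w, n%:R^-1 * bform (invmx (toeplitz n g)) (xi n w) (xi n w)
    @[n --> \oo] --> J (fun t => f t / g t)}.
Proof.
(* Countably many tolerances 1 / (k + 1) are enough, so that one null set serves all of them. *)
have H : {ae P, forall w, forall k : nat, exists N, forall n, (N <= n)%N ->
    ~ [set w | (k.+1%:R^-1 * n.+1%:R <= `|Q n.+1 w - m n.+1|)%R] w}.
  apply: ae_foralln => k; apply: borel_cantelli_ae; last first.
    by apply: deviation_summable; rewrite invr_gt0.
  move=> n; rewrite -[X in measurable X]setTI.
  apply: measurable_fun_le => //; apply: measurableT_comp => //; apply: measurable_funB => //.
  by apply: measurable_bform; have [] := gxi n.+1.
apply: filterS H => w Hw.
have tr := trace_limit a01 b01 W a'01 ab W'.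
rewrite (_ : (fun n => _) = (fun n => n%:R^-1 * m n + n%:R^-1 * (Q n w - m n))); last first.
  by apply/funext => n; rewrite -mulrDr addrCA subrr addr0.
rewrite -[X in _ --> X]addr0; apply: cvgD => //.
rewrite -(cvg_shiftS _) /=; apply/cvgrPdist_lt => eps e0.
have [k ke] : exists k : nat, k.+1%:R^-1 < eps.
  have [k _ Hk] := near_infty_natSinv_lt (PosNum e0).
  by exists k; exact: (Hk k (leqnn k)).
have [N HN] := Hw k; exists N => // n Nn /=.
have n0 : 0 < n.+1%:R :> R by rewrite ltr0n.
rewrite sub0r normrN normrM gtr0_norm ?invr_gt0// mulrC ltr_pdivrMr//.
have /negP := HN n Nn; rewrite -ltNge => /lt_trans; apply.
by rewrite ltr_pM2r.
Qed.

End StrongConvergence.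

(** * The spectral density of fractional Gaussian noise *)

Section PowerFacts.
Variable R : realType.
Implicit Types (p q x y r d : R).

Lemma ler_powRN p x y : 0 <= p -> 0 < x -> x <= y -> y `^ (- p) <= x `^ (- p).
Proof.
move=> p0 x0 xy; have y0 := lt_le_trans x0 xy.
rewrite !powRN lef_pV2 ?posrE ?powR_gt0//.
by apply: ge0_ler_powR => //; rewrite nnegrE ltW.
Qed.

(** Linear dependence on [r], paid for by a slightly larger power: 1 - r ln y <= y^-r and ln y <=
    y^d / d. *)
Lemma powR_le_linear r d y : 0 <= r -> 0 < d -> 0 < y ->
  y `^ r <= 1 + r / d * y `^ (r + d).
Proof.
move=> r0 d0 y0.
have h1 : 1 - r * ln y <= y `^ (- r).
  rewrite /powR (gt_eqF y0); apply: le_trans (expR_ge1Dx _).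
  by rewrite mulNr.
have h2 : ln y <= d^-1 * y `^ d.
  rewrite mulrC ler_pdivlMr// mulrC /powR (gt_eqF y0).
  by apply: le_trans (expR_ge1Dx _); rewrite lerDr.
have yr : 0 < y `^ r by rewrite powR_gt0.
rewrite powRD; last by rewrite (gt_eqF y0) implybT.
have h3 : r * ln y <= r * (d^-1 * y `^ d) by rewrite ler_wpM2l.
have := ler_wpM2r (ltW yr) h1; rewrite powRN mulVf ?gt_eqF// => h4.
have := ler_wpM2r (ltW yr) h3.
rewrite (_ : r / d * (y `^ r * y `^ d) = r * (d^-1 * y `^ d) * y `^ r); last by ring.
by move: h4; rewrite mulrBl mul1r; lra.
Qed.

(** Powers change their monotonicity in the exponent at x = 1; the extra term, proportional to
    [q - p], covers both sides. *)
Lemma powRN_le_interp p q d x : p <= q -> 0 < d -> 0 < x ->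
  x `^ (- p) <= x `^ (- q) + (q - p) / d * x `^ (- (p - d)).
Proof.
move=> pq d0 x0; have qp : 0 <= q - p by rewrite subr_ge0.
have h := powR_le_linear qp d0 x0.
have xq : 0 <= x `^ (- q) by exact: powR_ge0.
have := ler_wpM2l xq h; rewrite mulrDr mulr1 mulrCA -!powRD; last 2 first.
- by rewrite (gt_eqF x0) implybT.
- by rewrite (gt_eqF x0) implybT.
have -> : - q + (q - p) = - p by ring.
by have -> : - q + (q - p + d) = - (p - d) by ring.
Qed.

Lemma continuous_powR p x : 0 < x -> {for x, continuous (fun y => y `^ p)}.
Proof.
move=> x0; have h : expR (p * ln y) @[y --> x] --> expR (p * ln x).
  apply: continuous_comp; last exact: continuous_expR.
  by apply: cvgM; [exact: cvg_cst|exact: continuous_ln].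
rewrite /prop_for /continuous_at {2}/powR (gt_eqF x0).
apply: cvg_trans h; apply: near_eq_cvg; near=> y.
by rewrite /powR gt_eqF//; near: y; exact: lt_nbhsr.
Unshelve. all: by end_near. Qed.

End PowerFacts.

(** * The terms of the spectral series with k different from 0 *)

Section FgnTail.
Variable R : realType.
Notation Upi := (@Upi R).
Implicit Types (p q t s u v c d : R).

(** The indices n + 1 and - (n + 1) are paired, which makes the term even in [t]; for |t| <= pi both
    bases are at least pi. *)
Definition fgn_term p t n : R :=
  `|t - pi *+ 2 * n.+1%:R| `^ (- p) + `|t + pi *+ 2 * n.+1%:R| `^ (- p).

Definition fgn_tail p t : R := fine (\sum_(0 <= n <oo) (fgn_term p t n)%:E)%E.

Lemma fgn_term_ge0 p t n : 0 <= fgn_term p t n.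
Proof. by rewrite addr_ge0// powR_ge0. Qed.

Lemma fgn_tail_ge0 p t : 0 <= fgn_tail p t.
Proof. by apply: fine_ge0; apply: nneseries_ge0 => n _ _; rewrite lee_fin fgn_term_ge0. Qed.

Lemma fgn_termN p t n : fgn_term p (- t) n = fgn_term p t n.
Proof. by rewrite /fgn_term -opprD normrN addrC (_ : - t + _ = - (t - pi *+ 2 * n.+1%:R)) ?normrN//; ring. Qed.

Lemma norm_shift_ge t n : `|t| <= pi ->
  n.*2.+1%:R * pi <= `|t - pi *+ 2 * n.+1%:R| /\ n.*2.+1%:R * pi <= `|t + pi *+ 2 * n.+1%:R|.
Proof.
move=> tp; have p0 := pi_gt0 R.
have E : pi *+ 2 * n.+1%:R = n.*2.+1%:R * pi + pi :> R.
  by rewrite -muln2 -[n.+1]addn1 -[(n * 2).+1]addn1 !natrD natrM; ring.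
have B0 : 0 <= n.*2.+1%:R * pi :> R by rewrite mulr_ge0// ltW.
move: tp; rewrite ler_norml E => /andP[t1 t2]; split.
  by rewrite ler0_norm; lra.
by rewrite ger0_norm; lra.
Qed.

Lemma norm_shift_ge_pi t n : `|t| <= pi ->
  pi <= `|t - pi *+ 2 * n.+1%:R| /\ pi <= `|t + pi *+ 2 * n.+1%:R|.
Proof.
move=> tp; have [h1 h2] := norm_shift_ge n tp; have p0 := pi_gt0 R.
have : pi <= n.*2.+1%:R * pi :> R by rewrite ler_peMl ?(ltW p0)// ler1n.
by split; [apply: le_trans h1|apply: le_trans h2].
Qed.

Lemma fgn_term_le p t n : 0 <= p -> `|t| <= pi ->
  fgn_term p t n <= 2 * n.+1%:R `^ (- p).
Proof.
move=> p0 tp; have [h1 h2] := norm_shift_ge n tp; have p2 := pi_ge2 R.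
have nn : n.+1%:R <= n.*2.+1%:R * pi :> R.
  apply: (@le_trans _ _ (n.*2.+1%:R)); first by rewrite ler_nat ltnS -addnn leq_addr.
  by rewrite ler_peMr//; lra.
rewrite mulr_natl mulr2n; apply: lerD; apply: ler_powRN => //; exact: le_trans nn _.
Qed.

Lemma fgn_series_le p t : 1 < p -> `|t| <= pi ->
  (\sum_(0 <= n <oo) (fgn_term p t n)%:E <= (2 * (1 + (p - 1)^-1))%:E)%E.
Proof.
move=> p1 tp; have p10 : 0 < p - 1 by rewrite subr_gt0.
apply: lime_le; first by apply: is_cvg_nneseries => n _ _; rewrite lee_fin fgn_term_ge0.
apply: nearW => N; rewrite sumEFin lee_fin.
apply: (@le_trans _ _ (\sum_(0 <= n < N) 2 * n.+1%:R `^ (- (1 + (p - 1))))).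
  by apply: ler_sum => n _; rewrite addrC subrK fgn_term_le//; lra.
by rewrite -mulr_sumr ler_pM2l// sum_powRN_le.
Qed.

Lemma fgn_series_fin p t : 1 < p -> `|t| <= pi ->
  (\sum_(0 <= n <oo) (fgn_term p t n)%:E)%E \is a fin_num.
Proof.
move=> p1 tp; rewrite ge0_fin_numE; last by apply: nneseries_ge0 => n _ _; rewrite lee_fin fgn_term_ge0.
by apply: le_lt_trans (fgn_series_le p1 tp) _; exact: ltry.
Qed.

Lemma fgn_tail_le p t : 1 < p -> `|t| <= pi -> fgn_tail p t <= 2 * (1 + (p - 1)^-1).
Proof.
move=> p1 tp; rewrite -lee_fin fineK ?fgn_series_fin//; exact: fgn_series_le.
Qed.

Lemma le_fgn_tail c d p q r t s : 1 < p -> 1 < q -> 1 < r -> 0 <= c -> 0 <= d ->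
  `|t| <= pi -> `|s| <= pi ->
  (forall n, fgn_term p t n <= c * fgn_term q s n + d * fgn_term r s n) ->
  fgn_tail p t <= c * fgn_tail q s + d * fgn_tail r s.
Proof.
move=> p1 q1 r1 c0 d0 tp sp H.
rewrite -lee_fin EFinD !EFinM !fineK ?fgn_series_fin//.
have tge p' t' n : (0 <= (fgn_term p' t' n)%:E)%E by rewrite lee_fin fgn_term_ge0.
rewrite -!nneseriesZl//; try by move=> n _; exact: tge.
rewrite -nneseriesD; last 2 first.
- by move=> n _ _; rewrite mule_ge0// lee_fin.
- by move=> n _ _; rewrite mule_ge0// lee_fin.
apply: lee_nneseries => // n _; rewrite -!EFinM -EFinD lee_fin; exact: H.
Qed.

(** All bases are at least pi, so moving from [t] to [s] changes each by a factor of at most 1 + |t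
    - s| / pi; the power 3 bounds [p]. *)
Lemma fgn_tail_ratio p t s : 1 < p <= 3 -> `|t| <= pi -> `|s| <= pi ->
  fgn_tail p t <= (1 + `|t - s| / pi) ^+ 3 * fgn_tail p s.
Proof.
move=> /andP[p1 p3] tp sp; have pi0 := pi_gt0 R.
pose x := `|t - s| / pi; have x0 : 0 <= x by rewrite divr_ge0// ltW.
have x1 : 0 < 1 + x by lra.
have c0 : 0 <= (1 + x) ^+ 3 by rewrite exprn_ge0// ltW.
rewrite -[leRHS]addr0 -(mul0r (fgn_tail p s)); apply: le_fgn_tail => // n.
rewrite mul0r addr0 mulrDr.
have key (y z : R) : pi <= `|y| -> pi <= `|z| -> `|z - y| <= `|t - s| -> `|y| `^ (- p) <= (1 + x) ^+ 3 * `|z| `^ (- p).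
  move=> py pz zy; have y0 : 0 < `|y| by lra. have z0 : 0 < `|z| by lra.
  have h : `|z| <= (1 + x) * `|y|.
    have h1 : `|z| <= `|z - y| + `|y| by apply: le_trans (ler_normD _ _); rewrite subrK.
    have h2 : `|t - s| <= x * `|y|.
      by rewrite -[leLHS](divfK (lt0r_neq0 pi0)) -/x ler_wpM2l.
    by rewrite mulrDl mul1r; lra.
  have p0 : 0 <= p by lra.
  have := ler_powRN p0 z0 h; rewrite powRM ?(ltW x1)// => h3.
  have h4 : (1 + x) `^ p <= (1 + x) ^+ 3.
    by rewrite -[leRHS]powR_mulrn ?(ltW x1)//; apply: ler_powR => //; lra.
  have xp : 0 < (1 + x) `^ p by rewrite powR_gt0.
  have h5 : `|y| `^ (- p) <= (1 + x) `^ p * `|z| `^ (- p).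
    by move: h3; rewrite (powRN (1 + x)) ler_pdivrMl.
  by apply: (le_trans h5); rewrite ler_wpM2r ?powR_ge0.
have [t1 t2] := norm_shift_ge_pi n tp; have [s1 s2] := norm_shift_ge_pi n sp.
apply: lerD; apply: key => //.
  by rewrite (_ : s - _ - _ = - (t - s)) ?normrN//; ring.
by rewrite (_ : s + _ - _ = - (t - s)) ?normrN//; ring.
Qed.

Lemma fgn_tail_comparable p t s : 1 < p <= 3 -> `|t| <= pi -> `|s| <= pi ->
  fgn_tail p t <= 27 * fgn_tail p s.
Proof.
move=> p13 tp sp; have pi0 := pi_gt0 R.
apply: (le_trans (fgn_tail_ratio p13 tp sp)); apply: ler_wpM2r; first exact: fgn_tail_ge0.
have x0 : 0 <= `|t - s| / pi by rewrite divr_ge0// ltW.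
have x2 : `|t - s| / pi <= 2.
  by rewrite ler_pdivrMr//; apply: le_trans (ler_normB _ _) _; lra.
rewrite (_ : 27 = 3 ^+ 3 :> R); last by rewrite -natrX.
by apply: lerXn2r; rewrite ?nnegrE//; lra.
Qed.

Lemma fgn_tail_lipschitz p t s : 1 < p <= 3 -> `|t| <= pi -> `|s| <= pi ->
  `|fgn_tail p t - fgn_tail p s| <= 26 * (1 + (p - 1)^-1) * `|t - s|.
Proof.
move=> p13; have /andP[p1 p3] := p13; have p2 := pi_ge2 R; have pi0 := pi_gt0 R.
wlog st : t s / fgn_tail p s <= fgn_tail p t.
  move=> H tp sp; have [st|/ltW ts] := leP (fgn_tail p s) (fgn_tail p t); first exact: H.
  by rewrite distrC (distrC t); exact: H.
move=> tp sp; rewrite ger0_norm ?subr_ge0//.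
pose x := `|t - s| / pi; have x0 : 0 <= x by rewrite divr_ge0// ltW.
have x2 : x <= 2 by rewrite ler_pdivrMr//; apply: le_trans (ler_normB _ _) _; lra.
(* (1 + x)^3 - 1 = x (3 + 3 x + x^2), and x <= 2. *)
have x3 : (1 + x) ^+ 3 - 1 <= 13 * x by move: x0 x2; clear => ? ?; rewrite !exprS expr0 mulr1; nra.
have xts : 13 * x <= 13 * `|t - s|.
  by rewrite ler_pM2l// ler_pdivrMr// ler_peMr//; lra.
have h := fgn_tail_ratio p13 tp sp; have hM := fgn_tail_le p1 sp.
have h0 := fgn_tail_ge0 p s.
apply: (@le_trans _ _ (((1 + x) ^+ 3 - 1) * fgn_tail p s)).
  by rewrite mulrBl mul1r lerD2r.
apply: (@le_trans _ _ (13 * `|t - s| * (2 * (1 + (p - 1)^-1)))); last by rewrite le_eqVlt; apply/orP; left; apply/eqP; ring.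
apply: (@le_trans _ _ (13 * `|t - s| * fgn_tail p s)).
  by apply: ler_wpM2r => //; exact: le_trans x3 xts.
by apply: ler_wpM2l => //; rewrite mulr_ge0.
Qed.

Lemma fgn_tail_interp p q d t : 1 < p - d -> 0 < d -> p <= q -> `|t| <= pi ->
  fgn_tail p t <= fgn_tail q t + (q - p) / d * fgn_tail (p - d) t.
Proof.
move=> pd d0 pq tp; rewrite -[fgn_tail q t]mul1r; have pi0 := pi_gt0 R.
apply: le_fgn_tail => //; try lra; first by rewrite divr_ge0 ?subr_ge0// ltW.
move=> n; have [t1 t2] := norm_shift_ge_pi n tp; rewrite mul1r mulrDr addrACA.
by apply: lerD; apply: powRN_le_interp => //; exact: lt_le_trans pi0 _.
Qed.

(** Every base is at least pi >= |t|, so the tail obeys the same comparison as the polar term. *)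
Lemma fgn_tail_antitone p q t : 1 < p -> p <= q -> `|t| <= pi -> 0 < `|t| ->
  fgn_tail q t <= `|t| `^ (- (q - p)) * fgn_tail p t.
Proof.
move=> p1 pq tp t0; rewrite -[leRHS]addr0 -(mul0r (fgn_tail p t)); have pi0 := pi_gt0 R.
have qp : 0 <= q - p by rewrite subr_ge0.
have q1 := lt_le_trans p1 pq.
apply: le_fgn_tail => //.
move=> n; have [t1 t2] := norm_shift_ge_pi n tp; rewrite mul0r addr0 mulrDr.
have key (y : R) : pi <= `|y| -> `|y| `^ (- q) <= `|t| `^ (- (q - p)) * `|y| `^ (- p).
  move=> py; have y0 : 0 < `|y| by lra.
  rewrite (_ : - q = - (q - p) + - p); last by ring.
  rewrite powRD; last by rewrite (gt_eqF y0) implybT.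
  by apply: ler_wpM2r; [exact: powR_ge0|apply: ler_powRN => //; exact: le_trans tp py].
by apply: lerD; apply: key.
Qed.

End FgnTail.

(** * Power bounds for the unnormalized density *)

Section FgnDensity.
Variable R : realType.
Notation Upi := (@Upi R).
Implicit Types (p q t s u v c d : R).

Lemma esum_int (a : int -> \bar R) : (forall k, (0 <= a k)%E) ->
  (\esum_(k in [set: int]) a k =
   a 0%R + \sum_(0 <= n <oo) (a n.+1%:Z + a (- n.+1%:Z)%R))%E.
Proof.
move=> a0.
rewrite (esumID [set 0]) // setTI esum_set1//; congr (_ + _)%E.
rewrite (esumID (range (fun n : nat => n.+1%:Z))) // setTI.
rewrite nneseriesD//; congr (_ + _)%E.
  rewrite (_ : ~` [set 0] `&` _ = (fun n : nat => n.+1%:Z) @` setT); last first.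
    by apply/seteqP; split => [x [_]//|x xr]; split => //; case: xr => n _ <-.
  by rewrite esum_image ?nneseries_esumT// => m n _ _ [].
rewrite (_ : ~` [set 0] `&` _ = (fun n : nat => - n.+1%:Z) @` setT); last first.
  apply/seteqP; split => [[[|n]|n] [/= h1 h2]|x [n _ <-]].
  - by exfalso; apply: h1.
  - by exfalso; apply: h2; exists n.
  - by exists n => //; rewrite NegzE.
  - by split => //= -[m _].
by rewrite esum_image ?nneseries_esumT// => m n _ _ /oppr_inj [].
Qed.

Lemma fgn_unnormE u t : fgn_unnorm u t =
  (2 - 2 * cos t) * fine ((`|t| `^ (- (2 * u + 1)))%:E +
    \sum_(0 <= n <oo) (fgn_term (2 * u + 1) t n)%:E)%E.
Proof.
rewrite /fgn_unnorm esum_int; last by move=> k; rewrite lee_fin powR_ge0.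
rewrite mulr0 subr0; congr (_ * fine (_ + _)%E).
apply: eq_eseriesr => n _; rewrite -EFinD; congr EFin; rewrite /fgn_term.
by rewrite mulrNz mulrN opprK.
Qed.

Lemma fgn_unnorm_tail u t : 0 < u -> `|t| <= pi -> fgn_unnorm u t =
  (2 - 2 * cos t) * (`|t| `^ (- (2 * u + 1)) + fgn_tail (2 * u + 1) t).
Proof.
move=> u0 tp; rewrite fgn_unnormE fineD ?fgn_series_fin//; lra.
Qed.

Lemma twoB2cos_ge0 t : 0 <= 2 - 2 * cos t.
Proof. by have := cos_le1 t; lra. Qed.

Lemma measurable_fgn_unnorm u : measurable_fun setT (fgn_unnorm u : R -> R).
Proof.
rewrite (_ : fgn_unnorm u = fun t => (2 - 2 * cos t) * fine ((`|t| `^ (- (2 * u + 1)))%:E +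
    \sum_(0 <= n <oo) (fgn_term (2 * u + 1) t n)%:E)%E); last first.
  by apply/funext => t; exact: fgn_unnormE.
apply: measurable_funM.
  by apply: measurable_funB => //; apply: measurable_funM => //; exact: continuous_measurable_fun (@continuous_cos R).
apply: (measurableT_comp (fine_measurable measurableT)).
have mp a : measurable_fun setT (fun t : R => `|t + a| `^ (- (2 * u + 1))).
  apply: (measurableT_comp (measurable_norm_powR _)); exact: measurable_funD.
apply: emeasurable_funD; first by apply/measurable_EFinP; exact: measurable_norm_powR.
have := @ge0_emeasurable_sum _ _ R setT (fun n t => (fgn_term (2 * u + 1) t n)%:E) predT.
by apply => n *; [rewrite lee_fin fgn_term_ge0|apply/measurable_EFinP; exact: measurable_funD].
Qed.

Lemma fgn_unnorm_ge0 u t : 0 <= fgn_unnorm u t.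
Proof.
rewrite fgn_unnormE mulr_ge0 ?twoB2cos_ge0// fine_ge0// adde_ge0 ?lee_fin ?powR_ge0//.
by apply: nneseries_ge0 => n _ _; rewrite lee_fin fgn_term_ge0.
Qed.

Lemma fgn_unnormN u t : fgn_unnorm u (- t) = fgn_unnorm u t.
Proof.
rewrite !fgn_unnormE cosN normrN; congr (_ * fine (_ + _)%E).
by apply: eq_eseriesr => n _; rewrite fgn_termN.
Qed.

Let near_norm_le_pi t : `|t| < pi -> \forall s \near t, `|s| <= pi.
Proof.
move=> tp; have h : s @[s --> t] --> t by exact: cvg_id.
by near=> s; apply: ltW; near: s; apply: cvgr_norm_lt h _ tp.
Unshelve. all: by end_near.
Qed.

Lemma fgn_unnorm_cont u t : 0 < u < 1 -> Upi t -> {for t, continuous (fgn_unnorm u)}.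
Proof.
move=> /andP[u0 u1] Ut; have t0 := Upi_neq0 Ut; have tp := Upi_norm Ut.
pose p := 2 * u + 1; have p13 : 1 < p <= 3 by rewrite /p; apply/andP; split; lra.
have h : (2 - 2 * cos s) * (`|s| `^ (- p) + fgn_tail p s) @[s --> t] -->
    (2 - 2 * cos t) * (`|t| `^ (- p) + fgn_tail p t).
  apply: cvgM.
    apply: cvgB; first exact: cvg_cst.
    by apply: cvgM; [exact: cvg_cst|exact: continuous_cos].
  apply: cvgD.
    apply: (@continuous_comp _ _ _ (fun s : R => `|s|) (fun y => y `^ (- p))); first exact: norm_continuous.
    exact: continuous_powR.
  pose L := 26 * (1 + (p - 1)^-1).
  have L0 : 0 < L.
    by rewrite /L mulr_gt0// addr_gt0// invr_gt0; lra.
  apply/cvgrPdist_lt => e e0; near=> s.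
  have sp : `|s| <= pi.
    by near: s; exact: near_norm_le_pi.
  apply: le_lt_trans (fgn_tail_lipschitz p13 (ltW tp) sp) _.
  rewrite -/L -ltr_pdivlMl//; near: s.
  by apply: cvgr_dist_lt => //; rewrite mulr_gt0 ?invr_gt0.
rewrite /prop_for /continuous_at fgn_unnorm_tail ?(ltW tp)//.
apply: cvg_trans h; apply: near_eq_cvg; near=> s.
rewrite fgn_unnorm_tail//; near: s.
exact: near_norm_le_pi.
Unshelve. all: by end_near. Qed.

Lemma twoB2cos_le t : 2 - 2 * cos t <= `|t| ^+ 2.
Proof.
rewrite twoB2cos real_normK ?num_real//.
have := sqr_sin_le (t / 2); rewrite expr_div_n; lra.
Qed.

Lemma twoB2cos_lb t : `|t| <= pi -> sinc0 R ^+ 2 * `|t| ^+ 2 <= 2 - 2 * cos t.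
Proof.
move=> tp; have p0 := pi_gt0 R; rewrite twoB2cos real_normK ?num_real//.
have : `|t / 2| <= 3 * pi / 4 by rewrite normrM (ger0_norm (_ : 0 <= 2^-1))//; lra.
move=> /sqr_sin_ge; rewrite exprMn expr_div_n => h.
have -> : sinc0 R ^+ 2 * t ^+ 2 = 4 * (sinc0 R ^+ 2 * (t ^+ 2 / 2 ^+ 2)) by field.
by rewrite ler_pM2l.
Qed.

Lemma powR_sqrM u t : 0 < `|t| -> `|t| ^+ 2 * `|t| `^ (- (2 * u + 1)) = `|t| `^ (1 - 2 * u).
Proof.
move=> t0; rewrite -(powR_mulrn 2 (normr_ge0 t)) -powRD; last by rewrite (gt_eqF t0) implybT.
by congr (_ `^ _); ring.
Qed.

Lemma fgn_unnorm_lb u t : 0 < u -> Upi t ->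
  sinc0 R ^+ 2 * `|t| `^ (1 - 2 * u) <= fgn_unnorm u t.
Proof.
move=> u0 Ut; have t0 := Upi_neq0 Ut; have tp := Upi_norm Ut.
rewrite fgn_unnorm_tail ?(ltW tp)// -powR_sqrM// mulrA.
apply: ler_pM; rewrite ?powR_ge0 ?twoB2cos_lb ?(ltW tp)//.
  by apply: mulr_ge0; exact: sqr_ge0.
by rewrite lerDl fgn_tail_ge0.
Qed.

Lemma powRN_ge_pi p t : 0 <= p <= 3 -> Upi t -> pi ^- 3 <= `|t| `^ (- p).
Proof.
move=> /andP[p0 p3] Ut; have t0 := Upi_neq0 Ut; have tp := Upi_norm Ut; have p2 := pi_ge2 R.
have pi0 := pi_gt0 R.
apply: (@le_trans _ _ (pi `^ (- p))); last by apply: ler_powRN => //; exact: ltW.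
rewrite -powR_invn ?(ltW pi0)//; apply: ler_powR; first lra.
by rewrite lerN2.
Qed.

(* The tail is dominated by the polar term because [fgn_tail] is bounded while [`|t| `^ (- p)] is bounded below. *)
Lemma fgn_unnorm_ub u : 0 < u < 1 -> exists2 C, 0 < C &
  forall v t, u <= v <= 1 -> Upi t -> fgn_unnorm v t <= C * `|t| `^ (1 - 2 * v).
Proof.
move=> /andP[u0 u1]; have pi0 := pi_gt0 R; pose M := 2 * (1 + (2 * u)^-1).
have M0 : 0 < M by rewrite mulr_gt0// addr_gt0// invr_gt0 mulr_gt0.
exists (1 + M * pi ^+ 3); first by rewrite addr_gt0// mulr_gt0// exprn_gt0.
move=> v t /andP[uv v1] Ut; have t0 := Upi_neq0 Ut; have tp := Upi_norm Ut.
rewrite fgn_unnorm_tail ?(ltW tp)//; last lra.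
rewrite -powR_sqrM// mulrCA; apply: ler_pM; rewrite ?twoB2cos_ge0 ?twoB2cos_le//.
  by rewrite addr_ge0 ?powR_ge0 ?fgn_tail_ge0.
rewrite [leRHS]mulrDl mul1r lerD2l.
apply: (@le_trans _ _ M).
  have h1 : 1 < 2 * v + 1 by lra.
  apply: le_trans (fgn_tail_le h1 (ltW tp)) _.
  rewrite addrK ler_pM2l// lerD2l lef_pV2 ?posrE; lra.
have h13 : 0 <= 2 * v + 1 <= 3 by apply/andP; split; lra.
have h := powRN_ge_pi h13 Ut; rewrite -mulrA; apply: ler_peMr; first exact: ltW.
have p3 : 0 < pi ^+ 3 :> R by rewrite exprn_gt0.
by rewrite -ler_pdivrMl// mulr1.
Qed.

(** The Toeplitz bounds require nonnegative exponents, so a negative [e] is replaced by 0 at the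
    cost of a factor pi. *)
Lemma powR_ge_max e t : -1 <= e -> Upi t -> pi^-1 * `|t| `^ (Num.max 0 e) <= `|t| `^ e.
Proof.
move=> e1 Ut; have t0 := Upi_neq0 Ut; have tp := Upi_norm Ut; have p2 := pi_ge2 R.
have pi0 := pi_gt0 R.
case: (leP 0 e) => [e0|/ltW e0].
  by rewrite ler_piMl ?powR_ge0// invf_le1//; lra.
rewrite powRr0 mulr1 -powR_inv1 ?(ltW pi0)//.
apply: (@le_trans _ _ (pi `^ e)); first by apply: ler_powR => //; lra.
rewrite -[e]opprK; apply: ler_powRN => //; [by rewrite oppr_ge0|exact: ltW].
Qed.

Lemma powR_le_max e t : e <= 1 -> Upi t -> `|t| `^ e <= pi * `|t| `^ (- Num.max 0 (- e)).
Proof.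
move=> e1 Ut; have t0 := Upi_neq0 Ut; have pi0 := pi_gt0 R.
have h : -1 <= - e by rewrite lerN2.
have := powR_ge_max h Ut; rewrite ler_pdivrMl// => h'.
have m0 : 0 < `|t| `^ e by rewrite powR_gt0.
have n0 : 0 < `|t| `^ (Num.max 0 (- e)) by rewrite powR_gt0.
rewrite (powRN _ (Num.max _ _)) ler_pdivlMr// -ler_pdivlMl// mulrC -powRN mulrC.
by rewrite mulrC.
Qed.

(** The density is comparable to |t|^(1 - 2u): a pole for u > 1/2, a zero for u < 1/2, so at most
    one of the two exponents is positive. *)
Lemma fgn_weight u : 0 < u < 1 ->
  weight (Num.max 0 (2 * u - 1)) (Num.max 0 (1 - 2 * u)) (fgn_unnorm u).
Proof.
move=> u01; have /andP[u0 u1] := u01; have pi0 := pi_gt0 R; have s0 := sinc0_gt0 R.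
have [C C0 HC] := fgn_unnorm_ub u01.
split.
- exact: measurable_fgn_unnorm.
- exact: fgn_unnorm_ge0.
- exact: fgn_unnormN.
- by move=> t; exact: fgn_unnorm_cont.
- exists (sinc0 R ^+ 2 * pi^-1); first by apply: mulr_gt0; [exact: exprn_gt0|rewrite invr_gt0].
  move=> t Ut; apply: le_trans (fgn_unnorm_lb u0 Ut).
  rewrite -mulrA; apply: ler_wpM2l; first exact: sqr_ge0.
  by apply: powR_ge_max => //; lra.
- exists (C * pi); first exact: mulr_gt0.
  move=> t Ut; have uu : u <= u <= 1 by rewrite lexx ltW.
  apply: (le_trans (HC u t uu Ut)); rewrite -mulrA ler_pM2l//.
  have -> : 2 * u - 1 = - (1 - 2 * u) by ring.
  by apply: powR_le_max => //; lra.
Qed.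

Lemma weightZ a b g c : 0 < c -> weight a b g -> weight a b (fun t : R => c * g t).
Proof.
move=> c0 [mg g0 gN cg [k k0 Hk] [C C0 HC]]; split.
- exact: measurable_funM.
- by move=> t; rewrite mulr_ge0// ltW.
- by move=> t; rewrite gN.
- by move=> t Ut; apply: cvgM; [exact: cvg_cst|exact: cg].
- by exists (c * k); [exact: mulr_gt0|move=> t Ut; rewrite -mulrA ler_pM2l// Hk].
- by exists (c * C); [exact: mulr_gt0|move=> t Ut; rewrite -mulrA ler_pM2l// HC].
Qed.

End FgnDensity.

(** * Comparison of densities for different Hurst parameters *)

Section FgnComparison.
Variable R : realType.
Notation Upi := (@Upi R).
Implicit Types (p q t s u v c d e : R).

Lemma powR_le_pi3 e t : 0 <= e <= 3 -> Upi t -> `|t| `^ e <= pi ^+ 3.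
Proof.
move=> /andP[e0 e3] Ut; have tp := Upi_norm Ut; have p2 := pi_ge2 R; have pi0 := pi_gt0 R.
rewrite -powR_mulrn ?(ltW pi0)//; apply: (@le_trans _ _ (pi `^ e)).
  by apply: ge0_ler_powR; rewrite ?nnegrE ?(ltW pi0) ?(ltW tp).
by apply: ler_powR => //; lra.
Qed.

Lemma powR_split_pi3 e e' t : 0 <= e' - e <= 3 -> Upi t ->
  `|t| `^ e' <= pi ^+ 3 * `|t| `^ e.
Proof.
move=> ee Ut; have t0 := Upi_neq0 Ut; rewrite -[e'](subrK e) powRD; last by rewrite (gt_eqF t0) implybT.
by apply: ler_wpM2r; [exact: powR_ge0|exact: powR_le_pi3].
Qed.

(** For |t| > 1 every term of the series decreases in the exponent, so g_u <= g_v fails there;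
    interpolation restores it up to a term proportional to v - u. Taking the gap equal to [u0] keeps
    the exponent p - u0 above 1, where the tail is bounded. *)
Lemma fgn_unnorm_quasi_mono u0 : 0 < u0 -> exists2 K, 0 < K &
  forall u v t, u0 <= u <= v -> v <= 1 -> Upi t ->
    fgn_unnorm u t <= (1 + K * (v - u)) * fgn_unnorm v t.
Proof.
move=> u00; have pi0 := pi_gt0 R.
pose M := 2 * (1 + u0^-1); have M0 : 0 < M by rewrite mulr_gt0// addr_gt0// invr_gt0.
pose K' := pi ^+ 3 * (1 + M); have p30 : 0 < pi ^+ 3 :> R by rewrite exprn_gt0.
have K'0 : 0 < K' by apply: mulr_gt0 => //; lra.
exists (2 / u0 * K'); first by rewrite mulr_gt0// divr_gt0.
move=> u v t /andP[u0u uv] v1 Ut; have t0 := Upi_neq0 Ut; have tp := ltW (Upi_norm Ut).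
rewrite !fgn_unnorm_tail//; [|lra..].
rewrite mulrCA ler_wpM2l ?twoB2cos_ge0//.
set p := 2 * u + 1; set q := 2 * v + 1.
have qpE : q - p = 2 * (v - u) by rewrite /p /q; ring.
have pq : p <= q by rewrite /p /q; lra.
have pd : 1 < p - u0 by rewrite /p; lra.
have h3 : `|t| `^ (- (p - u0)) <= pi ^+ 3 * `|t| `^ (- q).
  by apply: powR_split_pi3 => //; apply/andP; rewrite /p /q; split; lra.
have h4 : fgn_tail (p - u0) t <= M.
  apply: le_trans (fgn_tail_le pd tp) _; rewrite /M ler_pM2l// lerD2l.
  have u0p : u0 <= p - u0 - 1 by rewrite /p; lra.
  by rewrite lef_pV2 ?posrE//; exact: lt_le_trans u0p.
have h5 : 1 <= pi ^+ 3 * `|t| `^ (- q).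
  by rewrite -ler_pdivrMl// mulr1; apply: powRN_ge_pi => //; apply/andP; rewrite /q; split; lra.
have h6 : M <= M * (pi ^+ 3 * `|t| `^ (- q)) by apply: ler_peMr => //; exact: ltW.
have h7 : `|t| `^ (- (p - u0)) + fgn_tail (p - u0) t <= K' * `|t| `^ (- q).
  by rewrite (_ : K' * _ = pi ^+ 3 * `|t| `^ (- q) + M * (pi ^+ 3 * `|t| `^ (- q))); [lra|rewrite /K'; ring].
have h1 := powRN_le_interp pq u00 t0.
have h2 := fgn_tail_interp pd u00 pq tp.
have qpd : 0 <= (q - p) / u0 by rewrite divr_ge0 ?subr_ge0// ltW.
have h8 := ler_wpM2l qpd h7.
apply: (@le_trans _ _ (`|t| `^ (- q) + fgn_tail q t + (q - p) / u0 * (K' * `|t| `^ (- q)))).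
  by move: h8; rewrite mulrDr; lra.
rewrite [leRHS]mulrDl mul1r lerD2l.
rewrite (_ : 2 / u0 * K' * (v - u) = (q - p) / u0 * K'); last by rewrite qpE; ring.
rewrite mulrA; apply: ler_wpM2l; first by rewrite mulr_ge0// ltW.
by rewrite lerDl fgn_tail_ge0.
Qed.

(** The opposite comparison. Its factor is unbounded at the origin, so it serves under the integral,
    for the limit. *)
Lemma fgn_unnorm_antitone u v t : 0 < u -> u <= v -> Upi t ->
  fgn_unnorm v t <= `|t| `^ (- (2 * (v - u))) * fgn_unnorm u t.
Proof.
move=> u0 uv Ut; have t0 := Upi_neq0 Ut; have tp := ltW (Upi_norm Ut).
rewrite !fgn_unnorm_tail//; last lra.
rewrite mulrCA ler_wpM2l ?twoB2cos_ge0// mulrDr.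
have E : 2 * (v - u) = (2 * v + 1) - (2 * u + 1) by ring.
apply: lerD.
  by rewrite -powRD; [rewrite le_eqVlt; apply/orP; left; apply/eqP; congr (_ `^ _); ring|rewrite (gt_eqF t0) implybT].
by rewrite E; apply: fgn_tail_antitone => //; lra.
Qed.

Let iJ_twoB2cos : iJ (fun t : R => 2 - 2 * cos t).
Proof.
apply: (@iJ_dom _ _ (fun=> 4)); [|exact: iJ_cst|].
  by apply: measurable_funB => //; apply: measurable_funM => //; exact: continuous_measurable_fun (@continuous_cos R).
by move=> t _; rewrite !ger0_norm ?twoB2cos_ge0//; have := cos_geN1 t; lra.
Qed.

Let J_twoB2cos : J (fun t : R => 2 - 2 * cos t) = 2.
Proof.
have ic : iJ (fun t : R => cos t).
  apply: (@iJ_dom _ _ (fun=> 1)); [exact: continuous_measurable_fun (@continuous_cos R)|exact: iJ_cst|].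
  by move=> t _; rewrite normr1 ler_norml cos_geN1 cos_le1.
rewrite JB ?JZ ?J_cst//; [|exact: iJ_cst|exact: iJZ].
have := J_cos R 1; rewrite (eq_J (h := cos)) => [->|t _]; first by rewrite mulr0 subr0.
by rewrite mul1r.
Qed.

Lemma iJ_fgn u : 0 < u < 1 -> iJ (fgn_unnorm u : R -> R).
Proof.
move=> u01; have /andP[u0 u1] := u01; apply: iJ_weight (fgn_weight u01).
by rewrite gt_max ltr01; lra.
Qed.

Lemma J_fgn_ge u c : 0 < u < 1 -> 0 <= c ->
  (forall t, Upi t -> c <= `|t| `^ (- (2 * u + 1)) + fgn_tail (2 * u + 1) t) ->
  2 * c <= J (fgn_unnorm u).
Proof.
move=> u01 c0 H; have /andP[u0 u1] := u01; rewrite -J_twoB2cos mulrC -JZ; last exact: iJ_twoB2cos.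
apply: le_J; [exact: iJZ iJ_twoB2cos|exact: iJ_fgn|move=> t Ut].
rewrite fgn_unnorm_tail ?(ltW (Upi_norm Ut))// mulrC.
by apply: ler_wpM2l; [exact: twoB2cos_ge0|exact: H].
Qed.

Lemma J_fgn_gt0 u : 0 < u < 1 -> 0 < J (fgn_unnorm u : R -> R).
Proof.
move=> u01; have /andP[u0 u1] := u01; have pi0 := pi_gt0 R.
have p3 : 0 < pi ^- 3 :> R by rewrite invr_gt0 exprn_gt0.
apply: lt_le_trans (J_fgn_ge u01 (ltW p3) _); first by rewrite mulr_gt0.
move=> t Ut; have h13 : 0 <= 2 * u + 1 <= 3 by apply/andP; split; lra.
by apply: le_trans (powRN_ge_pi h13 Ut) _; rewrite lerDl fgn_tail_ge0.
Qed.

Lemma fcoef0_fgn u : fcoef (fgn_unnorm u) 0 = J (fgn_unnorm u : R -> R).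
Proof.
rewrite fcoefE; last exact: measurable_fgn_unnorm.
by apply: eq_J => t _; rewrite mul0r cos0 mul1r.
Qed.

Lemma C_fgn_gt0 u : 0 < u < 1 -> 0 < C_fgn u :> R.
Proof. by move=> u01; rewrite /C_fgn fcoef0_fgn invr_gt0 J_fgn_gt0. Qed.

(* As [u] tends to [0] the tail blows up, but so does the normalizing integral: the tail at [t] is at most 27 times the tail at any other point, hence at most a multiple of [J (fgn_unnorm u)]. *)
Lemma f_fgn_le : exists2 C, 0 < C & forall u v t, 0 < u <= v -> v < 1 -> Upi t ->
  f_fgn u t <= C * fgn_unnorm v t.
Proof.
have pi0 := pi_gt0 R; have p30 : 0 < pi ^+ 3 :> R by rewrite exprn_gt0.
(* 14 = 1/2 + 27/2, the shares of the polar term and of the tail. One pi^3 comes from bounding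
   [|t| ^ - (2 u + 1)] below, the other from replacing u by v in that power. *)
exists (14 * pi ^+ 3 * pi ^+ 3); first by rewrite mulr_gt0// mulr_gt0.
move=> u v t /andP[u0 uv] v1 Ut; have tp := ltW (Upi_norm Ut).
have u01 : 0 < u < 1 by apply/andP; split => //; lra.
have Jg := J_fgn_gt0 u01.
rewrite /f_fgn /C_fgn fcoef0_fgn ler_pdivrMl//.
rewrite !fgn_unnorm_tail//; last lra.
have w0 := twoB2cos_ge0 t.
rewrite [leRHS](_ : _ = (2 - 2 * cos t) * (J (fgn_unnorm u) * (14 * pi ^+ 3 * pi ^+ 3 * (`|t| `^ (- (2 * v + 1)) + fgn_tail (2 * v + 1) t)))); last by ring.
apply: ler_wpM2l => //.
have h3 : `|t| `^ (- (2 * u + 1)) <= pi ^+ 3 * `|t| `^ (- (2 * v + 1)).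
  by apply: powR_split_pi3 => //; apply/andP; split; lra.
have h13 : 0 <= 2 * u + 1 <= 3 by apply/andP; split; lra.
have h13' : 1 < 2 * u + 1 <= 3 by apply/andP; split; lra.
have pge s : Upi s -> pi ^- 3 <= `|s| `^ (- (2 * u + 1)) by exact: powRN_ge_pi.
have p3 : 0 <= pi ^- 3 :> R by rewrite invr_ge0 ltW.
have J1 : 2 * pi ^- 3 <= J (fgn_unnorm u).
  by apply: J_fgn_ge => // s Us; apply: (le_trans (pge s Us)); rewrite lerDl fgn_tail_ge0.
have J2 : 2 * (fgn_tail (2 * u + 1) t / 27) <= J (fgn_unnorm u).
  apply: J_fgn_ge => //; first by rewrite divr_ge0// fgn_tail_ge0.
  move=> s Us; have := fgn_tail_comparable h13' tp (ltW (Upi_norm Us)).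
  have := powR_ge0 `|s| (- (2 * u + 1)); lra.
set a := `|t| `^ (- (2 * u + 1)); set T := fgn_tail _ t in J2 *.
have a0 : 0 <= a by exact: powR_ge0.
have pa : 1 <= pi ^+ 3 * a by rewrite -ler_pdivrMl// mulr1; exact: pge.
have J1' : 2 <= pi ^+ 3 * J (fgn_unnorm u) by rewrite -ler_pdivrMl// mulrC.
have h1 : a <= J (fgn_unnorm u) * (pi ^+ 3 / 2 * a).
  rewrite [leRHS](_ : _ = (pi ^+ 3 * J (fgn_unnorm u)) / 2 * a); last by ring.
  by rewrite -[leLHS]mul1r; apply: ler_wpM2r => //; lra.
have h2 : T <= J (fgn_unnorm u) * (27 / 2 * (pi ^+ 3 * a)).
  apply: (@le_trans _ _ (J (fgn_unnorm u) * (27 / 2))); first lra.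
  by apply: ler_wpM2l; [exact: ltW|rewrite ler_peMr].
apply: (@le_trans _ _ (J (fgn_unnorm u) * (14 * pi ^+ 3 * a))).
  rewrite [leRHS](_ : _ = J (fgn_unnorm u) * (pi ^+ 3 / 2 * a) + J (fgn_unnorm u) * (27 / 2 * (pi ^+ 3 * a))); last by field.
  exact: lerD.
apply: ler_wpM2l; first exact: ltW.
rewrite -!(mulrA (14 * pi ^+ 3)); apply: ler_wpM2l; first by rewrite mulr_ge0// ltW.
apply: (le_trans h3); apply: ler_wpM2l; first exact: ltW.
by rewrite lerDl fgn_tail_ge0.
Qed.

Lemma toeplitzZ n c (g : R -> R) : measurable_fun setT g -> iJ g ->
  toeplitz n (fun t => c * g t) = c *: toeplitz n g.
Proof.
move=> mg ig; apply/matrixP => i j; rewrite !mxE !fcoefE//; last exact: measurable_funM.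
rewrite -JZ; last exact: iJ_cosM.
by apply: eq_J => t _; rewrite mulrCA.
Qed.

Lemma toeplitz_fgn_posdef n u : 0 < u < 1 ->
  forall x : 'cV[R]_n, x != 0 -> 0 < bform (toeplitz n (fgn_unnorm u)) x x.
Proof.
move=> u01; have /andP[u0 u1] := u01.
by apply: toeplitz_posdef (fgn_weight u01); rewrite ?gt_max ?le_max ?lexx ?ltr01//=; lra.
Qed.

(** The normalization is left out because the comparison in [u] holds for [fgn_unnorm]; it returns
    as the factor [J (fgn_unnorm u)]. *)
Definition rho_unnorm n (x : 'cV[R]_n) u : R :=
  n%:R^-1 * bform (invmx (toeplitz n (fgn_unnorm u))) x x.

Lemma toeplitz_f_fgn n u : 0 < u < 1 ->
  toeplitz n (f_fgn u) = C_fgn u *: toeplitz n (fgn_unnorm u : R -> R).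
Proof. by move=> u01; apply: toeplitzZ; [exact: measurable_fgn_unnorm|exact: iJ_fgn]. Qed.

Lemma rho_nE n (x : 'cV[R]_n) u : 0 < u < 1 ->
  rho_n x u = J (fgn_unnorm u) * rho_unnorm x u.
Proof.
move=> u01; have C0 := C_fgn_gt0 u01.
have uT := bform_posdef_unit (toeplitz_fgn_posdef u01 (n := n)).
rewrite /rho_n toeplitz_f_fgn// invmxZ; last by rewrite unitmxZ ?unitfE ?gt_eqF.
rewrite -scalemxAr -scalemxAl mxE /rho_unnorm /bform mulrCA /C_fgn fcoef0_fgn invrK.
by [].
Qed.

(** The normalized density stands on the side of [u] so that [f_fgn_le] applies with one constant
    for all [u] down to 0. *)
Lemma rho_n_ge n (x : 'cV[R]_n) c u v : 0 < u < 1 -> 0 < v < 1 -> 0 < c ->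
  (forall t, Upi t -> f_fgn u t <= c * fgn_unnorm v t) ->
  c^-1 * rho_unnorm x v <= rho_n x u.
Proof.
move=> u01 v01 c0 H; have C0 := C_fgn_gt0 u01.
have mf : measurable_fun setT (f_fgn u : R -> R) by apply: measurable_funM => //; exact: measurable_fgn_unnorm.
have i_f : iJ (f_fgn u : R -> R) by apply: iJZ; exact: iJ_fgn.
have pf (y : 'cV[R]_n) : y != 0 -> 0 < bform (toeplitz n (f_fgn u)) y y.
  by move=> y0; rewrite toeplitz_f_fgn// bformMZ mulr_gt0// toeplitz_fgn_posdef.
have := bform_invmx_le (toeplitz_sym n _) pf (toeplitz_sym n _) (toeplitz_fgn_posdef v01 (n := n))
  (toeplitz_le mf (measurable_fgn_unnorm v) i_f (iJ_fgn v01) H).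
move=> /(_ x) h; rewrite /rho_unnorm /rho_n mulrCA ler_wpM2l ?invr_ge0//.
by rewrite ler_pdivrMl.
Qed.

Lemma rho_unnorm_le n (x : 'cV[R]_n) c u v : 0 < u < 1 -> 0 < v < 1 ->
  (forall t, Upi t -> fgn_unnorm u t <= c * fgn_unnorm v t) ->
  rho_unnorm x v <= c * rho_unnorm x u.
Proof.
move=> u01 v01 H.
have := bform_invmx_le (toeplitz_sym n _) (toeplitz_fgn_posdef u01 (n := n)) (toeplitz_sym n _) (toeplitz_fgn_posdef v01 (n := n))
  (toeplitz_le (measurable_fgn_unnorm u) (measurable_fgn_unnorm v) (iJ_fgn u01) (iJ_fgn v01) H).
by move=> /(_ x) h; rewrite /rho_unnorm mulrCA ler_wpM2l ?invr_ge0.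
Qed.

End FgnComparison.

(** * Uniformity in the Hurst parameter *)

Section Sandwich.
Variable R : realType.
Implicit Types (a b u v eps : R).

(* Monotonicity up to a factor close to 1 lets convergence at two nearby rational points control everything in between, as in Dini's second theorem. *)
Lemma quasi_monotone_cvg (rho : nat -> R -> R) (L : R -> R) a b u0 K C M :
  a < u0 < b -> 0 < K -> 0 < C -> 0 < M ->
  (forall n u, 0 <= rho n u) -> (forall u, 0 <= L u) ->
  (forall n u v, a <= u <= v -> v <= b -> rho n v <= (1 + K * (v - u)) * rho n u) ->
  (forall u v, a <= u <= v -> v <= b -> L v <= (1 + K * (v - u)) * L u) ->
  (forall u v, a <= u <= v -> v <= b -> L u <= L v + C * (v - u)) ->
  (forall u, a <= u <= b -> L u <= M) ->
  (forall q : rat, a <= ratr q <= b -> rho n (ratr q) @[n --> \oo] --> L (ratr q)) ->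
  forall eps, 0 < eps -> exists2 d, 0 < d & exists N, forall n u, (N <= n)%N ->
    `|u - u0| < d -> `|rho n u - L u| < eps.
Proof.
move=> /andP[au ub] K0 C0 M0 rho0 L0 rhoK LK LC LM cv eps e0.
(* With k = K (r2 - r1), the estimate of [rho n u] from below loses C (r2 - r1) + 3 k M + 3 eps / 8,
   which is where the 3 originates. *)
pose B := C + 3 * K * M.
have B0 : 0 < B by rewrite addr_gt0// !mulr_gt0.
(* The entries keep the two rational points in [a, b], make k <= 1, and make B (r2 - r1) <= eps /
   2. *)
pose eta := Num.min (Num.min (u0 - a) (b - u0)) (Num.min (1 / (2 * K)) (eps / (4 * B))).
have eta0 : 0 < eta by rewrite !lt_min !subr_gt0 au ub !divr_gt0// mulr_gt0.
have [q1 q1E] : exists q : rat, u0 - eta < ratr q < u0.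
  have [|q] := @rat_in_itvoo R (u0 - eta) u0; first lra.
  by rewrite in_itv/=; exists q.
have [q2 q2E] : exists q : rat, u0 < ratr q < u0 + eta.
  have [|q] := @rat_in_itvoo R u0 (u0 + eta); first lra.
  by rewrite in_itv/=; exists q.
have ea : eta <= u0 - a by rewrite /eta !ge_min lexx.
have eb : eta <= b - u0 by rewrite /eta !ge_min lexx orbT.
have eK : eta * (2 * K) <= 1.
  by rewrite -ler_pdivlMr ?mulr_gt0// /eta !ge_min lexx !orbT.
have eB : eta * (4 * B) <= eps.
  by rewrite -ler_pdivlMr ?mulr_gt0// /eta !ge_min lexx !orbT.
move: (q1E) (q2E); set r1 : R := ratr q1; set r2 : R := ratr q2 => /andP[r1l r1u] /andP[r2l r2u].
have ar1 : a <= r1 by lra.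
have r2b : r2 <= b by lra.
have e8 : 0 < eps / 8 by rewrite divr_gt0.
have [|N1 _ H1] := @cvgr_dist_lt _ _ _ _ _ _ _ (cv q1 _) (eps / 8) e8; first by rewrite -/r1; lra.
have [|N2 _ H2] := @cvgr_dist_lt _ _ _ _ _ _ _ (cv q2 _) (eps / 8) e8; first by rewrite -/r2; lra.
exists (Num.min (u0 - r1) (r2 - u0)); first by rewrite lt_min !subr_gt0 r1u r2l.
exists (maxn N1 N2) => n u; rewrite geq_max => /andP[n1 n2].
rewrite lt_min ltr_norml (ltr_norml _ (r2 - u0)) => /andP[/andP[u1 _] /andP[_ u2]].
have r1u' : r1 <= u by lra.
have ur2 : u <= r2 by lra.
have au' := le_trans ar1 r1u'; have ub' := le_trans ur2 r2b.
have r12 := le_trans r1u' ur2; have ar2 := le_trans ar1 r12; have r1b := le_trans r12 r2b.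
have := H1 n n1; have := H2 n n2; rewrite /= -/r1 -/r2 !ltr_norml => /andP[c1 c2] /andP[c3 c4].
pose k := K * (r2 - r1).
have h0 : 0 <= r2 - r1 by rewrite subr_ge0.
have k0 : 0 <= k by rewrite mulr_ge0// ltW.
have hle : r2 - r1 <= 2 * eta by lra.
have k1 : k <= 1.
  have : k <= K * (2 * eta) by apply: ler_wpM2l => //; exact: ltW.
  by move/le_trans; apply; rewrite mulrCA mulrA mulrC.
have hB : B * (r2 - r1) <= eps / 2.
  have : B * (r2 - r1) <= B * (2 * eta) by apply: ler_wpM2l => //; exact: ltW.
  by move: eB; rewrite (_ : eta * (4 * B) = 2 * (B * (2 * eta))); [lra|ring].
have up1 (x y : R) : r1 <= x -> x <= y -> y <= r2 -> 1 + K * (y - x) <= 1 + k.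
  by move=> *; rewrite lerD2l; apply: ler_wpM2l; [exact: ltW|lra].
have A1 : rho n u <= (1 + k) * rho n r1.
  apply: (@le_trans _ _ ((1 + K * (u - r1)) * rho n r1)); first by apply: rhoK; rewrite ?ar1.
  by apply: ler_wpM2r => //; apply: up1.
have A2 : L u <= (1 + k) * L r1.
  apply: (@le_trans _ _ ((1 + K * (u - r1)) * L r1)); first by apply: LK; rewrite ?ar1.
  by apply: ler_wpM2r => //; apply: up1.
have A3 : rho n r2 <= (1 + k) * rho n u.
  apply: (@le_trans _ _ ((1 + K * (r2 - u)) * rho n u)); first by apply: rhoK; rewrite ?au'.
  by apply: ler_wpM2r => //; apply: up1.
have A4 : L r2 <= (1 + k) * L u.
  apply: (@le_trans _ _ ((1 + K * (r2 - u)) * L u)); first by apply: LK; rewrite ?au'.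
  by apply: ler_wpM2r => //; apply: up1.
have A5 : L r1 <= L r2 + C * (r2 - r1) by apply: LC; rewrite ?ar1.
have M1 : L r1 <= M by apply: LM; rewrite ar1.
have Mu : L u <= M by apply: LM; rewrite au'.
have kM : 0 <= k * M by rewrite mulr_ge0// ltW.
have P1 : k * rho n r1 <= k * M + eps / 8.
  apply: (@le_trans _ _ (k * (M + eps / 8))); first by apply: ler_wpM2l => //; lra.
  by rewrite mulrDr lerD2l ler_piMl// ltW.
have P2 : k * L r1 <= k * M by apply: ler_wpM2l.
have P3 : k * L u <= k * M by apply: ler_wpM2l.
have ru : rho n u <= 2 * (M + eps / 8).
  apply: (le_trans A1); apply: (@le_trans _ _ (2 * rho n r1)).
    by apply: ler_wpM2r => //; lra.
  by apply: ler_wpM2l => //; lra.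
have P4 : k * rho n u <= 2 * (k * M) + 2 * (eps / 8).
  apply: (@le_trans _ _ (k * (2 * (M + eps / 8)))); first by apply: ler_wpM2l.
  rewrite (_ : k * (2 * (M + eps / 8)) = 2 * (k * M) + 2 * (k * (eps / 8))); last by ring.
  by rewrite lerD2l ler_pM2l// ler_piMl// ltW.
have BE : B * (r2 - r1) = C * (r2 - r1) + 3 * (k * M) by rewrite /B /k; ring.
move: A1 A2 A3 A4; rewrite !mulrDl !mul1r => A1 A2 A3 A4.
move: kM hB A1 A2 A3 A4 A5 P1 P2 P3 P4 c1 c2 c3 c4 e0; rewrite BE.
move: (rho n u) (rho n r1) (rho n r2) (L u) (L r1) (L r2) => x x1 x2 l l1 l2.
move: (k * x) (k * x1) (k * l) (k * l1) (k * M) (C * (r2 - r1)) => kx kx1 kl kl1 kM' ch.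
by clear; move=> *; apply/andP; split; lra.
Qed.

End Sandwich.

(** * Regularity and blow-up of the limit *)

Section Limit.
Variables (R : realType) (Hh : R).
Notation Upi := (@Upi R).
Implicit Types (t u v c d e : R).
Hypothesis Hh01 : 0 < Hh < 1.

Definition rho_unnorm_lim u : R := J (fun t => f_fgn Hh t / fgn_unnorm u t).
Notation L := rho_unnorm_lim.

Let f_weight : weight (Num.max 0 (2 * Hh - 1)) (Num.max 0 (1 - 2 * Hh)) (f_fgn Hh).
Proof. by apply: weightZ (fgn_weight Hh01); exact: C_fgn_gt0. Qed.

Lemma f_fgn_ub : exists2 C, 0 < C & forall t, Upi t -> f_fgn Hh t <= C * `|t| `^ (1 - 2 * Hh).
Proof.
have /andP[H0 H1] := Hh01; have [C C0 HC] := fgn_unnorm_ub Hh01.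
have c0 := C_fgn_gt0 Hh01.
exists (C_fgn Hh * C); first exact: mulr_gt0.
by move=> t Ut; rewrite -mulrA ler_pM2l//; apply: HC => //; rewrite lexx ltW.
Qed.

Lemma fgn_ratio_ub : exists2 C, 0 < C & forall u t, 0 < u -> Upi t ->
  f_fgn Hh t / fgn_unnorm u t <= C * `|t| `^ (- (2 * Hh - 2 * u)).
Proof.
have s0 := sinc0_gt0 R; have s2 : 0 < sinc0 R ^+ 2 by rewrite exprn_gt0.
have [C C0 HC] := f_fgn_ub; exists (C / sinc0 R ^+ 2); first exact: divr_gt0.
move=> u t u0 Ut; have t0 := Upi_neq0 Ut; have lb := fgn_unnorm_lb u0 Ut.
have p0 : 0 < `|t| `^ (1 - 2 * u) by rewrite powR_gt0.
have l0 : 0 < sinc0 R ^+ 2 * `|t| `^ (1 - 2 * u) by exact: mulr_gt0.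
have g0 := lt_le_trans l0 lb.
rewrite ler_pdivrMr//; apply: (le_trans (HC t Ut)).
apply: (@le_trans _ _ (C / sinc0 R ^+ 2 * `|t| `^ (- (2 * Hh - 2 * u)) * (sinc0 R ^+ 2 * `|t| `^ (1 - 2 * u)))).
  rewrite (_ : 1 - 2 * Hh = - (2 * Hh - 2 * u) + (1 - 2 * u)); last by ring.
  rewrite powRD; last by rewrite (gt_eqF t0) implybT.
  by rewrite le_eqVlt; apply/orP; left; apply/eqP; field; rewrite gt_eqF.
by apply: ler_wpM2l => //; apply: mulr_ge0; [apply: ltW; exact: divr_gt0|exact: powR_ge0].
Qed.

Lemma measurable_fgn_ratio u : measurable_fun setT (fun t : R => f_fgn Hh t / fgn_unnorm u t).
Proof.
apply: measurable_funM; first by apply: measurable_funM => //; exact: measurable_fgn_unnorm.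
rewrite (_ : (fun t => _) = fun t => fgn_unnorm u t `^ (-1)); last first.
  by apply/funext => t; rewrite powR_inv1// fgn_unnorm_ge0.
by apply: (measurableT_comp (measurable_powR _)); exact: measurable_fgn_unnorm.
Qed.

Lemma fgn_ratio_ge0 u t : 0 <= f_fgn Hh t / fgn_unnorm u t.
Proof.
by rewrite divr_ge0 ?fgn_unnorm_ge0// mulr_ge0 ?fgn_unnorm_ge0// ltW// C_fgn_gt0.
Qed.

Lemma I_set01 u : I_set Hh u -> 0 < u < 1.
Proof. by case=> _ [-> ->]. Qed.

Lemma iJ_fgn_ratio u : I_set Hh u -> iJ (fun t => f_fgn Hh t / fgn_unnorm u t).
Proof.
move=> [Hu [u1 u0]]; have [C C0 HC] := fgn_ratio_ub.
apply: (@iJ_dom _ _ (fun t => C * `|t| `^ (- (2 * Hh - 2 * u)))).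
- exact: measurable_fgn_ratio.
- by apply: iJZ; apply: iJ_powR; lra.
- move=> t Ut; rewrite ger0_norm ?fgn_ratio_ge0//.
  by apply: le_trans (HC u t u0 Ut) _; exact: ler_norm.
Qed.

Lemma rho_inftyE u : I_set Hh u -> rho_infty Hh u = J (fgn_unnorm u) * L u.
Proof.
move=> Iu; have u01 := I_set01 Iu; have Jg := J_fgn_gt0 u01.
have E t : f_fgn Hh t / f_fgn u t = J (fgn_unnorm u) * (f_fgn Hh t / fgn_unnorm u t).
  by rewrite [f_fgn u t]/f_fgn /C_fgn fcoef0_fgn invfM invrK mulrCA.
rewrite /rho_infty RintegralE; last first.
  under eq_fun do rewrite E.
  by apply: measurable_funM => //; exact: measurable_fgn_ratio.
by rewrite /L -JZ ?iJ_fgn_ratio//; apply: eq_J => t _; exact: E.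
Qed.

Lemma rho_unnorm_lim_ge0 u : 0 <= L u.
Proof. by apply: J_ge0 => t _; exact: fgn_ratio_ge0. Qed.

Lemma rho_unnorm_lim_le c u v : I_set Hh u -> I_set Hh v ->
  (forall t, Upi t -> fgn_unnorm u t <= c * fgn_unnorm v t) -> L v <= c * L u.
Proof.
move=> Iu Iv H; rewrite /L -JZ ?iJ_fgn_ratio//.
apply: le_J; [exact: iJ_fgn_ratio|by apply: iJZ; exact: iJ_fgn_ratio|move=> t Ut].
have gu := weight_gt0 (fgn_weight (I_set01 Iu)) Ut.
have gv := weight_gt0 (fgn_weight (I_set01 Iv)) Ut.
have f0 : 0 <= f_fgn Hh t by exact: weight_ge0 f_weight _.
rewrite mulrCA; apply: ler_wpM2l => //.
by rewrite ler_pdivlMr// mulrC ler_pdivrMr// H.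
Qed.

(** The converse of the quasi-monotonicity of [L]: the two one-sided bounds together control its
    oscillation between nearby points. *)
Lemma rho_unnorm_lim_lipschitz a b : I_set Hh a -> I_set Hh b -> exists2 C, 0 < C &
  forall u v, a <= u <= v -> v <= b -> L u <= L v + C * (v - u).
Proof.
move=> [Ha [a1 a0]] [Hb [b1 b0]]; have [C C0 HC] := fgn_ratio_ub.
have /andP[H0 H1] := Hh01; have pi0 := pi_gt0 R.
(* [d] is the distance from [a] to the critical value; e = 1 - d stays integrable after the factor
   |t|^-d lost in the linearization. *)
pose d := a - (Hh - 2^-1); have d0 : 0 < d by rewrite /d; lra.
pose e := 2 * Hh - 2 * a + d; have e1 : e < 1 by rewrite /e /d; lra.
have Je0 : 0 <= J (fun t : R => `|t| `^ (- e)) by apply: J_ge0 => t _; exact: powR_ge0.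
have p30 : 0 < pi ^+ 3 :> R by rewrite exprn_gt0.
have c0 : 0 < 2 / d * C * pi ^+ 3 by apply: mulr_gt0 => //; apply: mulr_gt0 => //; exact: divr_gt0.
exists (2 / d * C * pi ^+ 3 * J (fun t : R => `|t| `^ (- e)) + 1).
  by rewrite ltr_wpDl// mulr_ge0// ltW.
move=> u v /andP[au uv] vb.
have Iu : I_set Hh u by split; [lra|split; lra].
have Iv : I_set Hh v by split; [lra|split; lra].
have vu : 0 <= v - u by rewrite subr_ge0.
apply: (@le_trans _ _ (L v + (v - u) * (2 / d * C * pi ^+ 3) * J (fun t : R => `|t| `^ (- e)))); last first.
  set Je := J _ in Je0 *; rewrite lerD2l.
  by rewrite [leRHS](_ : _ = (v - u) * (2 / d * C * pi ^+ 3) * Je + (v - u)) ?lerDl//; ring.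
rewrite /L -JZ; last exact: iJ_powR.
rewrite -JD; [|exact: iJ_fgn_ratio|by apply: iJZ; exact: iJ_powR].
apply: le_J; [exact: iJ_fgn_ratio|by apply: iJD; [exact: iJ_fgn_ratio|apply: iJZ; exact: iJ_powR]|move=> t Ut].
have t0 := Upi_neq0 Ut.
have gu := weight_gt0 (fgn_weight (I_set01 Iu)) Ut.
have gv := weight_gt0 (fgn_weight (I_set01 Iv)) Ut.
have f0 : 0 <= f_fgn Hh t by exact: weight_ge0 f_weight _.
have r0 := fgn_ratio_ge0 v t.
have u0 : 0 < u by lra.
have v0 : 0 < v by lra.
have h1 : f_fgn Hh t / fgn_unnorm u t <= `|t| `^ (- (2 * (v - u))) * (f_fgn Hh t / fgn_unnorm v t).
  rewrite mulrCA; apply: ler_wpM2l => //.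
  by rewrite ler_pdivlMr// mulrC ler_pdivrMr// fgn_unnorm_antitone.
have tV : 0 < `|t|^-1 by rewrite invr_gt0.
have powV x : `|t|^-1 `^ x = `|t| `^ (- x).
  by rewrite -powR_inv1// -powRrM mulN1r.
have uv2 : 0 <= 2 * (v - u) by rewrite mulr_ge0.
have h2 : `|t| `^ (- (2 * (v - u))) <= 1 + 2 * (v - u) / d * `|t| `^ (- (2 * (v - u) + d)).
  by have := powR_le_linear uv2 d0 tV; rewrite !powV.
apply: (le_trans h1); apply: (le_trans (ler_wpM2r r0 h2)); rewrite mulrDl mul1r lerD2l.
apply: (@le_trans _ _ (2 * (v - u) / d * `|t| `^ (- (2 * (v - u) + d)) * (C * `|t| `^ (- (2 * Hh - 2 * v))))).
  apply: ler_wpM2l; last exact: HC.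
  by rewrite mulr_ge0 ?powR_ge0// divr_ge0// ltW.
rewrite (_ : 2 * (v - u) / d * _ * _ = (v - u) * (2 / d * C) * (`|t| `^ (- (2 * (v - u) + d)) * `|t| `^ (- (2 * Hh - 2 * v)))); last by ring.
rewrite -powRD; last by rewrite (gt_eqF t0) implybT.
rewrite (_ : (v - u) * (2 / d * C * pi ^+ 3) * _ = (v - u) * (2 / d * C) * (pi ^+ 3 * `|t| `^ (- e))); last by ring.
apply: ler_wpM2l; first by rewrite !mulr_ge0// ?invr_ge0 ltW.
by apply: powR_split_pi3 => //; rewrite /e; apply/andP; split; lra.
Qed.

Lemma J_fgn_locally_bounded a b : 0 < a -> b < 1 -> exists2 G, 0 < G &
  forall u, a <= u <= b -> J (fgn_unnorm u) <= G.
Proof.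
move=> a0 b1; have [ab|ba] := leP a b; last first.
  by exists 1 => // u /andP[au ub]; exfalso; have := le_trans au ub; rewrite leNgt ba.
have a01 : 0 < a < 1 by apply/andP; split => //; lra.
have [C C0 HC] := fgn_unnorm_ub a01; have pi0 := pi_gt0 R.
have p30 : 0 < pi ^+ 3 :> R by rewrite exprn_gt0.
have Je0 : 0 <= J (fun t : R => `|t| `^ (- (2 * b - 1))) by apply: J_ge0 => t _; exact: powR_ge0.
have e1 : 2 * b - 1 < 1 by lra.
exists (C * pi ^+ 3 * J (fun t : R => `|t| `^ (- (2 * b - 1))) + 1).
  by rewrite ltr_wpDl// mulr_ge0// ltW// mulr_gt0.
move=> u /andP[au ub]; apply: (@le_trans _ _ (C * pi ^+ 3 * J (fun t : R => `|t| `^ (- (2 * b - 1))))); last by rewrite lerDl.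
rewrite -JZ; last exact: iJ_powR.
have u01 : 0 < u < 1 by apply/andP; split; lra.
apply: le_J; [exact: iJ_fgn|by apply: iJZ; exact: iJ_powR|move=> t Ut].
have u1 : a <= u <= 1 by apply/andP; split; lra.
apply: (le_trans (HC u t u1 Ut)); rewrite -mulrA ler_pM2l//.
by apply: powR_split_pi3 => //; apply/andP; split; lra.
Qed.

(** The integrand is at least a multiple of |t|^-a with a = 2 Hh - 2 v, whose integral over (0, 1]
    is 1 / (1 - a), and 1 - a = 2 (v - (Hh - 1/2)). *)
Lemma rho_unnorm_lim_blowup : 0 < Hh - 2^-1 -> exists2 c, 0 < c &
  forall v, I_set Hh v -> c / (v - (Hh - 2^-1)) <= L v.
Proof.
move=> h0; have /andP[H0 H1] := Hh01; have pi0 := pi_gt0 R; have p2 := pi_ge2 R.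
have s0 := sinc0_gt0 R; have s2 : 0 < sinc0 R ^+ 2 by rewrite exprn_gt0.
have cf := C_fgn_gt0 Hh01.
have h01 : 0 < Hh - 2^-1 < 1 by apply/andP; split; lra.
have [C C0 HC] := fgn_unnorm_ub h01.
pose c := C_fgn Hh * sinc0 R ^+ 2 / C.
have c0 : 0 < c by rewrite divr_gt0// mulr_gt0.
exists (c * ((pi *+ 2)^-1 * 2^-1)); first by rewrite mulr_gt0// mulr_gt0// invr_gt0 mulrn_wgt0.
move=> v Iv; have [Hv [v1 v0]] := Iv.
pose a := 2 * Hh - 2 * v; have a1 : a < 1 by rewrite /a; lra.
have key : c * J (fun t : R => `|t| `^ (- a)) <= L v.
  rewrite -JZ; last exact: iJ_powR.
  apply: le_J; [by apply: iJZ; exact: iJ_powR|exact: iJ_fgn_ratio|move=> t Ut].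
  have t0 := Upi_neq0 Ut; have gv := weight_gt0 (fgn_weight (I_set01 Iv)) Ut.
  have v1' : Hh - 2^-1 <= v <= 1 by apply/andP; split; lra.
  have pa : 0 <= `|t| `^ (- a) by exact: powR_ge0.
  rewrite ler_pdivlMr//; apply: (@le_trans _ _ (c * `|t| `^ (- a) * (C * `|t| `^ (1 - 2 * v)))).
    by apply: ler_wpM2l; [apply: mulr_ge0 => //; exact: ltW|exact: HC].
  rewrite (_ : c * _ * _ = C_fgn Hh * (sinc0 R ^+ 2 * (`|t| `^ (- a) * `|t| `^ (1 - 2 * v)))); last first.
    by rewrite /c; field; rewrite gt_eqF.
  rewrite -powRD; last by rewrite (gt_eqF t0) implybT.
  rewrite (_ : - a + (1 - 2 * v) = 1 - 2 * Hh); last by rewrite /a; ring.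
  by rewrite ler_pM2l//; exact: fgn_unnorm_lb.
apply: le_trans key; rewrite -mulrA ler_pM2l// /J -mulrA ler_pM2l; last by rewrite invr_gt0 mulrn_wgt0.
have d01 : 0 < (1 : R) < pi by apply/andP; split => //; lra.
have := integral_powR_lb a1 d01; rewrite powR1 mul1r => h.
rewrite -lee_fin /Rintegral fineK; last by apply: integrable_fin_num; [exact: measurable_Upi|exact: iJ_powR].
apply: le_trans h; rewrite lee_fin -invfM le_eqVlt; apply/orP; left; apply/eqP; congr (_^-1).
by rewrite /a; field.
Qed.

End Limit.

(** * From rational parameters to all parameters, for a fixed sequence *)

Section LocalConvergence.
Variables (R : realType) (Hh : R).
Hypothesis Hh01 : 0 < Hh < 1.
Variable x : forall n, 'cV[R]_n.
Hypothesis x_cvg : forall q : rat, I_set Hh (ratr q) ->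
  rho_unnorm (x n) (ratr q) @[n --> \oo] --> rho_unnorm_lim Hh (ratr q).
Implicit Types (u v a b eps : R).

Lemma rho_unnorm_ge0 n (y : 'cV[R]_n) u : 0 < u < 1 -> 0 <= rho_unnorm y u.
Proof.
move=> u01; rewrite /rho_unnorm mulr_ge0 ?invr_ge0//; apply: bform_posdef_ge0.
by apply: bform_invmx_posdef; [exact: toeplitz_sym|exact: toeplitz_fgn_posdef].
Qed.

Lemma rho_n_cvg_locally u0 eps : I_set Hh u0 -> 0 < eps -> exists2 d, 0 < d &
  exists N, forall n u, (N <= n)%N -> `|u - u0| < d ->
    `|rho_n (x n) u - rho_infty Hh u| < eps.
Proof.
move=> [Hu [u1 u0p]] e0.
pose lo := Num.max 0 (Hh - 2^-1).
have lo0 : 0 <= lo by rewrite le_max lexx.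
have loH : Hh - 2^-1 <= lo by rewrite le_max lexx orbT.
have lou : lo < u0 by rewrite gt_max u0p Hu.
pose a := (lo + u0) / 2; pose b := (u0 + 1) / 2.
have au : a < u0 by rewrite /a; lra.
have ub : u0 < b by rewrite /b; lra.
have loa : lo < a by rewrite /a; lra.
have b1 : b < 1 by rewrite /b; lra.
have Iab u : a <= u <= b -> I_set Hh u by move=> /andP[h1 h2]; split; [lra|split; lra].
have ab : a <= b by lra.
have Ia : I_set Hh a by apply: Iab; rewrite lexx.
have Ib : I_set Hh b by apply: Iab; rewrite ab lexx.
have a0 : 0 < a by lra.
have [K K0 HK] := fgn_unnorm_quasi_mono a0.
have [C C0 HC] := rho_unnorm_lim_lipschitz Hh01 Ia Ib.
have [G G0 HG] := J_fgn_locally_bounded a0 b1.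
pose M := rho_unnorm_lim Hh b + C * (b - a) + 1.
have M0 : 0 < M.
  by rewrite ltr_wpDl// addr_ge0 ?rho_unnorm_lim_ge0// mulr_ge0 ?subr_ge0// ltW.
(* [quasi_monotone_cvg] wants nonnegativity at every real [u], while the form is known to be
   nonnegative for [u] in (0, 1); clipping changes nothing on [a, b]. *)
pose clip u := if a <= u <= b then u else a.
have clipI u : a <= clip u <= b by rewrite /clip; case: ifP => // _; rewrite lexx.
have clipE u : a <= u <= b -> clip u = u by rewrite /clip => ->.
have [||||||||d d0 [N HN]] := @quasi_monotone_cvg R (fun n u => rho_unnorm (x n) (clip u))
  (rho_unnorm_lim Hh) a b u0 K C M _ K0 C0 M0 _ _ _ _ _ _ _ (eps / G) (divr_gt0 e0 G0).
- by rewrite au.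
- by move=> n u; apply: rho_unnorm_ge0; exact: I_set01 (Iab _ (clipI u)).
- by move=> u; exact: rho_unnorm_lim_ge0.
- move=> n u v /andP[h1 h2] h3.
  have h4 := le_trans h2 h3; have h5 := le_trans h1 h2.
  rewrite !clipE ?h1 ?h5//; apply: rho_unnorm_le.
  + by apply: I_set01 (Iab _ _); rewrite h1.
  + by apply: I_set01 (Iab _ _); rewrite h5.
  + by move=> t Ut; apply: HK => //; [rewrite h1|apply: le_trans h3 (ltW b1)].
- move=> u v /andP[h1 h2] h3.
  have h4 := le_trans h2 h3; have h5 := le_trans h1 h2.
  apply: rho_unnorm_lim_le => //; [by apply: Iab; rewrite h1|by apply: Iab; rewrite h5|].
  by move=> t Ut; apply: HK => //; [rewrite h1|apply: le_trans h3 (ltW b1)].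
- by move=> u v h1 h2; exact: HC.
- move=> u /andP[h1 h2]; apply: (@le_trans _ _ (rho_unnorm_lim Hh b + C * (b - u))).
    by apply: HC; rewrite ?h1.
  rewrite /M -addrA lerD2l; apply: (@le_trans _ _ (C * (b - a))); last by rewrite lerDl.
  by apply: ler_wpM2l; [exact: ltW|lra].
- by move=> q hq; rewrite clipE//; apply: x_cvg; exact: Iab.
exists (Num.min d (Num.min (u0 - a) (b - u0))); first by rewrite !lt_min d0 !subr_gt0 au.
exists N => n u Nn; rewrite !lt_min => /and3P[ud ua ub'].
have uab : a <= u <= b.
  by move: ua ub'; rewrite !ltr_norml => /andP[p1 p2] /andP[p3 p4]; apply/andP; split; lra.
have Iu := Iab u uab; have u01 := I_set01 Iu.
have := HN n u Nn ud; rewrite clipE// => h.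
rewrite rho_nE// rho_inftyE// -mulrBr normrM gtr0_norm ?J_fgn_gt0//.
apply: (@le_lt_trans _ _ (G * `|rho_unnorm (x n) u - rho_unnorm_lim Hh u|)).
  by apply: ler_wpM2r => //; exact: HG.
by rewrite -ltr_pdivlMl// mulrC.
Qed.

Lemma rho_n_cvg_compact (K : set R) : compact K -> K `<=` I_set Hh ->
  forall eps, 0 < eps -> exists N : nat, forall n, (N <= n)%N ->
    forall u, K u -> `|rho_n (x n) u - rho_infty Hh u| < eps.
Proof.
move=> /compact_near_coveringP cK KI eps e0.
have [|N _ HN] := cK nat \oo (fun n u => `|rho_n (x n) u - rho_infty Hh u| < eps) _.
  move=> u Ku; have [d d0 [N HN]] := rho_n_cvg_locally (KI u Ku) e0.
  exists (ball u d, [set n | (N <= n)%N]); first by split; [exact: nbhsx_ballx|exists N].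
  by move=> [v n] [/= uv Nn]; apply: HN => //; rewrite distrC.
by exists N => n Nn u Ku; exact: (HN n Nn).
Qed.

Lemma rho_n_diverges M : exists N : nat, forall n, (N <= n)%N ->
  forall u, 0 < u < 1 -> ~ I_set Hh u -> M <= rho_n (x n) u.
Proof.
have bad u : 0 < u < 1 -> ~ I_set Hh u -> u <= Hh - 2^-1.
  by move=> /andP[u0 u1] nI; rewrite leNgt; apply/negP => h; apply: nI.
have [h0|h0] := leP (Hh - 2^-1) 0.
  exists 0%N => n _ u u01 nI; exfalso; have := bad u u01 nI.
  by move: u01 => /andP[u0 _] h; have := le_trans h h0; rewrite leNgt u0.
have /andP[H0 H1] := Hh01.
have [C C0 HC] := f_fgn_le R.
have [c c0 Hc] := rho_unnorm_lim_blowup Hh01 h0.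
pose M' := C * (`|M| + 1); have M'0 : 0 < M' by rewrite mulr_gt0// ltr_wpDl.
(* 1/2 keeps the rational point [v] below Hh < 1; [c / M'] forces the limit at [v] above M' = C (|M|
   + 1). *)
pose eta := Num.min (1 / 2) (c / M').
have eta0 : 0 < eta by rewrite lt_min !divr_gt0.
have [q] : exists q : rat, Hh - 2^-1 < ratr q < Hh - 2^-1 + eta.
  have [|q] := @rat_in_itvoo R (Hh - 2^-1) (Hh - 2^-1 + eta); first by rewrite ltrDl.
  by rewrite in_itv/=; exists q.
set v : R := ratr q => /andP[v1 v2].
have e2 : eta <= 1 / 2 by rewrite ge_min lexx.
have eM : eta <= c / M' by rewrite ge_min lexx orbT.
have Iv : I_set Hh v by split; [|split; lra].
have v01 := I_set01 Iv; have /andP[v0 v1'] := v01.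
have LM : M' < rho_unnorm_lim Hh v.
  apply: lt_le_trans (Hc v Iv); rewrite ltr_pdivlMr ?subr_gt0// mulrC -ltr_pdivlMr//.
  by apply: lt_le_trans eM; rewrite ltrBlDl.
have [N _ HN] := @cvgr_gt _ _ _ _ _ _ (x_cvg Iv) _ LM.
exists N => n Nn u u01 nI; have uh := bad u u01 nI; have /andP[u0 u1] := u01.
have uv : 0 < u <= v by rewrite u0 (le_trans uh)// ltW.
have h := rho_n_ge (x n) u01 v01 C0 (fun t Ut => HC u v t uv v1' Ut).
apply: le_trans h; rewrite ler_pdivlMl//.
apply: (@le_trans _ _ M'); last by apply: ltW; exact: HN.
rewrite ler_pM2l//; have := ler_norm M; lra.
Qed.

End LocalConvergence.

Lemma rho_unnorm_cvg_ae (R : realType) (d : measure_display) (Omega : measurableType d)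
  (P : probability Omega R) (Hh : R) (xi : forall n : nat, Omega -> 'cV[R]_n) :
  0 < Hh < 1 ->
  (forall n : nat, centered_gaussian_vector P (xi n) (toeplitz n (f_fgn Hh))) ->
  {ae P, forall w, forall q : rat, I_set Hh (ratr q) ->
    rho_unnorm (xi n w) (ratr q) @[n --> \oo] --> rho_unnorm_lim Hh (ratr q)}.
Proof.
move=> Hh01 gxi; have /andP[H0 H1] := Hh01.
(* The rationals are enumerated by their codes so that the countable intersection of almost sure
   events applies. *)
have H : {ae P, forall w, forall k : nat, forall q : rat, unpickle k = Some q ->
    I_set Hh (ratr q) ->
    rho_unnorm (xi n w) (ratr q) @[n --> \oo] --> rho_unnorm_lim Hh (ratr q)}.
  apply: ae_foralln => k; case E : (unpickle k) => [q|]; last exact: aeW.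
  have [Iq|nI] := pselect (I_set Hh (ratr q : R)); last first.
    by apply: aeW => w q' [<-].
  have [Hq [q1 q0]] := Iq; have q01 := I_set01 Iq.
  have fW : weight (Num.max 0 (2 * Hh - 1)) (Num.max 0 (1 - 2 * Hh)) (f_fgn Hh).
    by apply: weightZ (fgn_weight Hh01); exact: C_fgn_gt0.
  have m01 (e : R) : e < 1 -> 0 <= Num.max 0 e < 1.
    by move=> e1; rewrite le_max lexx gt_max ltr01 e1.
  have := @quadratic_form_cvg_ae _ _ _ P (f_fgn Hh) (fgn_unnorm (ratr q)) _ _ _ _
    (m01 (2 * ratr q - 1) _) (m01 (1 - 2 * ratr q) _) (fgn_weight q01)
    (m01 (2 * Hh - 1) _) (m01 (1 - 2 * Hh) _) fW _ xi gxi.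
  move=> /(_ _ _ _ _ _)-h.
  apply: filterS (h _ _ _ _ _); try lra.
    by move=> w hw q' [<-] _.
  (* The sum of the two positive parts is 0, 2 Hh - 1, 1 - 2 q or 2 (Hh - q); the last is below 1
     because q > Hh - 1/2. *)
  by rewrite /Num.max; case: ifP; case: ifP; lra.
apply: filterS H => w Hw q; exact: (Hw (pickle q) q (pickleK q)).
Qed.

(** Divergence of the infimum is expressed by eventual lower bounds, which covers the empty set
    without a convention. An almost sure statement asks that the exceptional set lie in a null set,
    so its own measurability does not arise. *)
Theorem theorem102 (R : realType) (d : measure_display) (Omega : measurableType d)
  (P : probability Omega R) (Hh : R) (xi : forall n : nat, Omega -> 'cV[R]_n) :
  0 < Hh < 1 ->
  (forall n : nat, centered_gaussian_vector P (xi n) (toeplitz n (f_fgn Hh))) ->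
  {ae P, forall w : Omega,
     (forall K : set R, compact K -> K `<=` I_set Hh ->
        forall eps : R, 0 < eps -> exists N : nat, forall n : nat, (N <= n)%N ->
          forall u : R, K u -> `|rho_n (xi n w) u - rho_infty Hh u| < eps) /\
     (forall M : R, exists N : nat, forall n : nat, (N <= n)%N ->
        forall u : R, 0 < u < 1 -> ~ I_set Hh u -> M <= rho_n (xi n w) u)}.
Proof.
move=> Hh01 gxi; apply: filterS (rho_unnorm_cvg_ae Hh01 gxi) => w Hw; split.
  exact: (rho_n_cvg_compact Hh01 Hw).
exact: (rho_n_diverges Hh01 Hw).
Qed.
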